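(* Consider the space-like curves $X$ in $\mathbf R^{1,1}$, other than straight lines, which expand under the mean curvature flow with scaling function $\sqrt{2t+1}$, $t>-\frac12$ (i.e. $\sqrt{2t+1}\,X$ is a solution of the flow). There are six types of such curves, including the expanding hyperbola $y^2-x^2 = 2t+1$. Each such curve is convex, asymptotic to a cone, and $k^2e^{\langle X,X\rangle}$ is constant along it. Under the flow, it comes out of this cone (translated so that its vertex lies at the origin) at $t=-\frac12$ and expands out to infinity as $t\to\infty$.
   Context: $\mathbf R^{1,1}$ is $\mathbf R^2$ with $\langle (x_1,y_1),(x_2,y_2)\rangle = x_1x_2-y_1y_2$; points $x+hy$, $h^2=1$. For a space-like curve ($\langle X_u,X_u\rangle>0$), $s$ is Minkowski arc-length, $T=X_s$, $N=hT$, $T_s=kN$; convex means $k>0$ everywhere or $k<0$ everywhere. Mean curvature flow: $\langle\partial_tX,N\rangle=-k$. Expanding with scaling function $\sqrt{2t+1}$ is equivalent to $-\langle X,N\rangle = k$. Types are counted up to reflection and distinguished by qualitative behaviour (ends of finite/infinite Minkowski length, limits of curvature at the ends, crossings of the light-like lines $y=\pm x$). *)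

(* Defs.v *)
From Stdlib Require Import Reals Lra List.
From Coquelicot Require Import Coquelicot.
Open Scope R_scope.

Definition pt := (R * R)%type.
Definition mink (p q : pt) : R := fst p * fst q - snd p * snd q.
(* multiplication by h (h^2 = 1): h (x + h y) = y + h x *)
Definition hmul (p : pt) : pt := (snd p, fst p).
Definition padd (p q : pt) : pt := (fst p + fst q, snd p + snd q).
Definition psub (p q : pt) : pt := (fst p - fst q, snd p - snd q).
Definition pscal (c : R) (p : pt) : pt := (c * fst p, c * snd p).
Definition enorm (p : pt) : R := sqrt (fst p ^ 2 + snd p ^ 2).

Definition dX (X : R -> pt) (s : R) : pt :=
  (Derive (fun t => fst (X t)) s, Derive (fun t => snd (X t)) s).
Definition ddX (X : R -> pt) (s : R) : pt := dX (dX X) s.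

(* T = X_s, N = h T, T_s = k N; since <N,N> = -1 this means k = - <T_s, N>. *)
Definition tang (X : R -> pt) (s : R) : pt := dX X s.
Definition norml (X : R -> pt) (s : R) : pt := hmul (tang X s).
Definition curv (X : R -> pt) (s : R) : R := - mink (ddX X s) (norml X s).

Definition in_intv (a b : Rbar) (s : R) : Prop :=
  Rbar_lt a (Finite s) /\ Rbar_lt (Finite s) b.

Definition expander_on (a b : Rbar) (X : R -> pt) : Prop :=
  Rbar_lt a b /\
  forall s, in_intv a b s ->
    ex_derive (fun t => fst (X t)) s /\ ex_derive (fun t => snd (X t)) s /\
    ex_derive (fun t => fst (dX X t)) s /\ ex_derive (fun t => snd (dX X t)) s /\
    mink (tang X s) (tang X s) = 1 /\
    - mink (X s) (norml X s) = curv X s.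

Definition maximal_expander (a b : Rbar) (X : R -> pt) : Prop :=
  expander_on a b X /\
  forall a' b' (Y : R -> pt), expander_on a' b' Y ->
    Rbar_le a' a -> Rbar_le b b' -> (forall s, in_intv a b s -> Y s = X s) ->
    a' = a /\ b' = b.

Definition straight_line (a b : Rbar) (X : R -> pt) : Prop :=
  exists P d : pt, d <> (0, 0) /\
    forall s, in_intv a b s -> exists c, X s = padd P (pscal c d).

Definition convex_curve (a b : Rbar) (X : R -> pt) : Prop :=
  (forall s, in_intv a b s -> 0 < curv X s) \/
  (forall s, in_intv a b s -> curv X s < 0).

Definition left_end (a : Rbar) : (R -> Prop) -> Prop :=
  match a with
  | Finite r => at_right r
  | p_infty => Rbar_locally p_infty
  | m_infty => Rbar_locally m_infty
  end.
Definition right_end (b : Rbar) : (R -> Prop) -> Prop :=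
  match b with
  | Finite r => at_left r
  | p_infty => Rbar_locally p_infty
  | m_infty => Rbar_locally m_infty
  end.

(* the end has finite Minkowski length (arc-length parametrisation) *)
Definition finite_end (a : Rbar) : bool :=
  match a with Finite _ => true | _ => false end.

Definition asymptotic_to_ray (F : (R -> Prop) -> Prop) (X : R -> pt) (P d : pt) : Prop :=
  (forall M, F (fun s => M < enorm (X s))) /\
  (forall eps, 0 < eps ->
     F (fun s => exists r, 0 <= r /\ enorm (psub (X s) (padd P (pscal r d))) < eps)).

Definition asymptotic_to_cone (a b : Rbar) (X : R -> pt) (P d1 d2 : pt) : Prop :=
  enorm d1 = 1 /\ enorm d2 = 1 /\ d1 <> d2 /\
  asymptotic_to_ray (left_end a) X P d1 /\ asymptotic_to_ray (right_end b) X P d2.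

Definition in_cone0 (d1 d2 c : pt) : Prop :=
  exists r, 0 <= r /\ (c = pscal r d1 \/ c = pscal r d2).

(* Under the flow X_t = sqrt(2t+1) X, the curves converge (locally
   Hausdorff) to the cone with vertex 0 as t -> -1/2+ ... *)
Definition emerges_from_cone (a b : Rbar) (X : R -> pt) (d1 d2 : pt) : Prop :=
  (forall c, in_cone0 d1 d2 c -> forall eps, 0 < eps ->
     exists delta, 0 < delta /\ forall t, -1/2 < t < -1/2 + delta ->
       exists s, in_intv a b s /\ enorm (psub (pscal (sqrt (2*t+1)) (X s)) c) < eps) /\
  (forall Rad eps, 0 < eps ->
     exists delta, 0 < delta /\ forall t, -1/2 < t < -1/2 + delta ->
       forall s, in_intv a b s -> enorm (pscal (sqrt (2*t+1)) (X s)) <= Rad ->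
         exists c, in_cone0 d1 d2 c /\ enorm (psub (pscal (sqrt (2*t+1)) (X s)) c) < eps).

Definition expands_to_infinity (a b : Rbar) (X : R -> pt) : Prop :=
  forall Rad, exists T0, forall t, T0 < t ->
    forall s, in_intv a b s -> Rad < enorm (pscal (sqrt (2*t+1)) (X s)).

Definition light_crossings (a b : Rbar) (X : R -> pt) (n : nat) : Prop :=
  exists l : list R, NoDup l /\ length l = n /\
    forall s, In s l <-> (in_intv a b s /\ mink (X s) (X s) = 0).

(* Qualitative profile of a curve: for each end (finite length?, limit of |k|),
   and the number of crossings of the light-like lines. *)
Definition end_data := (bool * Rbar)%type.
Definition profile := (end_data * end_data * nat)%type.

Definition has_profile (a b : Rbar) (X : R -> pt) (p : profile) : Prop :=
  match p with
  | ((f1, L1), (f2, L2), n) =>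
      f1 = finite_end a /\ f2 = finite_end b /\
      filterlim (fun s => Rabs (curv X s)) (left_end a) (Rbar_locally L1) /\
      filterlim (fun s => Rabs (curv X s)) (right_end b) (Rbar_locally L2) /\
      light_crossings a b X n
  end.

(* types are counted up to reflection: reversing the curve swaps the ends *)
Definition swap_profile (p : profile) : profile :=
  match p with (e1, e2, n) => (e2, e1, n) end.
Definition same_type (p q : profile) : Prop := p = q \/ swap_profile p = q.

Definition nonlinear_expander (a b : Rbar) (X : R -> pt) : Prop :=
  maximal_expander a b X /\ ~ straight_line a b X.

(* Main.v *)
(* Write X = t T + k N with t = <X,T>; for an expander k = -<X,N> is also the curvature. Then
   t' = 1 - k^2 and k' = - k t, a planar system with first integral k^2 e^(t^2 - k^2) =
   k^2 e^<X,X>, and the null component A = x' + y' of the tangent obeys A' = k A. The phase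
   plane has the saddle (0, 1), which is the hyperbola; with c = 2 ln k + t^2 - k^2, the orbits
   with k > 0 are the fixed point, the separatrices at c = -1 with k < 1 or k > 1, the orbits
   c > -1 (k runs over all of (0, oo)), and the two families c < -1 with k < 1 or k > 1: six types
   up to reversal. Each orbit is integrated by quadrature, so a maximal expander coincides with the
   explicit one through the same initial data. An end has k -> 0 (space-like asymptotic
   line through the origin), k -> 1 (light-like asymptote through the origin) or k -> oo at finite
   length (light-like asymptote not through the origin in general); the asymptotes of the two ends
   meet in the vertex of the cone. *)
Require Import Defs.
From Stdlib Require Import Reals List Lra Psatz.
From Stdlib Require Ranalysis5 FinFun.
From Coquelicot Require Import Coquelicot.
Open Scope R_scope.

(** * Intervals and their ends *)

(** The profile of a curve refers to the ends of its maximal interval, so local existence of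
    solutions is not enough: whole orbits with their exact intervals are needed. Inverting the
    integral of [1 / F] delivers both at once. The variable is [k] where [t] keeps its sign, and [t]
    or [- t] below the level -1, the maximum of [2 ln k - k^2], because there [t] passes through 0.
    Whether an end has finite length is then decided by differential inequalities rather than by
    evaluating the integral. A maximal expander and the explicit one are compared by gluing. Their
    union is an expander, so maximality puts the explicit interval inside the given one; conversely
    the explicit curve cannot be continued, since each of its ends is infinite or has unbounded
    curvature. Symmetries halve the work: reversal of arc length exchanges the ends, and reflection
    in the x-axis changes the sign of [k]. The delicate asymptote is the one at a flat end.
    Convergence of [A] gives only a direction; an actual asymptotic line requires [t] times the
    error of [A] to tend to 0, and the first integral supplies this decay. *)

Lemma intv_between a b s1 s2 x :
  in_intv a b s1 -> in_intv a b s2 -> s1 <= x <= s2 -> in_intv a b x.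
Proof.
  intros [H1 _] [_ H2] Hx; split.
  - apply Rbar_lt_le_trans with (1 := H1); exact (proj1 Hx).
  - apply Rbar_le_lt_trans with (2 := H2); exact (proj2 Hx).
Qed.

Lemma intv_open a b s : in_intv a b s -> locally s (in_intv a b).
Proof.
  intros [H1 H2]; apply filter_and.
  - exact (open_Rbar_gt' _ _ H1).
  - exact (open_Rbar_lt' _ _ H2).
Qed.

Lemma intv_nonempty a b : Rbar_lt a b -> exists s, in_intv a b s.
Proof.
  destruct a as [a| |], b as [b| |]; simpl; try easy; intros H.
  - exists ((a + b) / 2); split; simpl; lra.
  - exists (a + 1); split; simpl; lra || easy.
  - exists (b - 1); split; simpl; lra || easy.
  - exists 0; split; easy.
Qed.

Lemma intv_opp a b s : in_intv a b s -> in_intv (Rbar_opp b) (Rbar_opp a) (- s).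
Proof.
  intros [H1 H2]; split.
  - destruct b as [b| |]; simpl in *; try easy; lra.
  - destruct a as [a| |]; simpl in *; try easy; lra.
Qed.

Lemma intv_opp_inv a b s : in_intv (Rbar_opp b) (Rbar_opp a) s -> in_intv a b (- s).
Proof.
  intros H; apply intv_opp in H; now rewrite !Rbar_opp_involutive in H.
Qed.

Lemma intv_extend a b s : in_intv a b s ->
  exists s1 s2, s1 < s < s2 /\ in_intv a b s1 /\ in_intv a b s2.
Proof.
  intros H.
  destruct (intv_open _ _ _ H) as [e He].
  exists (s - e / 2), (s + e / 2); assert (0 < e) by apply cond_pos.
  split; [lra|]; split; apply He;
    unfold ball; simpl; unfold AbsRing_ball, abs, minus, plus, opp; simpl;
    apply Rabs_def1; lra.
Qed.

(** Placing [s1] beyond a prescribed [s0] lets successive tails be nested, which is how several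
    eventual properties are combined below. *)
Lemma right_end_elim a b s0 P : in_intv a b s0 -> right_end b P ->
  exists s1, s0 < s1 /\ in_intv a b s1 /\ forall s, s1 <= s -> in_intv a b s -> P s.
Proof.
  intros Hs0 HP; destruct Hs0 as [H1 H2].
  destruct b as [b| |]; simpl in *; try easy.
  - destruct HP as [e He]; assert (0 < e) by apply cond_pos.
    (* The midpoint keeps [s1] strictly between [s0] and [b]; the second term puts it in the ball
       where [P] is known. *)
    exists (Rmax (s0 + (b - s0) / 2) (b - e / 2)).
    assert (s0 + (b - s0) / 2 <= Rmax (s0 + (b - s0) / 2) (b - e / 2)) by apply Rmax_l.
    assert (b - e / 2 <= Rmax (s0 + (b - s0) / 2) (b - e / 2)) by apply Rmax_r.
    assert (Rmax (s0 + (b - s0) / 2) (b - e / 2) < b) by (apply Rmax_lub_lt; lra).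
    split; [lra|]; split.
    + split; [|assumption].
      apply Rbar_lt_trans with (1 := H1); simpl; lra.
    + intros s Hs [_ Hs2]; simpl in Hs2; apply He; [|assumption].
      unfold ball; simpl; unfold AbsRing_ball, abs, minus, plus, opp; simpl.
      apply Rabs_def1; lra.
  - destruct HP as [M HM].
    exists (Rmax (s0 + 1) (M + 1)).
    assert (s0 + 1 <= Rmax (s0 + 1) (M + 1)) by apply Rmax_l.
    assert (M + 1 <= Rmax (s0 + 1) (M + 1)) by apply Rmax_r.
    split; [lra|]; split.
    + split; [|easy]. apply Rbar_lt_trans with (1 := H1); simpl; lra.
    + intros s Hs _; apply HM; lra.
Qed.

Lemma right_end_intro a b s1 (P : R -> Prop) : in_intv a b s1 ->
  (forall s, s1 < s -> in_intv a b s -> P s) -> right_end b P.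
Proof.
  intros [H1 H2] HP.
  assert (Ha : forall s, s1 < s -> Rbar_lt a s)
    by (intros s Hs; apply Rbar_lt_trans with (1 := H1); exact Hs).
  destruct b as [b| |]; simpl in *; try easy.
  - assert (He : 0 < b - s1) by lra.
    exists (mkposreal _ He); intros s Hs Hb; simpl in Hs.
    assert (s1 < s).
    { unfold ball in Hs; simpl in Hs; unfold AbsRing_ball, abs, minus, plus, opp in Hs; simpl in Hs.
      apply Rabs_def2 in Hs; lra. }
    apply HP; [assumption|]; split; auto.
  - exists s1; intros s Hs; apply HP; [assumption|]; split; simpl; auto.
Qed.

(** Every later statement about left ends is reduced to right ends through this reflection. *)
Lemma left_end_opp a P : left_end a P <-> right_end (Rbar_opp a) (fun s => P (- s)).
Proof.
  destruct a as [a| |]; simpl; split.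
  - intros [e He]; exists e; intros s Hs Hb; apply He; [|lra].
    unfold ball in *; simpl in *; unfold AbsRing_ball, abs, minus, plus, opp in *; simpl in *.
    apply Rabs_def2 in Hs; apply Rabs_def1; lra.
  - intros [e He]; exists e; intros s Hs Hb.
    rewrite <- (Ropp_involutive s); apply He; [|lra].
    unfold ball in *; simpl in *; unfold AbsRing_ball, abs, minus, plus, opp in *; simpl in *.
    apply Rabs_def2 in Hs; apply Rabs_def1; lra.
  - intros [M HM]; exists (- M); intros s Hs; apply HM; lra.
  - intros [M HM]; exists (- M); intros s Hs.
    rewrite <- (Ropp_involutive s); apply HM; lra.
  - intros [M HM]; exists (- M); intros s Hs; apply HM; lra.
  - intros [M HM]; exists (- M); intros s Hs.
    rewrite <- (Ropp_involutive s); apply HM; lra.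
Qed.

Lemma left_end_intro a b s1 (P : R -> Prop) : in_intv a b s1 ->
  (forall s, s < s1 -> in_intv a b s -> P s) -> left_end a P.
Proof.
  intros H1 HP; apply left_end_opp.
  apply right_end_intro with (1 := intv_opp _ _ _ H1).
  intros s Hs H; apply HP; [lra|].
  now apply intv_opp_inv.
Qed.

Lemma left_end_elim a b s0 P : in_intv a b s0 -> left_end a P ->
  exists s1, s1 < s0 /\ in_intv a b s1 /\ forall s, s <= s1 -> in_intv a b s -> P s.
Proof.
  intros H0 HP; apply left_end_opp in HP.
  destruct (right_end_elim _ _ _ _ (intv_opp _ _ _ H0) HP) as (s1 & H1 & H2 & H3).
  exists (- s1); split; [lra|]; split; [now apply intv_opp_inv|].
  intros s Hs Hi; rewrite <- (Ropp_involutive s); apply H3; [lra|].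
  now apply intv_opp.
Qed.

#[global] Instance right_end_filter b : Filter (right_end b).
Proof. destruct b; simpl; apply _. Qed.

#[global] Instance left_end_filter a : Filter (left_end a).
Proof. destruct a; simpl; apply _. Qed.

Lemma right_end_intv a b : Rbar_lt a b -> right_end b (in_intv a b).
Proof.
  intros H; destruct (intv_nonempty _ _ H) as [s Hs].
  now apply right_end_intro with (1 := Hs).
Qed.

Lemma left_end_intv a b : Rbar_lt a b -> left_end a (in_intv a b).
Proof.
  intros H; destruct (intv_nonempty _ _ H) as [s Hs].
  now apply left_end_intro with (1 := Hs).
Qed.

(** * Consequences of the mean value and intermediate value theorems *)

Lemma derive_nonneg_le (f df : R -> R) x y : x <= y ->
  (forall z, x <= z <= y -> is_derive f z (df z) /\ 0 <= df z) -> f x <= f y.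
Proof.
  intros [Hxy| ->] H; [|lra].
  destruct (MVT_cor2 f df x y Hxy) as (c & Hc & Hc').
  - intros c Hc; apply is_derive_Reals, H, Hc.
  - destruct (H c) as [_ H0]; [lra|]; nra.
Qed.

Lemma derive_pos_lt (f df : R -> R) x y : x < y ->
  (forall z, x <= z <= y -> is_derive f z (df z) /\ 0 < df z) -> f x < f y.
Proof.
  intros Hxy H.
  destruct (MVT_cor2 f df x y Hxy) as (c & Hc & Hc').
  - intros c Hc; apply is_derive_Reals, H, Hc.
  - destruct (H c) as [_ H0]; [lra|]; nra.
Qed.

Lemma derive_zero_const a b (f : R -> R) x y :
  (forall z, in_intv a b z -> is_derive f z 0) ->
  in_intv a b x -> in_intv a b y -> f x = f y.
Proof.
  assert (Hle : forall x y, (forall z, in_intv a b z -> is_derive f z 0) ->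
    in_intv a b x -> in_intv a b y -> x <= y -> f x = f y).
  { clear; intros x y H Hx Hy Hxy; apply Rle_antisym.
    - apply derive_nonneg_le with (df := fun _ => 0) (1 := Hxy).
      intros z Hz; split; [|lra]; apply H; now apply intv_between with x y.
    - cut (- f x <= - f y); [lra|].
      apply (derive_nonneg_le (fun z => - f z) (fun _ => -0) x y Hxy).
      intros z Hz; split; [|lra].
      apply (is_derive_opp f z 0), H; now apply intv_between with x y. }
  intros H Hx Hy; destruct (Rle_dec x y) as [Hxy|Hxy].
  - now apply Hle.
  - symmetry; apply Hle; trivial; lra.
Qed.

Lemma is_derive_continuity_pt (f : R -> R) x l : is_derive f x l -> continuity_pt f x.
Proof.
  intros H; apply continuity_pt_filterlim.
  apply (ex_derive_continuous f x); now exists l.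
Qed.

Lemma ivt_interval (f : R -> R) x y c :
  x < y -> (forall z, x <= z <= y -> continuity_pt f z) -> f x < c < f y ->
  exists z, x <= z <= y /\ f z = c.
Proof.
  intros Hxy Hf Hc.
  destruct (Ranalysis5.IVT_interv (fun z => f z - c) x y) as (z & Hz & Hz'); trivial; try lra.
  - intros z Hz; apply continuity_pt_minus; [now apply Hf|].
    apply continuity_pt_const; now intros ? ?.
  - exists z; split; [assumption|lra].
Qed.

(** * Inverse functions and separation of variables *)

(** With [m] the increment of [g], the difference quotient of [g] is the inverse of that of [f] at
    [g s] with increment [m]. Continuity of [g] makes [m] small, and [f (g s') = s'] makes it
    nonzero. *)
Lemma derive_inverse (f g : R -> R) s d :
  is_derive f (g s) d -> d <> 0 -> continuity_pt g s ->
  locally s (fun s' => f (g s') = s') -> is_derive g s (/ d).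
Proof.
  intros Hf Hd Hg Hfg; apply is_derive_Reals in Hf; apply is_derive_Reals.
  intros eps Heps.
  assert (Hinv : continuity_pt Rinv d).
  { apply (continuity_pt_inv id); [|exact Hd].
    apply derivable_continuous_pt, derivable_pt_id. }
  destruct (Hinv eps Heps) as (e1 & He1 & H1).
  destruct (Hf e1 He1) as [e2 H2].
  destruct (Hg e2 (cond_pos e2)) as (e3 & He3 & H3).
  destruct Hfg as [e4 H4].
  assert (He : 0 < Rmin e3 e4) by (apply Rmin_pos; [exact He3|apply cond_pos]).
  exists (mkposreal _ He); intros h Hh Hhe; simpl in Hhe.
  assert (Hh3 : Rabs h < e3) by (apply Rlt_le_trans with (1 := Hhe), Rmin_l).
  assert (Hh4 : Rabs h < e4) by (apply Rlt_le_trans with (1 := Hhe), Rmin_r).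
  assert (E0 : f (g s) = s) by (apply H4, ball_center).
  assert (E1 : f (g (s + h)) = s + h).
  { apply H4; unfold ball; simpl; unfold AbsRing_ball, abs, minus, plus, opp; simpl.
    now replace (s + h + - s) with h by ring. }
  set (m := g (s + h) - g s).
  assert (Hm0 : m <> 0).
  { intros Hm; apply Hh; assert (E : g (s + h) = g s) by (unfold m in Hm; lra).
    rewrite E in E1; lra. }
  assert (Hm : Rabs m < e2).
  { apply (H3 (s + h)); split; [split; [exact I|lra]|].
    unfold dist; simpl; unfold Rdist; now replace (s + h - s) with h by ring. }
  specialize (H2 m Hm0 Hm).
  replace (g s + m) with (g (s + h)) in H2 by (unfold m; ring).
  rewrite E0, E1 in H2.
  replace (m / h) with (/ ((s + h - s) / m)) by (field; split; trivial; lra).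
  (* The limit behind [continuity_pt] excludes the point itself, so a quotient equal to [d] is
     treated apart. *)
  destruct (Req_dec ((s + h - s) / m) d) as [Ed|Ed].
  - rewrite Ed, Rminus_diag, Rabs_R0; exact Heps.
  - apply (H1 ((s + h - s) / m)); split.
    + split; [exact I|now intros E; apply Ed].
    + exact H2.
Qed.

(** The image interval is delimited by the infimum and supremum of the values of [f], finite or not.
    The last two clauses say that [g] tends to [be] and to [al] at the two ends. *)
Lemma inverse_function (al be : Rbar) (f df : R -> R) :
  Rbar_lt al be ->
  (forall x, in_intv al be x -> is_derive f x (df x) /\ 0 < df x) ->
  exists a b g,
    (forall x, in_intv al be x -> in_intv a b (f x) /\ g (f x) = x) /\
    (forall s, in_intv a b s ->
       in_intv al be (g s) /\ f (g s) = s /\ is_derive g s (/ df (g s))) /\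
    (forall x, in_intv al be x -> right_end b (fun s => in_intv al be (g s) /\ x < g s)) /\
    (forall x, in_intv al be x -> left_end a (fun s => in_intv al be (g s) /\ g s < x)).
Proof.
  intros Hlt Hf.
  pose (im := fun y => exists x, in_intv al be x /\ y = f x).
  pose (a := Glb_Rbar im); pose (b := Lub_Rbar im).
  (* The largest [x] with [f x <= s] is the preimage of [s], so no choice of preimages is made. *)
  pose (g := fun s => real (Lub_Rbar (fun x => in_intv al be x /\ f x <= s))).
  assert (Hinc : forall x y, in_intv al be x -> in_intv al be y -> x < y -> f x < f y).
  { intros x y Hx Hy Hxy; apply derive_pos_lt with df; trivial.
    intros z Hz; apply Hf; now apply intv_between with x y. }
  assert (Hle : forall x y, in_intv al be x -> in_intv al be y -> f x <= f y -> x <= y).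
  { intros x y Hx Hy H; destruct (Rle_lt_dec x y) as [|Hyx]; trivial.
    apply Hinc in Hyx; trivial; lra. }
  assert (Ha : is_glb_Rbar im a) by apply Glb_Rbar_correct.
  assert (Hb : is_lub_Rbar im b) by apply Lub_Rbar_correct.
  assert (Him : forall x, in_intv al be x -> in_intv a b (f x)).
  { intros x Hx; destruct (intv_extend _ _ _ Hx) as (x1 & x2 & Hx12 & Hx1 & Hx2); split.
    - apply Rbar_le_lt_trans with (f x1).
      + apply Ha; now exists x1.
      + apply Hinc; trivial; lra.
    - apply Rbar_lt_le_trans with (f x2).
      + apply Hinc; trivial; lra.
      + apply Hb; now exists x2. }
  assert (Hg : forall x, in_intv al be x -> g (f x) = x).
  { intros x Hx; unfold g.
    rewrite (is_lub_Rbar_unique _ (Finite x)); trivial; split.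
    - intros y [Hy Hxy]; now apply Hle.
    - intros M HM; apply HM; split; [assumption|lra]. }
  assert (Hsurj : forall s, in_intv a b s -> exists x, in_intv al be x /\ f x = s).
  { intros s [Hs1 Hs2].
    assert (H2 : exists x, in_intv al be x /\ s < f x).
    { apply Classical_Prop.NNPP; intros H; apply (Rbar_lt_not_le _ _ Hs2), Hb.
      intros y [x [Hx ->]]; simpl; apply Rnot_lt_le; intros H'; apply H; now exists x. }
    assert (H1 : exists x, in_intv al be x /\ f x < s).
    { apply Classical_Prop.NNPP; intros H; apply (Rbar_lt_not_le _ _ Hs1), Ha.
      intros y [x [Hx ->]]; simpl; apply Rnot_lt_le; intros H'; apply H; now exists x. }
    destruct H1 as (x1 & Hx1 & H1), H2 as (x2 & Hx2 & H2).
    assert (Hx12 : x1 < x2).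
    { destruct (Rle_lt_dec x2 x1) as [[H| ->]|]; trivial; [|lra].
      apply Hinc in H; trivial; lra. }
    destruct (ivt_interval f x1 x2 s Hx12) as (x & Hx & Hfx).
    - intros z Hz; apply is_derive_continuity_pt with (df z), Hf.
      now apply intv_between with x1 x2.
    - now split.
    - exists x; split; [now apply intv_between with x1 x2|assumption]. }
  assert (Hginc : forall s1 s2, in_intv a b s1 -> in_intv a b s2 -> s1 < s2 -> g s1 < g s2).
  { intros s1 s2 H1 H2 H.
    destruct (Hsurj _ H1) as (x1 & Hx1 & <-), (Hsurj _ H2) as (x2 & Hx2 & <-).
    rewrite !Hg; trivial.
    destruct (Rle_lt_dec x2 x1) as [[H'| ->]|]; trivial; [|lra].
    apply Hinc in H'; trivial; lra. }
  exists a, b, g; split; [|split; [|split]].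
  - intros x Hx; split; auto.
  - intros s Hs; destruct (Hsurj _ Hs) as (x & Hx & Hfx).
    assert (Egx : g s = x) by (rewrite <- Hfx; auto).
    rewrite Egx; split; [assumption|]; split; [assumption|].
    destruct (Hf x Hx) as [Hd Hpos].
    rewrite <- Egx in Hd at 1.
    apply derive_inverse with (1 := Hd); [lra| |].
    + apply continuity_pt_filterlim; rewrite Egx.
      intros P [e He].
      destruct (intv_open _ _ _ Hx) as [e' He'].
      pose (d := Rmin e e' / 2).
      assert (0 < Rmin e e') by (apply Rmin_pos; apply cond_pos).
      assert (Rmin e e' <= e) by apply Rmin_l.
      assert (Rmin e e' <= e') by apply Rmin_r.
      assert (Hball : forall y (r : posreal), x - r < y < x + r -> ball x r y).
      { intros y r Hy; unfold ball; simpl; unfold AbsRing_ball, abs, minus, plus, opp; simpl.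
        apply Rabs_def1; lra. }
      assert (Hx1 : in_intv al be (x - d)) by (apply He', Hball; unfold d; lra).
      assert (Hx2 : in_intv al be (x + d)) by (apply He', Hball; unfold d; lra).
      assert (Hlo : f (x - d) < s) by (rewrite <- Hfx; apply Hinc; trivial; unfold d; lra).
      assert (Hhi : s < f (x + d)) by (rewrite <- Hfx; apply Hinc; trivial; unfold d; lra).
      change (locally s (fun s' => P (g s'))).
      apply (filter_imp (in_intv (f (x - d)) (f (x + d)))).
      * intros s' [Hs1 Hs2]; simpl in Hs1, Hs2; apply He, Hball.
        assert (Hs' : in_intv a b s') by
          (apply intv_between with (f (x - d)) (f (x + d)); auto; lra).
        assert (H3 := Hginc _ _ (Him _ Hx1) Hs' Hs1).
        assert (H4 := Hginc _ _ Hs' (Him _ Hx2) Hs2).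
        rewrite Hg in H3, H4 by assumption; unfold d in H3, H4; split; lra.
      * now apply intv_open.
    + apply filter_imp with (2 := intv_open _ _ _ Hs).
      intros s' Hs'; destruct (Hsurj _ Hs') as (x' & Hx' & <-); now rewrite Hg.
  - intros x Hx; apply (right_end_intro a b (f x)); [auto|].
    intros s Hs1 Hs.
    assert (H := Hginc _ _ (Him _ Hx) Hs Hs1); rewrite Hg in H; trivial.
    split; [|assumption].
    destruct (Hsurj _ Hs) as (x' & Hx' & <-); now rewrite Hg.
  - intros x Hx; apply (left_end_intro a b (f x)); [auto|].
    intros s Hs1 Hs.
    assert (H := Hginc _ _ Hs (Him _ Hx) Hs1); rewrite Hg in H; trivial.
    split; [|assumption].
    destruct (Hsurj _ Hs) as (x' & Hx' & <-); now rewrite Hg.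
Qed.

Lemma antiderivative_exists a b (g : R -> R) x0 :
  in_intv a b x0 -> (forall x, in_intv a b x -> continuity_pt g x) ->
  exists G, G x0 = 0 /\ forall x, in_intv a b x -> is_derive G x (g x).
Proof.
  intros H0 Hg; exists (fun x => RInt g x0 x); split; [exact (RInt_point x0 g)|].
  intros x Hx; apply is_derive_RInt with x0.
  - apply filter_imp with (2 := intv_open _ _ _ Hx); intros y Hy.
    apply (RInt_correct g), ex_RInt_continuous; intros z Hz.
    apply continuity_pt_filterlim, Hg.
    destruct (Rle_dec x0 y) as [H|H].
    + rewrite Rmin_left, Rmax_right in Hz by lra; now apply intv_between with x0 y.
    + rewrite Rmin_right, Rmax_left in Hz by lra; now apply intv_between with y x0.
  - now apply continuity_pt_filterlim, Hg.
Qed.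

(** Separation of variables: [s = s0 + G x] with [G' = / F] is inverted. The interval [(a, b)] is
    the range of this function, so the solution sweeps all of [(al, be)] and reaches its limits only
    at the ends. *)
Lemma autonomous_solution (al be : Rbar) (F : R -> R) s0 x0 :
  in_intv al be x0 ->
  (forall x, in_intv al be x -> continuity_pt F x /\ 0 < F x) ->
  exists a b g, in_intv a b s0 /\ g s0 = x0 /\
    (forall s, in_intv a b s -> in_intv al be (g s) /\ is_derive g s (F (g s))) /\
    (forall x, in_intv al be x -> exists s, in_intv a b s /\ g s = x) /\
    (forall x, in_intv al be x -> right_end b (fun s => in_intv al be (g s) /\ x < g s)) /\
    (forall x, in_intv al be x -> left_end a (fun s => in_intv al be (g s) /\ g s < x)).
Proof.
  intros H0 HF.
  destruct (antiderivative_exists al be (fun x => / F x) x0 H0) as (G & HG0 & HG).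
  { intros x Hx; destruct (HF x Hx); apply continuity_pt_inv; trivial; lra. }
  destruct (inverse_function al be (fun x => s0 + G x) (fun x => / F x))
    as (a & b & g & H1 & H2 & H3 & H4).
  - destruct H0 as [? ?]; now apply Rbar_lt_trans with x0.
  - intros x Hx; split.
    + rewrite <- (Rplus_0_l (/ F x)).
      apply (is_derive_plus (fun _ => s0) G); [apply (is_derive_const s0)|auto].
    + apply Rinv_0_lt_compat, HF, Hx.
  - destruct (H1 _ H0) as [H5 H6]; rewrite HG0, Rplus_0_r in H5, H6.
    exists a, b, g; split; [assumption|]; split; [assumption|].
    split; [|split; [|now split]].
    + intros s Hs; destruct (H2 s Hs) as (H7 & _ & H8); split; [assumption|].
      rewrite Rinv_inv in H8; exact H8.
    + intros x Hx; exists (s0 + G x); now apply H1.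
Qed.

(** * The planar system *)

(** [auto_derive] leaves [Derive g x] for each abstract function; these are replaced by the values
    found in the [is_derive] hypotheses, and an algebraic identity remains. *)
Ltac solve_derive :=
  auto_derive;
  [ repeat split; trivial; try (eexists; eassumption)
  | repeat match goal with
    | H : is_derive _ _ ?l |- context [Derive ?g ?x] =>
        rewrite (is_derive_unique g x l H)
    end ].

Definition orbit (a b : Rbar) (t k : R -> R) : Prop :=
  forall s, in_intv a b s ->
    is_derive t s (1 - k s ^ 2) /\ is_derive k s (- (k s * t s)).

Lemma orbit_reverse a b t k : orbit a b t k ->
  orbit (Rbar_opp b) (Rbar_opp a) (fun s => - t (- s)) (fun s => k (- s)).
Proof.
  intros H s Hs; destruct (H (- s)) as [Ht Hk]; [now apply intv_opp_inv|].
  split; solve_derive; ring.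
Qed.

(** Unlike the logarithmic form in [orbit_energy], this one assumes no sign of [k]; it can therefore
    show that a zero of [k] forces [k] to vanish identically. *)
Lemma orbit_first_integral a b t k s1 s2 : orbit a b t k ->
  in_intv a b s1 -> in_intv a b s2 ->
  k s1 ^ 2 * exp (t s1 ^ 2 - k s1 ^ 2) = k s2 ^ 2 * exp (t s2 ^ 2 - k s2 ^ 2).
Proof.
  intros H; apply (derive_zero_const a b (fun s => k s ^ 2 * exp (t s ^ 2 - k s ^ 2))).
  intros s Hs; destruct (H s Hs) as [Ht Hk]; solve_derive; ring.
Qed.

Lemma orbit_energy a b t k s1 s2 : orbit a b t k ->
  (forall s, in_intv a b s -> 0 < k s) ->
  in_intv a b s1 -> in_intv a b s2 ->
  2 * ln (k s1) + t s1 ^ 2 - k s1 ^ 2 = 2 * ln (k s2) + t s2 ^ 2 - k s2 ^ 2.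
Proof.
  intros H Hpos; apply (derive_zero_const a b (fun s => 2 * ln (k s) + t s ^ 2 - k s ^ 2)).
  intros s Hs; destruct (H s Hs) as [Ht Hk]; assert (Hk0 := Hpos s Hs).
  solve_derive; field; lra.
Qed.

Lemma continuity_bounded (f : R -> R) x y :
  x <= y -> (forall z, x <= z <= y -> continuity_pt f z) ->
  exists B, forall z, x <= z <= y -> Rabs (f z) <= B.
Proof.
  intros Hxy Hf.
  destruct (continuity_ab_maj (fun z => Rabs (f z)) x y Hxy) as (m & Hm & _).
  - intros z Hz; apply (continuity_pt_comp f Rabs); [auto|apply Rcontinuity_abs].
  - now exists (Rabs (f m)).
Qed.

(** The function [D z * exp (- M z)] is nonincreasing, nonnegative and starts at 0. *)
Lemma gronwall_zero (D dD : R -> R) M x y :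
  x <= y -> D x = 0 ->
  (forall z, x <= z <= y -> is_derive D z (dD z) /\ 0 <= D z /\ dD z <= M * D z) ->
  D y = 0.
Proof.
  intros Hxy H0 HD.
  assert (H : - (D x * exp (- (M * x))) <= - (D y * exp (- (M * y)))).
  { apply (derive_nonneg_le (fun z => - (D z * exp (- (M * z))))
      (fun z => (M * D z - dD z) * exp (- (M * z)))); trivial.
    intros z Hz; destruct (HD z Hz) as (Hd & _ & Hle); split.
    - solve_derive; ring.
    - apply Rmult_le_pos; [lra|apply Rlt_le, exp_pos]. }
  rewrite H0 in H; assert (He := exp_pos (- (M * y))).
  destruct (HD y) as (_ & Hpos & _); [lra|]; nra.
Qed.

(** The squares of [u + w] and [u - w] bound the cross term by [3 B (u^2 + w^2)], and the other term
    is at most [2 B w^2]. The factor 6 fits [p = 4 k1 + 2 k2] with [k1], [k2] bounded by [B]. *)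
Lemma quadratic_bound p q B u w : - (6 * B) <= p <= 6 * B -> - B <= q <= B ->
  - p * (u * w) - 2 * q * w ^ 2 <= 5 * B * (u ^ 2 + w ^ 2).
Proof.
  intros Hp Hq.
  assert (0 <= (6 * B + p) * (u + w) ^ 2) by (apply Rmult_le_pos; [lra|apply pow2_ge_0]).
  assert (0 <= (6 * B - p) * (u - w) ^ 2) by (apply Rmult_le_pos; [lra|apply pow2_ge_0]).
  assert (0 <= (B + q) * w ^ 2) by (apply Rmult_le_pos; [lra|apply pow2_ge_0]).
  assert (0 <= B * u ^ 2) by (apply Rmult_le_pos; [lra|apply pow2_ge_0]).
  lra.
Qed.

Lemma orbit_unique_forward a b t1 k1 t2 k2 s0 s : orbit a b t1 k1 -> orbit a b t2 k2 ->
  in_intv a b s0 -> t1 s0 = t2 s0 -> k1 s0 = k2 s0 -> in_intv a b s -> s0 <= s ->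
  t1 s = t2 s /\ k1 s = k2 s.
Proof.
  intros O1 O2 Hs0 Et Ek Hs Hle.
  assert (Hin : forall z, s0 <= z <= s -> in_intv a b z)
    by (intros z Hz; now apply intv_between with s0 s).
  assert (HB : exists B, forall z, s0 <= z <= s ->
     Rabs (k1 z) <= B /\ Rabs (k2 z) <= B /\ Rabs (t2 z) <= B).
  { destruct (continuity_bounded k1 s0 s Hle) as [B1 HB1].
    { intros z Hz; eapply is_derive_continuity_pt, (O1 z), Hin, Hz. }
    destruct (continuity_bounded k2 s0 s Hle) as [B2 HB2].
    { intros z Hz; eapply is_derive_continuity_pt, (O2 z), Hin, Hz. }
    destruct (continuity_bounded t2 s0 s Hle) as [B3 HB3].
    { intros z Hz; eapply is_derive_continuity_pt, (O2 z), Hin, Hz. }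
    exists (B1 + B2 + B3); intros z Hz.
    specialize (HB1 z Hz); specialize (HB2 z Hz); specialize (HB3 z Hz).
    assert (H1 := Rabs_pos (k1 z)); assert (H2 := Rabs_pos (k2 z)).
    assert (H3 := Rabs_pos (t2 z)); repeat split; lra. }
  destruct HB as [B HB].
  pose (D := fun z => (t1 z - t2 z) ^ 2 + (k1 z - k2 z) ^ 2).
  assert (HD : D s = 0).
  (* The derivative of the squared distance, with [k1^2 - k2^2] factored and [k1 t1 - k2 t2] written
     as [k1 (t1 - t2) + t2 (k1 - k2)]: a quadratic form in the two differences. *)
  { apply (gronwall_zero D (fun z =>
      - 2 * (t1 z - t2 z) * (k1 z - k2 z) * (k1 z + k2 z)
      - 2 * (k1 z - k2 z) * (k1 z * (t1 z - t2 z) + t2 z * (k1 z - k2 z)))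
      (5 * B) s0 s Hle).
    - unfold D; rewrite Et, Ek; ring.
    - intros z Hz; destruct (O1 z (Hin z Hz)) as [Ht1 Hk1], (O2 z (Hin z Hz)) as [Ht2 Hk2].
      split; [|split].
      + unfold D; solve_derive; ring.
      + apply Rplus_le_le_0_compat; apply pow2_ge_0.
      + unfold D; destruct (HB z Hz) as (H1 & H2 & H3).
        apply Rabs_le_between in H1; apply Rabs_le_between in H2; apply Rabs_le_between in H3.
        set (u := t1 z - t2 z); set (w := k1 z - k2 z).
        assert (H4 := quadratic_bound (4 * k1 z + 2 * k2 z) (t2 z) B u w).
        replace (- 2 * u * w * (k1 z + k2 z) - 2 * w * (k1 z * u + t2 z * w))
          with (- (4 * k1 z + 2 * k2 z) * (u * w) - 2 * t2 z * w ^ 2) by ring.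
        apply H4; lra. }
  unfold D in HD.
  assert (H1 := pow2_ge_0 (t1 s - t2 s)); assert (H2 := pow2_ge_0 (k1 s - k2 s)).
  split; apply Rminus_diag_uniq, Rsqr_0_uniq; unfold Rsqr; lra.
Qed.

Lemma orbit_unique a b t1 k1 t2 k2 s0 s : orbit a b t1 k1 -> orbit a b t2 k2 ->
  in_intv a b s0 -> t1 s0 = t2 s0 -> k1 s0 = k2 s0 -> in_intv a b s ->
  t1 s = t2 s /\ k1 s = k2 s.
Proof.
  intros O1 O2 Hs0 Et Ek Hs; destruct (Rle_dec s0 s) as [H|H].
  - now apply orbit_unique_forward with a b s0.
  - destruct (orbit_unique_forward _ _ _ _ _ _ (- s0) (- s) (orbit_reverse _ _ _ _ O1)
      (orbit_reverse _ _ _ _ O2)) as [Et' Ek'];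
      try (now apply intv_opp); rewrite ?Ropp_involutive; try lra.
    rewrite Ropp_involutive in Et', Ek'; split; lra.
Qed.

(** * The three kinds of ends and criteria for them *)

Inductive end_kind := Flat | Unit | Sharp.

Definition right_kind (e : end_kind) (b : Rbar) (t k : R -> R) : Prop :=
  match e with
  | Flat => b = p_infty /\ (forall eps, 0 < eps -> right_end b (fun s => Rabs (k s) < eps)) /\
      (forall M, right_end b (fun s => M < t s))
  | Unit => b = p_infty /\
      (forall eps, 0 < eps -> right_end b (fun s => Rabs (k s - 1) < eps /\ Rabs (t s) < eps))
  | Sharp => (exists r, b = Finite r) /\
      (forall M, right_end b (fun s => M < k s /\ t s < - M))
  end.

(** Reversing arc length changes the sign of [t] and keeps [k]. Hence at a left end [Flat] has [t]
    tending to minus infinity and [Sharp] has [t] tending to plus infinity. *)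
Definition left_kind (e : end_kind) (a : Rbar) (t k : R -> R) : Prop :=
  right_kind e (Rbar_opp a) (fun s => - t (- s)) (fun s => k (- s)).

Lemma ln_le_sub_one x : 0 < x -> ln x <= x - 1.
Proof.
  intros Hx; assert (H := exp_ineq1_le (ln x)); rewrite exp_ln in H; lra.
Qed.

Lemma intv_not_right_end a b s r : in_intv a b s -> b = Finite r -> s < r.
Proof. intros [_ H] ->; exact H. Qed.

Lemma finite_or_infinite_right_end a b s :
  in_intv a b s -> (exists r, b = Finite r) \/ b = p_infty.
Proof.
  intros [_ H]; destruct b as [r| |]; [left; now exists r|now right|easy].
Qed.

Section RightEnd.

Variables (a b : Rbar) (t k : R -> R) (s0 c : R).
Hypothesis Hs0 : in_intv a b s0.
Hypothesis Horb : orbit a b t k.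
Hypothesis Hpos : forall s, in_intv a b s -> 0 < k s.
Hypothesis Hc : forall s, in_intv a b s -> 2 * ln (k s) + t s ^ 2 - k s ^ 2 = c.

(** The energy forces [t^2] to infinity as [k] tends to 0. Since [t' = 1 - k^2 <= 1], this takes
    infinite length. *)
Lemma right_kind_flat :
  (forall eps, 0 < eps -> right_end b (fun s => k s < eps)) ->
  right_end b (fun s => 0 < t s) -> right_kind Flat b t k.
Proof.
  intros Hk Ht.
  assert (HM : forall M, right_end b (fun s => M < t s)).
  { intros M; assert (He := exp_pos ((c - M ^ 2) / 2)).
    destruct (right_end_elim a b s0 _ Hs0 (filter_and _ _ Ht (Hk _ He))) as (s1 & H1 & Hs1 & H).
    apply (right_end_intro a b s1 _ Hs1); intros s Hs Hi.
    destruct (H s (Rlt_le _ _ Hs) Hi) as [Hts Hks].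
    apply ln_increasing in Hks; [|auto]; rewrite ln_exp in Hks.
    specialize (Hc s Hi); assert (0 <= k s ^ 2) by apply pow2_ge_0.
    assert (M ^ 2 < t s ^ 2) by lra.
    destruct (Rlt_le_dec M (t s)); trivial; nra. }
  split; [|split; trivial].
  - destruct (finite_or_infinite_right_end _ _ _ Hs0) as [[r Hr]|]; trivial; exfalso.
    destruct (right_end_elim a b s0 _ Hs0 (HM (t s0 + (r - s0)))) as (s1 & H1 & Hs1 & H).
    specialize (H s1 (Rle_refl _) Hs1).
    assert (Hr1 := intv_not_right_end _ _ _ _ Hs1 Hr).
    assert (s0 - t s0 <= s1 - t s1).
    { apply (derive_nonneg_le (fun s => s - t s) (fun s => k s ^ 2)); [lra|].
      intros z Hz; destruct (Horb z) as [Ht' _]; [now apply intv_between with s0 s1|].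
      split; [solve_derive; ring|apply pow2_ge_0]. }
    lra.
  - intros eps He.
    apply filter_imp with (2 := filter_and _ _ (Hk eps He) (right_end_intv a b
      (Rbar_lt_trans _ s0 _ (proj1 Hs0) (proj2 Hs0)))).
    intros s [H Hi]; specialize (Hpos s Hi); now rewrite Rabs_pos_eq by lra.
Qed.

(** For large [k] the energy gives [t < - k / 2], so [k' > k^2 / 2] and [/ k] decreases at a rate
    above 1/2: the end is reached at finite length. *)
Lemma right_kind_sharp :
  (forall M, right_end b (fun s => M < k s)) ->
  right_end b (fun s => t s < 0) -> right_kind Sharp b t k.
Proof.
  intros Hk Ht.
  destruct (right_end_elim a b s0 _ Hs0 (filter_and _ _ Ht (Hk (4 + Rabs c))))
    as (s1 & H1 & Hs1 & H).
  assert (Hhalf : forall s, s1 <= s -> in_intv a b s -> t s < - (k s / 2)).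
  { intros s Hs Hi; destruct (H s Hs Hi) as [Hts Hks].
    specialize (Hc s Hi); specialize (Hpos s Hi).
    assert (Hl := ln_le_sub_one _ Hpos).
    assert (Hc1 := Rle_abs (c)); assert (Hc2 := Rabs_maj2 c).
    assert (Hc3 := Rabs_pos c).
    assert ((k s / 2) ^ 2 < t s ^ 2) by nra.
    nra. }
  split.
  - destruct (finite_or_infinite_right_end _ _ _ Hs0) as [|Hr]; trivial; exfalso.
    (* The length by which [/ k], losing at least 1/2 per unit, would have dropped to 0. *)
    pose (s2 := s1 + 2 / k s1).
    assert (Hk1 := Hpos s1 Hs1).
    assert (H2 : 0 < 2 / k s1) by (apply Rdiv_lt_0_compat; lra).
    assert (Hin : forall s, s1 <= s -> in_intv a b s).
    { intros s Hs; split; [apply Rbar_lt_le_trans with s1; [apply Hs1|exact Hs]|now rewrite Hr]. }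
    assert (Hm : - / k s1 - s1 / 2 <= - / k s2 - s2 / 2).
    { apply (derive_nonneg_le (fun s => - / k s - s / 2) (fun s => - t s / k s - 1 / 2));
        [unfold s2; lra|].
      intros z Hz; assert (Hz1 : in_intv a b z) by (apply Hin; lra).
      destruct (Horb z Hz1) as [_ Hkz]; assert (Hkz0 := Hpos z Hz1); split.
      - solve_derive; [lra|field; lra].
      - assert (Hh := Hhalf z (proj1 Hz) Hz1).
        apply Rmult_le_reg_r with (k z); trivial; field_simplify; lra. }
    assert (Hk2 : 0 < / k s2) by (apply Rinv_0_lt_compat, Hpos, Hin; unfold s2; lra).
    unfold s2 in Hm at 2; replace ((s1 + 2 / k s1) / 2) with (s1 / 2 + / k s1) in Hm
      by (field; lra); lra.
  - intros M.
    destruct (right_end_elim a b s1 _ Hs1 (Hk (2 * Rabs M))) as (s2 & H2 & Hs2 & H3).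
    apply (right_end_intro a b s2 _ Hs2); intros s Hs Hi.
    specialize (H3 s (Rlt_le _ _ Hs) Hi).
    assert (Hh : t s < - (k s / 2)) by (apply Hhalf; trivial; lra).
    assert (Hm := Rle_abs M); assert (Hm' := Rabs_pos M); lra.
Qed.

(** At the saddle level, [t^2 = k^2 - 1 - 2 ln k] is of order [(k - 1)^2] near [k = 1]. Hence
    [(k - 1)^2] decays at most exponentially and cannot tend to 0 at finite length. *)
Lemma right_kind_unit : c = -1 ->
  (forall eps, 0 < eps -> right_end b (fun s => Rabs (k s - 1) < eps)) ->
  (forall s, in_intv a b s -> k s <> 1) -> right_kind Unit b t k.
Proof.
  intros Hc1 Hk Hne; rewrite Hc1 in Hc.
  destruct (right_end_elim a b s0 _ Hs0 (Hk (1 / 2) ltac:(lra))) as (s1 & H1 & Hs1 & H).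
  (* From [ln k >= 1 - / k] and [/ k < 2] the factor is below 5; the square 9 yields
     [|t| <= 3 |k - 1|]. *)
  assert (Ht : forall s, s1 <= s -> in_intv a b s -> t s ^ 2 <= 9 * (k s - 1) ^ 2).
  { intros s Hs Hi; specialize (H s Hs Hi); apply Rabs_def2 in H.
    specialize (Hc s Hi); specialize (Hpos s Hi).
    assert (Hl := ln_le_sub_one _ (Rinv_0_lt_compat _ Hpos)).
    rewrite ln_Rinv in Hl by trivial.
    replace (t s ^ 2) with (k s ^ 2 - 1 - 2 * ln (k s)) by lra.
    apply Rle_trans with (k s ^ 2 - 1 + 2 * (/ k s - 1)); [lra|].
    replace (k s ^ 2 - 1 + 2 * (/ k s - 1)) with ((k s - 1) ^ 2 * (1 + 2 * / k s))
      by (field; lra).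
    assert (/ k s < 2).
    { replace 2 with (/ (1 / 2)) by field; apply Rinv_lt_contravar; lra. }
    assert (0 <= (k s - 1) ^ 2) by apply pow2_ge_0; nra. }
  assert (Hta : forall s, s1 <= s -> in_intv a b s -> Rabs (t s) <= 3 * Rabs (k s - 1)).
  { intros s Hs Hi; specialize (Ht s Hs Hi).
    assert (H2 := Rabs_pos (k s - 1)); assert (H3 := Rabs_pos (t s)).
    rewrite <- (pow2_abs (t s)), <- (pow2_abs (k s - 1)) in Ht; nra. }
  split.
  - destruct (finite_or_infinite_right_end _ _ _ Hs0) as [[r Hr]|]; trivial; exfalso.
    assert (Hr1 := intv_not_right_end _ _ _ _ Hs1 Hr).
    (* A lower bound for [(k - 1)^2] up to [r]. The rate 12 comes from [|k t| <= 6 |k - 1|], which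
       bounds the derivative [- 2 (k - 1) k t] by [12 (k - 1)^2] in absolute value. *)
    pose (m := (k s1 - 1) ^ 2 * exp (12 * s1) * exp (- (12 * r))).
    assert (Hm : 0 < m).
    { unfold m; assert (Hw : 0 < (k s1 - 1) ^ 2)
        by (apply pow2_gt_0; specialize (Hne s1 Hs1); lra).
      apply Rmult_lt_0_compat; [apply Rmult_lt_0_compat; [exact Hw|]|]; apply exp_pos. }
    destruct (right_end_elim a b s1 _ Hs1 (Hk (Rmin 1 m) ltac:(apply Rmin_pos; lra)))
      as (s2 & H2 & Hs2 & H3).
    specialize (H3 s2 (Rle_refl _) Hs2).
    assert (Hr2 := intv_not_right_end _ _ _ _ Hs2 Hr).
    assert (Hle : (k s1 - 1) ^ 2 * exp (12 * s1) <= (k s2 - 1) ^ 2 * exp (12 * s2)).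
    { apply (derive_nonneg_le (fun s => (k s - 1) ^ 2 * exp (12 * s))
        (fun s => (12 * (k s - 1) ^ 2 - 2 * (k s - 1) * (k s * t s)) * exp (12 * s))); [lra|].
      intros z Hz; assert (Hzi : in_intv a b z) by now apply intv_between with s1 s2.
      destruct (Horb z Hzi) as [_ Hkz]; split; [solve_derive; ring|].
      apply Rmult_le_pos; [|apply Rlt_le, exp_pos].
      specialize (Ht z (proj1 Hz) Hzi); specialize (H z (proj1 Hz) Hzi).
      apply Rabs_def2 in H.
      assert (Hkt : (k z * t z) ^ 2 <= 36 * (k z - 1) ^ 2).
      { assert (0 <= t z ^ 2) by apply pow2_ge_0.
        rewrite Rpow_mult_distr; assert (k z ^ 2 <= 4) by nra; nra. }
      nra. }
    assert (He : exp (12 * s2) <= exp (12 * r)) by (apply Rlt_le, exp_increasing; lra).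
    assert (Hmr : m * exp (12 * r) = (k s1 - 1) ^ 2 * exp (12 * s1)).
    { unfold m; rewrite Rmult_assoc, <- exp_plus.
      replace (- (12 * r) + 12 * r) with 0 by ring; rewrite exp_0; ring. }
    assert (H4 : Rabs (k s2 - 1) < 1) by (apply Rlt_le_trans with (1 := H3), Rmin_l).
    assert (H5 : Rabs (k s2 - 1) < m) by (apply Rlt_le_trans with (1 := H3), Rmin_r).
    assert (H6 : (k s2 - 1) ^ 2 < m).
    { rewrite <- pow2_abs; assert (H7 := Rabs_pos (k s2 - 1)); nra. }
    assert (H8 := exp_pos (12 * r)); assert (H9 := exp_pos (12 * s2)).
    assert (H10 : 0 <= (k s2 - 1) ^ 2) by apply pow2_ge_0.
    nra.
  - intros eps He.
    destruct (right_end_elim a b s1 _ Hs1 (Hk (eps / 3) ltac:(lra))) as (s2 & H2 & Hs2 & H3).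
    apply (right_end_intro a b s2 _ Hs2); intros s Hs Hi.
    specialize (H3 s (Rlt_le _ _ Hs) Hi).
    specialize (Hta s ltac:(lra) Hi); split; lra.
Qed.

End RightEnd.

(** * Orbits and their ends *)

Lemma right_kind_ext e b t k t' k' :
  right_end b (fun s => t' s = t s /\ k' s = k s) ->
  right_kind e b t k -> right_kind e b t' k'.
Proof.
  intros Hext; destruct e; simpl.
  - intros (Hb & Hk & Ht); split; [assumption|]; split.
    + intros eps He; apply filter_imp with (2 := filter_and _ _ Hext (Hk eps He)).
      now intros s [[_ ->] H].
    + intros M; apply filter_imp with (2 := filter_and _ _ Hext (Ht M)).
      now intros s [[-> _] H].
  - intros (Hb & Hk); split; [assumption|].
    intros eps He; apply filter_imp with (2 := filter_and _ _ Hext (Hk eps He)).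
    now intros s [[-> ->] H].
  - intros (Hb & Hk); split; [assumption|].
    intros M; apply filter_imp with (2 := filter_and _ _ Hext (Hk M)).
    now intros s [[-> ->] H].
Qed.

Lemma left_kind_reverse e b t k : right_kind e b t k ->
  left_kind e (Rbar_opp b) (fun s => - t (- s)) (fun s => k (- s)).
Proof.
  intros H; unfold left_kind; rewrite Rbar_opp_involutive.
  apply right_kind_ext with (2 := H), filter_forall; intros s.
  rewrite !Ropp_involutive; now split.
Qed.

Section LeftEnd.

Variables (a b : Rbar) (t k : R -> R) (s0 c : R).
Hypothesis Hs0 : in_intv a b s0.
Hypothesis Horb : orbit a b t k.
Hypothesis Hpos : forall s, in_intv a b s -> 0 < k s.
Hypothesis Hc : forall s, in_intv a b s -> 2 * ln (k s) + t s ^ 2 - k s ^ 2 = c.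

Lemma reversed_pos s : in_intv (Rbar_opp b) (Rbar_opp a) s -> 0 < k (- s).
Proof. intros H; apply Hpos; now apply intv_opp_inv. Qed.

Lemma reversed_energy s : in_intv (Rbar_opp b) (Rbar_opp a) s ->
  2 * ln (k (- s)) + (- t (- s)) ^ 2 - k (- s) ^ 2 = c.
Proof.
  intros H; rewrite <- (Hc (- s)); [ring|now apply intv_opp_inv].
Qed.

Lemma left_kind_flat :
  (forall eps, 0 < eps -> left_end a (fun s => k s < eps)) ->
  left_end a (fun s => t s < 0) -> left_kind Flat a t k.
Proof.
  intros Hk Ht; apply right_kind_flat with (Rbar_opp b) (- s0) c.
  - now apply intv_opp.
  - now apply orbit_reverse.
  - exact reversed_pos.
  - exact reversed_energy.
  - intros eps He; apply (left_end_opp a (fun s => k s < eps)); auto.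
  - apply left_end_opp in Ht; apply filter_imp with (2 := Ht); intros s; lra.
Qed.

Lemma left_kind_sharp :
  (forall M, left_end a (fun s => M < k s)) ->
  left_end a (fun s => 0 < t s) -> left_kind Sharp a t k.
Proof.
  intros Hk Ht; apply right_kind_sharp with (Rbar_opp b) (- s0) c.
  - now apply intv_opp.
  - now apply orbit_reverse.
  - exact reversed_pos.
  - exact reversed_energy.
  - intros M; apply (left_end_opp a (fun s => M < k s)); auto.
  - apply left_end_opp in Ht; apply filter_imp with (2 := Ht); intros s; lra.
Qed.

Lemma left_kind_unit : c = -1 ->
  (forall eps, 0 < eps -> left_end a (fun s => Rabs (k s - 1) < eps)) ->
  (forall s, in_intv a b s -> k s <> 1) -> left_kind Unit a t k.
Proof.
  intros Hc1 Hk Hne; apply right_kind_unit with (Rbar_opp b) (- s0) c; trivial.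
  - now apply intv_opp.
  - now apply orbit_reverse.
  - exact reversed_pos.
  - exact reversed_energy.
  - intros eps He; apply (left_end_opp a (fun s => Rabs (k s - 1) < eps)); auto.
  - intros s Hs; apply Hne; now apply intv_opp_inv.
Qed.

End LeftEnd.

(** These are the crossings of the light-like lines, because [<X,X> = t^2 - k^2]. *)
Definition crossings (a b : Rbar) (t k : R -> R) (n : nat) : Prop :=
  exists l : list R, NoDup l /\ length l = n /\
    forall s, In s l <-> in_intv a b s /\ t s ^ 2 = k s ^ 2.

Definition phase (eL eR : end_kind) (n : nat) (a b : Rbar) (t k : R -> R) : Prop :=
  orbit a b t k /\ (forall s, in_intv a b s -> 0 < k s) /\
  left_kind eL a t k /\ right_kind eR b t k /\ crossings a b t k n.

Definition phase_through eL eR n s0 t0 k0 : Prop :=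
  exists a b t k, phase eL eR n a b t k /\ in_intv a b s0 /\ t s0 = t0 /\ k s0 = k0.

Lemma phase_through_reverse eL eR n s0 t0 k0 :
  phase_through eL eR n (- s0) (- t0) k0 -> phase_through eR eL n s0 t0 k0.
Proof.
  intros (a & b & t & k & (Ho & Hp & HL & HR & l & Hl1 & Hl2 & Hl3) & Hs0 & Ht0 & Hk0).
  exists (Rbar_opp b), (Rbar_opp a), (fun s => - t (- s)), (fun s => k (- s)).
  split; [|split; [|split]].
  - split; [now apply orbit_reverse|]; split; [|split; [|split]].
    + intros s Hs; apply Hp; now apply intv_opp_inv.
    + now apply left_kind_reverse.
    + exact HL.
    + exists (map Ropp l); split; [|split].
      * apply FinFun.Injective_map_NoDup; trivial.
        intros x y Hxy; lra.
      * now rewrite length_map.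
      * intros s; split.
        -- intros H; apply in_map_iff in H; destruct H as (x & <- & Hx).
           apply Hl3 in Hx; destruct Hx as [H1 H2]; split; [now apply intv_opp|].
           rewrite Ropp_involutive, <- H2; ring.
        -- intros [H1 H2]; apply in_map_iff; exists (- s).
           split; [ring|]; apply Hl3; split; [now apply intv_opp_inv|].
           rewrite <- H2; ring.
  - rewrite <- (Ropp_involutive s0); now apply intv_opp.
  - rewrite Ht0; ring.
  - exact Hk0.
Qed.

Lemma ln_lt_sub_one x : 0 < x -> x <> 1 -> ln x < x - 1.
Proof.
  intros Hx Hx1; assert (H := exp_ineq1 (ln x)); rewrite exp_ln in H by trivial.
  cut (ln x <> 0); [intros H0; specialize (H H0); lra|].
  intros H0; apply Hx1; rewrite <- (exp_ln x), H0 by trivial; apply exp_0.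
Qed.

Lemma ln_ge_one_sub_inv x : 0 < x -> 1 - / x <= ln x.
Proof.
  intros Hx; assert (H := ln_le_sub_one _ (Rinv_0_lt_compat _ Hx)).
  rewrite ln_Rinv in H by trivial; lra.
Qed.

(** This is [ln y < y - 1] at [y = x^2]. It makes [t^2 = c - 2 ln k + k^2] positive for [k <> 1] as
    soon as [c >= -1]. *)
Lemma critical_level x : 0 < x -> x <> 1 -> 2 * ln x - x ^ 2 < -1.
Proof.
  intros Hx Hx1.
  assert (H : ln (x ^ 2) < x ^ 2 - 1).
  { apply ln_lt_sub_one; [now apply pow_lt|]; intros H; apply Hx1; nra. }
  replace (x ^ 2) with (x * x) in H at 1 by ring.
  rewrite ln_mult in H by trivial; lra.
Qed.

(* Orbits on which [t] does not vanish are parametrised by [k], with [t = - sqrt (c - 2 ln k + k^2)]. *)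
Lemma orbit_by_curvature (al be : Rbar) s0 t0 k0 :
  let c := 2 * ln k0 + t0 ^ 2 - k0 ^ 2 in
  in_intv al be k0 -> t0 < 0 ->
  (forall x, in_intv al be x -> 0 < x /\ 0 < c - 2 * ln x + x ^ 2) ->
  exists a b t k, in_intv a b s0 /\ t s0 = t0 /\ k s0 = k0 /\ orbit a b t k /\
    (forall s, in_intv a b s -> in_intv al be (k s) /\ t s < 0 /\
       2 * ln (k s) + t s ^ 2 - k s ^ 2 = c) /\
    (forall x, in_intv al be x -> exists s, in_intv a b s /\ k s = x) /\
    (forall x, in_intv al be x -> right_end b (fun s => in_intv al be (k s) /\ x < k s)) /\
    (forall x, in_intv al be x -> left_end a (fun s => in_intv al be (k s) /\ k s < x)).
Proof.
  intros c Hk0 Ht0 Hh.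
  pose (h := fun x => c - 2 * ln x + x ^ 2).
  assert (Hdh : forall x, 0 < x -> is_derive h x (- 2 / x + 2 * x)).
  { intros x Hx; unfold h; auto_derive; [lra|field; lra]. }
  assert (Hds : forall x, in_intv al be x ->
    is_derive (fun x => sqrt (h x)) x ((- 2 / x + 2 * x) / (2 * sqrt (h x)))).
  { intros x Hx; destruct (Hh x Hx) as [H1 H2]; specialize (Hdh x H1).
    assert (Hs := sqrt_lt_R0 _ H2).
    solve_derive; field; unfold h; split; lra. }
  (* On this branch [k' = - k t] is an autonomous equation for [k] alone, with positive right-hand
     side. *)
  destruct (autonomous_solution al be (fun x => x * sqrt (h x)) s0 k0 Hk0)
    as (a & b & k & H1 & H2 & H3 & H4 & H5 & H6).
  - intros x Hx; destruct (Hh x Hx) as [Hx1 Hx2]; split.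
    + apply continuity_pt_mult; [apply derivable_continuous_pt, derivable_pt_id|].
      eapply is_derive_continuity_pt, Hds, Hx.
    + apply Rmult_lt_0_compat; trivial; now apply sqrt_lt_R0.
  - exists a, b, (fun s => - sqrt (h (k s))), k.
    split; [assumption|]; split; [|split; [assumption|]; split; [|split; [|now split]]].
    + rewrite H2; unfold h, c.
      replace (2 * ln k0 + t0 ^ 2 - k0 ^ 2 - 2 * ln k0 + k0 ^ 2) with ((- t0) ^ 2) by ring.
      rewrite sqrt_pow2; lra.
    + intros s Hs; destruct (H3 s Hs) as [Hks Hdk].
      destruct (Hh _ Hks) as [Hx1 Hx2]; assert (Hd := Hds _ Hks).
      assert (Hsq := sqrt_lt_R0 _ Hx2); split.
      (* Naming the root keeps the chain rule abstract: [r'(k)] has [sqrt (h k)] in its denominator,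
         [k'] has it as a factor, and [1 - k^2] is left. *)
      * pose (r := fun x => sqrt (h x)).
        assert (Hr : is_derive r (k s) ((- 2 / k s + 2 * k s) / (2 * sqrt (h (k s))))) by exact Hd.
        apply (is_derive_ext (fun s => - r (k s))); [reflexivity|].
        solve_derive; unfold h; field; split; lra.
      * replace (- (k s * - sqrt (h (k s)))) with (k s * sqrt (h (k s))) by ring.
        exact Hdk.
    + intros s Hs; destruct (H3 s Hs) as [Hks _].
      destruct (Hh _ Hks) as [Hx1 Hx2]; assert (Hsq := sqrt_lt_R0 _ Hx2).
      split; [assumption|]; split; [unfold h; lra|].
      replace ((- sqrt (h (k s))) ^ 2) with (h (k s)).
      * unfold h; ring.
      * rewrite <- (pow2_sqrt (h (k s))) at 1 by (unfold h; lra); ring.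
Qed.

(** On the level [c], the equation [t^2 = k^2] means [k = exp (c / 2)], a value that the strictly
    increasing [k] takes exactly once. *)
Lemma orbit_by_curvature_crossing a b t k c al be :
  orbit a b t k ->
  (forall s, in_intv a b s -> in_intv al be (k s) /\ t s < 0 /\
     2 * ln (k s) + t s ^ 2 - k s ^ 2 = c) ->
  (forall x, in_intv al be x -> 0 < x) ->
  (forall x, in_intv al be x -> exists s, in_intv a b s /\ k s = x) ->
  in_intv al be (exp (c / 2)) -> crossings a b t k 1.
Proof.
  intros Ho Hs Hal Hsurj Hc; destruct (Hsurj _ Hc) as (s1 & Hs1 & Hk1).
  assert (Hinc : forall x y, in_intv a b x -> in_intv a b y -> x < y -> k x < k y).
  { intros x y Hx Hy Hxy; apply (derive_pos_lt k (fun s => - (k s * t s)) x y Hxy).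
    intros z Hz; assert (Hzi : in_intv a b z) by now apply intv_between with x y.
    split; [now apply Ho|]; destruct (Hs z Hzi) as (H1 & H2 & _); apply Hal in H1; nra. }
  exists (s1 :: nil); split; [|split; [reflexivity|]].
  - constructor; [easy|constructor].
  - intros s; split.
    + intros [<-|[]]; split; [assumption|].
      destruct (Hs s1 Hs1) as (_ & _ & H); rewrite Hk1, ln_exp in H; rewrite Hk1; lra.
    + intros [Hi Heq]; left.
      destruct (Hs s Hi) as (H1 & _ & H); assert (Hl : ln (k s) = c / 2) by lra.
      assert (Hks : k s = k s1) by (rewrite Hk1, <- Hl, exp_ln; auto).
      destruct (Rtotal_order s s1) as [Hlt|[Heq'|Hlt]]; [|easy|].
      * apply Hinc in Hlt; trivial; lra.
      * apply Hinc in Hlt; trivial; lra.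
Qed.

(** Above the critical level the radicand stays positive for every [k > 0], so [k] sweeps [(0, oo)]
    and in particular passes [exp (c / 2)]. *)
Lemma phase_flat_sharp s0 t0 k0 : 0 < k0 -> t0 < 0 -> -1 < 2 * ln k0 + t0 ^ 2 - k0 ^ 2 ->
  phase_through Flat Sharp 1 s0 t0 k0.
Proof.
  intros Hk0 Ht0 Hc.
  assert (Hin : forall x, in_intv 0 p_infty x <-> 0 < x)
    by (intros x; unfold in_intv; simpl; tauto).
  destruct (orbit_by_curvature 0 p_infty s0 t0 k0) as
    (a & b & t & k & H1 & H2 & H3 & H4 & H5 & H6 & H7 & H8).
  - now apply Hin.
  - exact Ht0.
  - intros x Hx; apply Hin in Hx; split; trivial.
    destruct (Req_dec x 1) as [->|Hx1]; [rewrite ln_1; lra|].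
    assert (H := critical_level x Hx Hx1); lra.
  - assert (Hpos : forall s, in_intv a b s -> 0 < k s) by (intros s Hs; now apply Hin, H5).
    assert (Hen : forall s, in_intv a b s ->
      2 * ln (k s) + t s ^ 2 - k s ^ 2 = 2 * ln k0 + t0 ^ 2 - k0 ^ 2) by (intros s Hs; now apply H5).
    assert (Hab : Rbar_lt a b) by (destruct H1; now apply Rbar_lt_trans with s0).
    exists a, b, t, k; split; [|now split].
    split; [assumption|]; split; [assumption|]; split; [|split].
    + eapply left_kind_flat; eauto.
      * intros eps He; apply filter_imp with (2 := H8 eps (proj2 (Hin eps) He)); tauto.
      * apply filter_imp with (2 := left_end_intv a b Hab); intros s Hs; now apply H5.
    + eapply right_kind_sharp; eauto.
      * intros M.
        assert (HM : 0 < Rabs M + 1) by (assert (H := Rabs_pos M); lra).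
        apply filter_imp with (2 := H7 _ (proj2 (Hin _) HM)); intros s [_ H].
        assert (H' := Rle_abs M); lra.
      * apply filter_imp with (2 := right_end_intv a b Hab); intros s Hs; now apply H5.
    + eapply orbit_by_curvature_crossing; eauto.
      * intros x; apply Hin.
      * apply Hin, exp_pos.
Qed.

Lemma phase_flat_unit s0 t0 k0 : 0 < k0 < 1 -> t0 < 0 -> 2 * ln k0 + t0 ^ 2 - k0 ^ 2 = -1 ->
  phase_through Flat Unit 1 s0 t0 k0.
Proof.
  intros Hk0 Ht0 Hc.
  assert (Hin : forall x, in_intv 0 1 x <-> 0 < x < 1)
    by (intros x; unfold in_intv; simpl; tauto).
  destruct (orbit_by_curvature 0 1 s0 t0 k0) as
    (a & b & t & k & H1 & H2 & H3 & H4 & H5 & H6 & H7 & H8).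
  - now apply (proj2 (Hin _)).
  - exact Ht0.
  - intros x Hx; apply (proj1 (Hin _)) in Hx; split; [lra|].
    assert (H := critical_level x ltac:(lra) ltac:(lra)); lra.
  - rewrite Hc in H5.
    assert (Hpos : forall s, in_intv a b s -> 0 < k s) by (intros s Hs; now apply (proj1 (Hin _)), H5).
    assert (Hen : forall s, in_intv a b s ->
      2 * ln (k s) + t s ^ 2 - k s ^ 2 = -1) by (intros s Hs; now apply H5).
    assert (Hab : Rbar_lt a b) by (destruct H1; now apply Rbar_lt_trans with s0).
    exists a, b, t, k; split; [|now split].
    split; [assumption|]; split; [assumption|]; split; [|split].
    + eapply left_kind_flat; eauto.
      * intros eps He.
        assert (H : 0 < Rmin eps (1 / 2)) by (apply Rmin_pos; lra).
        assert (H' := Rmin_r eps (1 / 2)).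
        assert (Hm : in_intv 0 1 (Rmin eps (1 / 2))) by (apply (proj2 (Hin _)); split; lra).
        apply filter_imp with (2 := H8 _ Hm).
        intros s [_ Hs]; apply Rlt_le_trans with (1 := Hs), Rmin_l.
      * apply filter_imp with (2 := left_end_intv a b Hab); intros s Hs; now apply H5.
    + eapply right_kind_unit; eauto.
      * intros eps He.
        assert (H : Rmax (1 - eps) (1 / 2) < 1) by (apply Rmax_lub_lt; lra).
        assert (H' := Rmax_r (1 - eps) (1 / 2)); assert (H'' := Rmax_l (1 - eps) (1 / 2)).
        assert (Hm : in_intv 0 1 (Rmax (1 - eps) (1 / 2))) by (apply (proj2 (Hin _)); split; lra).
        apply filter_imp with (2 := H7 _ Hm).
        intros s [Hs1 Hs]; apply (proj1 (Hin _)) in Hs1; apply Rabs_def1; lra.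
      * intros s Hs; destruct (H5 s Hs) as [H _]; apply (proj1 (Hin _)) in H; lra.
    + eapply orbit_by_curvature_crossing; eauto.
      * intros x Hx; now apply (proj1 (Hin _)).
      * apply (proj2 (Hin _)); split; [apply exp_pos|]; rewrite <- exp_0; apply exp_increasing; lra.
Qed.

(** A light-like point would need [2 ln k = -1], whereas [k > 1] here; on the branch [k < 1] of the
    same level it does occur. *)
Lemma phase_unit_sharp s0 t0 k0 : 1 < k0 -> t0 < 0 -> 2 * ln k0 + t0 ^ 2 - k0 ^ 2 = -1 ->
  phase_through Unit Sharp 0 s0 t0 k0.
Proof.
  intros Hk0 Ht0 Hc.
  assert (Hin : forall x, in_intv 1 p_infty x <-> 1 < x)
    by (intros x; unfold in_intv; simpl; tauto).
  destruct (orbit_by_curvature 1 p_infty s0 t0 k0) as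
    (a & b & t & k & H1 & H2 & H3 & H4 & H5 & H6 & H7 & H8).
  - now apply (proj2 (Hin _)).
  - exact Ht0.
  - intros x Hx; apply (proj1 (Hin _)) in Hx; split; [lra|].
    assert (H := critical_level x ltac:(lra) ltac:(lra)); lra.
  - rewrite Hc in H5.
    assert (Hgt : forall s, in_intv a b s -> 1 < k s) by (intros s Hs; now apply (proj1 (Hin _)), H5).
    assert (Hpos : forall s, in_intv a b s -> 0 < k s) by (intros s Hs; specialize (Hgt s Hs); lra).
    assert (Hen : forall s, in_intv a b s ->
      2 * ln (k s) + t s ^ 2 - k s ^ 2 = -1) by (intros s Hs; now apply H5).
    assert (Hab : Rbar_lt a b) by (destruct H1; now apply Rbar_lt_trans with s0).
    exists a, b, t, k; split; [|now split].
    split; [assumption|]; split; [assumption|]; split; [|split].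
    + eapply left_kind_unit; eauto.
      * intros eps He.
        apply filter_imp with (2 := H8 (1 + eps) (proj2 (Hin (1 + eps)) ltac:(lra))).
        intros s [Hs1 Hs]; apply (proj1 (Hin _)) in Hs1; apply Rabs_def1; lra.
      * intros s Hs; specialize (Hgt s Hs); lra.
    + eapply right_kind_sharp; eauto.
      * intros M.
        assert (HM : 1 < Rabs M + 2) by (assert (H := Rabs_pos M); lra).
        apply filter_imp with (2 := H7 _ (proj2 (Hin _) HM)); intros s [_ H].
        assert (H' := Rle_abs M); lra.
      * apply filter_imp with (2 := right_end_intv a b Hab); intros s Hs; now apply H5.
    + exists nil; split; [constructor|]; split; [reflexivity|].
      intros s; split; [easy|]; intros [Hi Heq].
      specialize (Hgt s Hi); specialize (Hen s Hi).
      assert (Hl := ln_increasing 1 (k s) ltac:(lra) Hgt); rewrite ln_1 in Hl; lra.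
Qed.

Lemma phase_fixed_point : phase Unit Unit 0 m_infty p_infty (fun _ => 0) (fun _ => 1).
Proof.
  assert (Hk : right_kind Unit p_infty (fun _ => 0) (fun _ => 1)).
  { split; [reflexivity|]; intros eps He; apply filter_forall; intros _.
    rewrite Rminus_diag, Rabs_R0; now split. }
  split; [|split; [intros; lra|split; [|split; [assumption|]]]].
  - intros s _; split.
    + replace (1 - 1 ^ 2) with 0 by ring; apply (is_derive_const 0).
    + replace (- (1 * 0)) with 0 by ring; apply (is_derive_const 1).
  - apply right_kind_ext with (2 := Hk), filter_forall; intros; split; ring.
  - exists nil; split; [constructor|]; split; [reflexivity|].
    intros s; split; [easy|]; intros [_ H]; lra.
Qed.

(** Below the critical level [t] changes sign, so [k] cannot serve as parameter. Instead
    [k = g (c - t^2)], with [g] the inverse of the increasing branch of [2 ln x - x^2] on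
    [(0, 1)]. *)
Lemma curvature_below_one : exists g : R -> R,
  (forall w, w < -1 -> 0 < g w < 1 /\ 2 * ln (g w) - g w ^ 2 = w /\
     is_derive g w (/ (2 / g w - 2 * g w))) /\
  (forall x, 0 < x < 1 -> g (2 * ln x - x ^ 2) = x).
Proof.
  destruct (inverse_function 0 1 (fun x => 2 * ln x - x ^ 2) (fun x => 2 / x - 2 * x))
    as (a & b & g & H1 & H2 & _ & _).
  - simpl; lra.
  - intros x [Hx0 Hx1]; simpl in Hx0, Hx1; split.
    + auto_derive; [lra|field; lra].
    + cut (1 < / x); [unfold Rdiv; lra|].
      rewrite <- Rinv_1; apply Rinv_lt_contravar; lra.
  - exists g; split; [|intros x Hx; now apply H1].
    intros w Hw.
    assert (Hi : in_intv a b w).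
    (* Two points whose values enclose [w]: at [x1] the value is [w - x1^2], and at [x2] the bound
       [ln x >= 1 - / x] gives at least [1 + w - x2^2 >= w]. *)
    { pose (x1 := exp (w / 2)); pose (x2 := / (1 - (1 + w) / 2)).
      assert (Hx1 : 0 < x1 < 1).
      { unfold x1; split; [apply exp_pos|]; rewrite <- exp_0; apply exp_increasing; lra. }
      assert (Hx2 : 0 < x2 < 1).
      { unfold x2; split; [apply Rinv_0_lt_compat; lra|].
        rewrite <- Rinv_1; apply Rinv_lt_contravar; lra. }
      apply intv_between with (2 * ln x1 - x1 ^ 2) (2 * ln x2 - x2 ^ 2);
        [now apply H1|now apply H1|].
      split.
      - unfold x1 at 1; rewrite ln_exp; assert (H := pow2_ge_0 x1); lra.
      - assert (H := ln_ge_one_sub_inv x2 (proj1 Hx2)).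
        unfold x2 in H at 1; rewrite Rinv_inv in H.
        assert (x2 ^ 2 <= 1) by nra; lra. }
    destruct (H2 w Hi) as (H3 & H4 & H5); split; [exact H3|now split].
Qed.

(** The other branch of the same relation, with opposite sign so that it is increasing; it gives
    [k = g (t^2 - c)] on the orbits with [k > 1]. *)
Lemma curvature_above_one : exists g : R -> R,
  forall w, 1 < w -> 1 < g w /\ g w ^ 2 - 2 * ln (g w) = w /\
     is_derive g w (/ (2 * g w - 2 / g w)).
Proof.
  destruct (inverse_function 1 p_infty (fun x => x ^ 2 - 2 * ln x) (fun x => 2 * x - 2 / x))
    as (a & b & g & H1 & H2 & _ & _).
  - exact I.
  - intros x [Hx0 _]; simpl in Hx0; split.
    + auto_derive; [lra|field; lra].
    + cut (/ x < 1); [unfold Rdiv; lra|].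
      rewrite <- Rinv_1; apply Rinv_lt_contravar; lra.
  - exists g; intros w Hw.
    assert (Hi : in_intv a b w).
    (* At [1 + d] the value is at most [1 + 3 d^2 <= 1 + 3 d <= w]; at [1 + w] it is at least
       [1 + w^2 >= w]. *)
    { pose (d := Rmin 1 ((w - 1) / 3)).
      assert (Hd : 0 < d) by (apply Rmin_pos; lra).
      assert (Hd1 : d <= 1) by apply Rmin_l.
      assert (Hd2 : d <= (w - 1) / 3) by apply Rmin_r.
      assert (Hx1 : in_intv 1 p_infty (1 + d)) by (split; simpl; trivial; lra).
      assert (Hx2 : in_intv 1 p_infty (1 + w)) by (split; simpl; trivial; lra).
      apply intv_between with ((1 + d) ^ 2 - 2 * ln (1 + d)) ((1 + w) ^ 2 - 2 * ln (1 + w));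
        [now apply H1|now apply H1|].
      split.
      - assert (H := ln_ge_one_sub_inv (1 + d) ltac:(lra)).
        assert (/ (1 + d) <= 1 - d + d ^ 2).
        { apply Rmult_le_reg_r with (1 + d); [lra|]; rewrite Rinv_l by lra.
          assert (0 < d ^ 3) by (apply pow_lt; lra); nra. }
        nra.
      - assert (H := ln_le_sub_one (1 + w) ltac:(lra)); nra. }
    destruct (H2 w Hi) as (H3 & H4 & H5); split; [apply H3|now split].
Qed.

Lemma line_in_intv x : in_intv m_infty p_infty x.
Proof. now split. Qed.

(** With [k = q t] below 1, [t' = 1 - q(t)^2] is positive and [t] runs over the whole line. The
    light-like points have [k = exp (c / 2)], hence [t = exp (c / 2)] or [t = - exp (c / 2)]: two
    crossings. *)
Lemma phase_flat_flat s0 t0 k0 : 0 < k0 < 1 -> 2 * ln k0 + t0 ^ 2 - k0 ^ 2 < -1 ->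
  phase_through Flat Flat 2 s0 t0 k0.
Proof.
  intros Hk0 Hc; set (c := 2 * ln k0 + t0 ^ 2 - k0 ^ 2) in *.
  destruct curvature_below_one as (g & Hg & Hginv).
  assert (Hw : forall x, c - x ^ 2 < -1) by (intros x; assert (H := pow2_ge_0 x); lra).
  pose (q := fun x => g (c - x ^ 2)).
  assert (Hq : forall x, 0 < q x < 1 /\ 2 * ln (q x) - q x ^ 2 = c - x ^ 2 /\
     is_derive q x (/ (2 / q x - 2 * q x) * (- (2 * x)))).
  { intros x; destruct (Hg _ (Hw x)) as (H1 & H2 & H3).
    split; [exact H1|]; split; [exact H2|].
    unfold q; solve_derive; ring. }
  destruct (autonomous_solution m_infty p_infty (fun x => 1 - q x ^ 2) s0 t0 (line_in_intv _))
    as (a & b & t & H1 & H2 & H3 & H4 & H5 & H6).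
  { intros x _; destruct (Hq x) as (Hx1 & _ & Hx2); split; [|nra].
    apply is_derive_continuity_pt with
      (- (2 * q x * (/ (2 / q x - 2 * q x) * (- (2 * x))))).
    solve_derive; ring. }
  assert (Hab : Rbar_lt a b) by (destruct H1; now apply Rbar_lt_trans with s0).
  assert (Ho : orbit a b t (fun s => q (t s))).
  { intros s Hs; destruct (H3 s Hs) as [_ H]; split; [exact H|].
    destruct (Hq (t s)) as (Hx1 & _ & Hx2); solve_derive.
    field; split; nra. }
  assert (Hpos : forall s, in_intv a b s -> 0 < q (t s)) by (intros s _; apply Hq).
  assert (Hen : forall s, in_intv a b s ->
    2 * ln (q (t s)) + t s ^ 2 - q (t s) ^ 2 = c).
  { intros s _; destruct (Hq (t s)) as (_ & Hx & _); lra. }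
  (* Since [q^2 < 1], the level equation gives [2 ln q < c + 1 - x^2]; the added 1 makes [x^2]
     exceed the absolute value. *)
  assert (Hsmall : forall eps x, 0 < eps -> Rabs (c + 1 - 2 * ln eps) + 1 < Rabs x -> q x < eps).
  { intros eps x He Hx; destruct (Hq x) as (Hx1 & Hx2 & _).
    apply ln_lt_inv; [lra|trivial|].
    assert (H := Rle_abs (c + 1 - 2 * ln eps)); assert (H' := Rabs_pos (c + 1 - 2 * ln eps)).
    rewrite <- (pow2_abs x) in Hx2; assert (q x ^ 2 < 1) by nra; nra. }
  exists a, b, t, (fun s => q (t s)); split; [|split; [assumption|split; [assumption|]]].
  - split; [assumption|]; split; [assumption|]; split; [|split].
    + eapply left_kind_flat; eauto.
      * intros eps He.
        apply filter_imp with (2 := H6 (- (Rabs (c + 1 - 2 * ln eps) + 1)) (line_in_intv _)).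
        intros s [_ Hs]; apply Hsmall; trivial.
        assert (H := Rabs_maj2 (t s)); lra.
      * apply filter_imp with (2 := H6 0 (line_in_intv _)); tauto.
    + eapply right_kind_flat; eauto.
      * intros eps He.
        apply filter_imp with (2 := H5 (Rabs (c + 1 - 2 * ln eps) + 1) (line_in_intv _)).
        intros s [_ Hs]; apply Hsmall; trivial.
        assert (H := Rle_abs (t s)); lra.
      * apply filter_imp with (2 := H5 0 (line_in_intv _)); tauto.
    + assert (He := exp_pos (c / 2)).
      assert (He1 : exp (c / 2) < 1) by (rewrite <- exp_0; apply exp_increasing; lra).
      assert (Hqe : forall x, x ^ 2 = exp (c / 2) ^ 2 -> q x = exp (c / 2)).
      { intros x Hx; unfold q; rewrite Hx.
        rewrite <- (Hginv (exp (c / 2))) at 2 by now split.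
        rewrite ln_exp; f_equal; field. }
      destruct (H4 (exp (c / 2)) (line_in_intv _)) as (s1 & Hs1 & Ht1).
      destruct (H4 (- exp (c / 2)) (line_in_intv _)) as (s2 & Hs2 & Ht2).
      assert (Hinc : forall x y, in_intv a b x -> in_intv a b y -> x < y -> t x < t y).
      { intros x y Hx Hy Hxy; apply (derive_pos_lt t (fun s => 1 - q (t s) ^ 2) x y Hxy).
        intros z Hz; assert (Hzi : in_intv a b z) by now apply intv_between with x y.
        split; [now apply H3|]; destruct (Hq (t z)) as (Hx1 & _ & _); nra. }
      assert (Hinj : forall x y, in_intv a b x -> in_intv a b y -> t x = t y -> x = y).
      { intros x y Hx Hy Hxy; destruct (Rtotal_order x y) as [H|[H|H]]; trivial;
          apply Hinc in H; trivial; lra. }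
      exists (s1 :: s2 :: nil); split; [|split; [reflexivity|]].
      * constructor; [|constructor; [easy|constructor]].
        intros [H|[]]; subst; lra.
      * intros s; split.
        -- intros [<-|[<-|[]]]; (split; [assumption|]).
           ++ rewrite (Hqe (t s1)); rewrite Ht1; trivial.
           ++ rewrite (Hqe (t s2)); rewrite Ht2; ring.
        -- intros [Hi Heq]; specialize (Hen s Hi).
           assert (Hl : ln (q (t s)) = c / 2) by lra.
           assert (Hqs : q (t s) = exp (c / 2)) by (rewrite <- Hl, exp_ln; auto).
           rewrite Hqs in Heq.
           assert (Hts : (t s - exp (c / 2)) * (t s + exp (c / 2)) = 0) by lra.
           apply Rmult_integral in Hts; destruct Hts as [Hts|Hts].
           ++ left; apply Hinj; trivial; lra.
           ++ right; left; apply Hinj; trivial; lra.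
  - unfold q; rewrite H2.
    replace (c - t0 ^ 2) with (2 * ln k0 - k0 ^ 2) by (unfold c; ring); auto.
Qed.

(** Here [t] decreases, so the equation is solved for [p = - t]. There is no crossing: it would
    require [2 ln k = c < -1], but [k > 1]. *)
Lemma phase_sharp_sharp s0 t0 k0 : 1 < k0 -> 2 * ln k0 + t0 ^ 2 - k0 ^ 2 < -1 ->
  phase_through Sharp Sharp 0 s0 t0 k0.
Proof.
  intros Hk0 Hc; set (c := 2 * ln k0 + t0 ^ 2 - k0 ^ 2) in *.
  destruct curvature_above_one as (g & Hg).
  assert (Hw : forall x, 1 < x ^ 2 - c) by (intros x; assert (H := pow2_ge_0 x); lra).
  pose (q := fun x => g (x ^ 2 - c)).
  assert (Hq : forall x, 1 < q x /\ q x ^ 2 - 2 * ln (q x) = x ^ 2 - c /\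
     is_derive q x (/ (2 * q x - 2 / q x) * (2 * x))).
  { intros x; destruct (Hg _ (Hw x)) as (H1 & H2 & H3).
    split; [exact H1|]; split; [exact H2|].
    unfold q; solve_derive; ring. }
  destruct (autonomous_solution m_infty p_infty (fun x => q x ^ 2 - 1) s0 (- t0) (line_in_intv _))
    as (a & b & p & H1 & H2 & H3 & H4 & H5 & H6).
  { intros x _; destruct (Hq x) as (Hx1 & _ & Hx2); split; [|nra].
    apply is_derive_continuity_pt with
      (2 * q x * (/ (2 * q x - 2 / q x) * (2 * x))).
    solve_derive; ring. }
  assert (Hab : Rbar_lt a b) by (destruct H1; now apply Rbar_lt_trans with s0).
  pose (t := fun s => - p s); pose (k := fun s => q (p s)).
  assert (Ho : orbit a b t k).
  { intros s Hs; destruct (H3 s Hs) as [_ H]; unfold t, k; split; [solve_derive; ring|].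
    destruct (Hq (p s)) as (Hx1 & _ & Hx2); solve_derive.
    field; split; nra. }
  assert (Hgt : forall s, in_intv a b s -> 1 < k s) by (intros s _; apply Hq).
  assert (Hpos : forall s, in_intv a b s -> 0 < k s) by (intros s Hs; specialize (Hgt s Hs); lra).
  assert (Hen : forall s, in_intv a b s -> 2 * ln (k s) + t s ^ 2 - k s ^ 2 = c).
  { intros s _; unfold k, t; destruct (Hq (p s)) as (_ & Hx & _).
    replace ((- p s) ^ 2) with (p s ^ 2) by ring; lra. }
  assert (Hlarge : forall M x, Rabs M < Rabs x -> M < q x).
  { intros M x Hx; destruct (Hq x) as (Hx1 & Hx2 & _).
    assert (Hl := ln_increasing 1 (q x) ltac:(lra) Hx1); rewrite ln_1 in Hl.
    assert (H := Rle_abs M); assert (H' := Rabs_pos M).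
    rewrite <- (pow2_abs x) in Hx2; nra. }
  (* [curvature_above_one] only says that [g w] solves the level equation; injectivity of
     [x^2 - 2 ln x] on [(1, oo)] identifies the solution with [k0]. *)
  assert (Hk0' : k s0 = k0).
  { destruct (Req_dec (k s0) k0) as [|Hne]; trivial; exfalso.
    assert (Hinc : forall x y, 1 < x -> x < y -> x ^ 2 - 2 * ln x < y ^ 2 - 2 * ln y).
    { intros x y Hx Hxy; apply (derive_pos_lt (fun x => x ^ 2 - 2 * ln x)
        (fun x => 2 * x - 2 / x) x y Hxy).
      intros z Hz; split; [auto_derive; [lra|field; lra]|].
      cut (/ z < 1); [unfold Rdiv; lra|].
      rewrite <- Rinv_1; apply Rinv_lt_contravar; lra. }
    specialize (Hen s0 H1); specialize (Hgt s0 H1).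
    replace (t s0) with t0 in Hen by (unfold t; lra); unfold c in Hen.
    destruct (Rdichotomy _ _ Hne) as [H|H]; apply Hinc in H; trivial; lra. }
  exists a, b, t, k; split; [|split; [assumption|split; [unfold t; lra|assumption]]].
  split; [assumption|]; split; [assumption|]; split; [|split].
  - eapply left_kind_sharp; eauto.
    + intros M; apply filter_imp with (2 := H6 (- Rabs M) (line_in_intv _)).
      intros s [_ Hs]; apply Hlarge; assert (H := Rabs_maj2 (p s)); lra.
    + apply filter_imp with (2 := H6 0 (line_in_intv _)); intros s [_ H]; unfold t; lra.
  - eapply right_kind_sharp; eauto.
    + intros M; apply filter_imp with (2 := H5 (Rabs M) (line_in_intv _)).
      intros s [_ Hs]; apply Hlarge; assert (H := Rle_abs (p s)); lra.
    + apply filter_imp with (2 := H5 0 (line_in_intv _)); intros s [_ H]; unfold t; lra.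
  - exists nil; split; [constructor|]; split; [reflexivity|].
    intros s; split; [easy|]; intros [Hi Heq].
    specialize (Hgt s Hi); specialize (Hen s Hi).
    assert (Hl := ln_increasing 1 (k s) ltac:(lra) Hgt); rewrite ln_1 in Hl; lra.
Qed.

Definition phase_types : list (end_kind * end_kind * nat) :=
  (Flat, Flat, 2%nat) :: (Flat, Unit, 1%nat) :: (Flat, Sharp, 1%nat) ::
  (Unit, Unit, 0%nat) :: (Unit, Sharp, 0%nat) :: (Sharp, Sharp, 0%nat) :: nil.

(** A vanishing [t0] gives a level at most -1, with equality only at the saddle. On the remaining
    orbits of levels [c >= -1] the sign of [t0] therefore selects the constructed orbit or its
    reversal. *)
Lemma phase_exists s0 t0 k0 : 0 < k0 -> exists eL eR n,
  (In (eL, eR, n) phase_types \/ In (eR, eL, n) phase_types) /\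
  phase_through eL eR n s0 t0 k0.
Proof.
  intros Hk0.
  assert (Hsq : (- t0) ^ 2 = t0 ^ 2) by ring.
  destruct (Rtotal_order (2 * ln k0 + t0 ^ 2 - k0 ^ 2) (-1)) as [Hc|[Hc|Hc]].
  - destruct (Rtotal_order k0 1) as [Hk|[Hk|Hk]].
    + exists Flat, Flat, 2%nat; split; [simpl; tauto|]; now apply phase_flat_flat.
    + rewrite Hk, ln_1 in Hc; assert (H := pow2_ge_0 t0); lra.
    + exists Sharp, Sharp, 0%nat; split; [simpl; tauto|]; now apply phase_sharp_sharp.
  - destruct (Req_dec k0 1) as [Hk|Hk].
    + rewrite Hk, ln_1 in Hc; assert (Ht : t0 = 0) by (apply Rsqr_0_uniq; unfold Rsqr; lra).
      exists Unit, Unit, 0%nat; split; [simpl; tauto|]; rewrite Hk, Ht.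
      exists m_infty, p_infty, (fun _ => 0), (fun _ => 1); split; [exact phase_fixed_point|now split].
    + assert (Ht : t0 <> 0).
      { intros ->; assert (H := critical_level k0 Hk0 Hk); lra. }
      destruct (Rdichotomy _ _ Hk) as [Hk1|Hk1], (Rdichotomy _ _ Ht) as [Ht1|Ht1].
      * exists Flat, Unit, 1%nat; split; [simpl; tauto|]; now apply phase_flat_unit.
      * exists Unit, Flat, 1%nat; split; [simpl; tauto|]; apply phase_through_reverse.
        apply phase_flat_unit; trivial; [now split|lra|now rewrite Hsq].
      * exists Unit, Sharp, 0%nat; split; [simpl; tauto|]; now apply phase_unit_sharp.
      * exists Sharp, Unit, 0%nat; split; [simpl; tauto|]; apply phase_through_reverse.
        apply phase_unit_sharp; trivial; [lra|now rewrite Hsq].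
  - assert (Ht : t0 <> 0).
    { intros ->; destruct (Req_dec k0 1) as [->|Hk]; [rewrite ln_1 in Hc; lra|].
      assert (H := critical_level k0 Hk0 Hk); lra. }
    destruct (Rdichotomy _ _ Ht) as [Ht1|Ht1].
    + exists Flat, Sharp, 1%nat; split; [simpl; tauto|]; now apply phase_flat_sharp.
    + exists Sharp, Flat, 1%nat; split; [simpl; tauto|]; apply phase_through_reverse.
      apply phase_flat_sharp; trivial; [lra|now rewrite Hsq].
Qed.

Lemma phase_realized eL eR n : In (eL, eR, n) phase_types ->
  exists t0 k0, 0 < k0 /\ phase_through eL eR n 0 t0 k0.
Proof.
  assert (H1 := critical_level (1 / 2) ltac:(lra) ltac:(lra)).
  assert (H2 := critical_level 2 ltac:(lra) ltac:(lra)).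
  (* Solves for the negative [t0] that lifts a point of the axis [t = 0] to the critical level. *)
  assert (Hroot : forall x, 0 < x -> 2 * ln x - x ^ 2 < -1 -> exists t0, t0 < 0 /\
    2 * ln x + t0 ^ 2 - x ^ 2 = -1).
  { intros x Hx H; assert (Hs := sqrt_lt_R0 (-1 - (2 * ln x - x ^ 2)) ltac:(lra)).
    exists (- sqrt (-1 - (2 * ln x - x ^ 2))); split; [lra|].
    replace ((- sqrt (-1 - (2 * ln x - x ^ 2))) ^ 2) with
      (sqrt (-1 - (2 * ln x - x ^ 2)) ^ 2) by ring.
    rewrite pow2_sqrt; lra. }
  intros [E|[E|[E|[E|[E|[E|[]]]]]]]; injection E as <- <- <-.
  - exists 0, (1 / 2); split; [lra|]; apply phase_flat_flat; [split; lra|lra].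
  - destruct (Hroot (1 / 2) ltac:(lra) H1) as (t0 & Ht0 & Hc).
    exists t0, (1 / 2); split; [lra|]; apply phase_flat_unit; trivial; split; lra.
  - exists (-1), 1; split; [lra|]; apply phase_flat_sharp; rewrite ?ln_1; lra.
  - exists 0, 1; split; [lra|].
    exists m_infty, p_infty, (fun _ => 0), (fun _ => 1); split; [exact phase_fixed_point|now split].
  - destruct (Hroot 2 ltac:(lra) H2) as (t0 & Ht0 & Hc).
    exists t0, 2; split; [lra|]; apply phase_unit_sharp; trivial; lra.
  - exists 0, 2; split; [lra|]; apply phase_sharp_sharp; lra.
Qed.

(** * Expanders as solutions of the planar system *)

(* [A] is the null component [x' + y'] of the tangent, so that [/ A = x' - y']. *)
Definition flow (a b : Rbar) (A t k : R -> R) : Prop :=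
  orbit a b t k /\ forall s, in_intv a b s -> is_derive A s (k s * A s) /\ A s <> 0.

(* [X = t T + k N], with null coordinates [x + y = (t + k) A] and [x - y = (t - k) / A]. *)
Definition curve (A t k : R -> R) (s : R) : pt :=
  (((t s + k s) * A s + (t s - k s) / A s) / 2,
   ((t s + k s) * A s - (t s - k s) / A s) / 2).

(** The pointwise condition of [expander_on]; being local, it passes to any curve that agrees with
    [X] near [s], as gluing requires. *)
Definition expander_at (X : R -> pt) (s : R) : Prop :=
  ex_derive (fun t => fst (X t)) s /\ ex_derive (fun t => snd (X t)) s /\
  ex_derive (fun t => fst (dX X t)) s /\ ex_derive (fun t => snd (dX X t)) s /\
  mink (tang X s) (tang X s) = 1 /\
  - mink (X s) (norml X s) = curv X s.

Lemma dX_ext_loc X Y s : locally s (fun u => X u = Y u) -> dX X s = dX Y s.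
Proof.
  intros H; unfold dX; f_equal; apply Derive_ext_loc;
    apply filter_imp with (2 := H); now intros u ->.
Qed.

Lemma dX_ext_loc_loc X Y s :
  locally s (fun u => X u = Y u) -> locally s (fun u => dX X u = dX Y u).
Proof.
  intros H; apply filter_imp with (2 := locally_locally _ _ H).
  intros u; apply dX_ext_loc.
Qed.

Lemma expander_at_ext X Y s :
  locally s (fun u => X u = Y u) -> expander_at X s -> expander_at Y s.
Proof.
  intros H (H1 & H2 & H3 & H4 & H5 & H6).
  assert (Hd := dX_ext_loc_loc _ _ _ H).
  assert (E : X s = Y s) by exact (locally_singleton _ _ H).
  assert (Ed : dX X s = dX Y s) by exact (locally_singleton _ _ Hd).
  assert (Edd : ddX X s = ddX Y s) by (unfold ddX; now apply dX_ext_loc).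
  split; [|split; [|split; [|split; [|split]]]].
  - apply ex_derive_ext_loc with (2 := H1); apply filter_imp with (2 := H); now intros u ->.
  - apply ex_derive_ext_loc with (2 := H2); apply filter_imp with (2 := H); now intros u ->.
  - apply ex_derive_ext_loc with (2 := H3); apply filter_imp with (2 := Hd); now intros u ->.
  - apply ex_derive_ext_loc with (2 := H4); apply filter_imp with (2 := Hd); now intros u ->.
  - unfold tang in *; now rewrite <- Ed.
  - unfold curv, norml, tang in *; now rewrite <- E, <- Edd, <- Ed.
Qed.

Section FlowCurve.

Variables (a b : Rbar) (A t k : R -> R) (X : R -> pt).
Hypothesis Hflow : flow a b A t k.
Hypothesis HX : forall s, in_intv a b s -> X s = curve A t k s.

(** In null coordinates [((t + k) A)' = A] and [((t - k) / A)' = / A], so the tangent has null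
    components [A] and [/ A]. *)
Lemma flow_derive s : in_intv a b s ->
  is_derive (fun u => fst (X u)) s ((A s + / A s) / 2) /\
  is_derive (fun u => snd (X u)) s ((A s - / A s) / 2).
Proof.
  intros Hs; destruct Hflow as [Ho HA]; destruct (Ho s Hs) as [Ht Hk], (HA s Hs) as [Hd H0].
  split.
  - apply is_derive_ext_loc with (fun u => fst (curve A t k u)).
    + apply filter_imp with (2 := intv_open _ _ _ Hs); intros u Hu; now rewrite HX.
    + unfold curve; simpl; solve_derive; field; trivial.
  - apply is_derive_ext_loc with (fun u => snd (curve A t k u)).
    + apply filter_imp with (2 := intv_open _ _ _ Hs); intros u Hu; now rewrite HX.
    + unfold curve; simpl; solve_derive; field; trivial.
Qed.

Lemma flow_dX s : in_intv a b s -> dX X s = ((A s + / A s) / 2, (A s - / A s) / 2).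
Proof.
  intros Hs; destruct (flow_derive s Hs) as [H1 H2].
  unfold dX; f_equal; now apply is_derive_unique.
Qed.

Lemma flow_derive2 s : in_intv a b s ->
  is_derive (fun u => fst (dX X u)) s (k s * (A s - / A s) / 2) /\
  is_derive (fun u => snd (dX X u)) s (k s * (A s + / A s) / 2).
Proof.
  intros Hs; destruct Hflow as [_ HA]; destruct (HA s Hs) as [Hd H0].
  split.
  - apply is_derive_ext_loc with (fun u => (A u + / A u) / 2).
    + apply filter_imp with (2 := intv_open _ _ _ Hs); intros u Hu; now rewrite flow_dX.
    + solve_derive; field; trivial.
  - apply is_derive_ext_loc with (fun u => (A u - / A u) / 2).
    + apply filter_imp with (2 := intv_open _ _ _ Hs); intros u Hu; now rewrite flow_dX.
    + solve_derive; field; trivial.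
Qed.

Lemma flow_curv s : in_intv a b s -> curv X s = k s.
Proof.
  intros Hs; destruct (flow_derive2 s Hs) as [H1 H2].
  assert (H0 : A s <> 0) by now apply Hflow.
  assert (Edd : ddX X s = (k s * (A s - / A s) / 2, k s * (A s + / A s) / 2)).
  { apply (f_equal2 pair); now apply is_derive_unique. }
  unfold curv, norml, tang; rewrite Edd, (flow_dX s Hs).
  unfold mink, hmul; simpl; field; trivial.
Qed.

Lemma flow_mink s : in_intv a b s -> mink (X s) (X s) = t s ^ 2 - k s ^ 2.
Proof.
  intros Hs; assert (H0 : A s <> 0) by now apply Hflow.
  rewrite (HX s Hs); unfold mink, curve; simpl; field; trivial.
Qed.

Lemma flow_expander_at s : in_intv a b s -> expander_at X s.
Proof.
  intros Hs; assert (H0 : A s <> 0) by now apply Hflow.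
  destruct (flow_derive s Hs) as [H1 H2], (flow_derive2 s Hs) as [H3 H4].
  split; [|split; [|split; [|split; [|split]]]]; try (eexists; eassumption).
  - unfold tang; rewrite flow_dX by trivial; unfold mink; simpl; field; trivial.
  - rewrite flow_curv by trivial; unfold norml, tang; rewrite flow_dX, HX by trivial.
    unfold mink, hmul, curve; simpl; field; trivial.
Qed.

(** On a line of direction [d] the determinant of [d] and [X] is constant. Two derivatives make [d]
    parallel to the tangent and, if [k s <> 0], to the normal as well, so [d = 0]. *)
Lemma flow_straight_line s : in_intv a b s -> straight_line a b X -> k s = 0.
Proof.
  intros Hs (P & d & Hd & Hline).
  destruct (Req_dec (k s) 0) as [|Hk]; trivial; exfalso; apply Hd.
  destruct (flow_derive s Hs) as [H1 H2], (flow_derive2 s Hs) as [H3 H4].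
  assert (H0 : A s <> 0) by now apply Hflow.
  assert (Hz : forall u, in_intv a b u ->
    snd d * ((A u + / A u) / 2) - fst d * ((A u - / A u) / 2) = 0).
  { intros u Hu; destruct (flow_derive u Hu) as [H5 H6].
    assert (H7 : is_derive (fun u => snd d * fst (X u) - fst d * snd (X u)) u
      (snd d * ((A u + / A u) / 2) - fst d * ((A u - / A u) / 2))).
    { apply (is_derive_minus (fun u => snd d * fst (X u)) (fun u => fst d * snd (X u)));
        now apply is_derive_scal. }
    rewrite <- (is_derive_unique _ _ _ H7).
    apply is_derive_unique.
    apply is_derive_ext_loc with (fun _ => snd d * fst P - fst d * snd P).
    - apply filter_imp with (2 := intv_open _ _ _ Hu); intros v Hv.
      destruct (Hline v Hv) as [c ->]; unfold padd, pscal; simpl; ring.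
    - apply (is_derive_const (snd d * fst P - fst d * snd P)). }
  assert (E1 := Hz s Hs).
  assert (E2 : snd d * (k s * (A s - / A s) / 2) - fst d * (k s * (A s + / A s) / 2) = 0).
  { assert (H7 : is_derive (fun u => snd d * fst (dX X u) - fst d * snd (dX X u)) s
      (snd d * (k s * (A s - / A s) / 2) - fst d * (k s * (A s + / A s) / 2))).
    { apply (is_derive_minus (fun u => snd d * fst (dX X u)) (fun u => fst d * snd (dX X u)));
        now apply is_derive_scal. }
    rewrite <- (is_derive_unique _ _ _ H7); apply is_derive_unique.
    apply is_derive_ext_loc with (fun _ => 0); [|apply (is_derive_const 0)].
    apply filter_imp with (2 := intv_open _ _ _ Hs); intros v Hv.
    rewrite flow_dX by trivial; simpl; now rewrite Hz. }
  assert (E3 : snd d * (A s - / A s) - fst d * (A s + / A s) = 0)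
    by (apply Rmult_eq_reg_l with (k s / 2); [lra|lra]).
  assert (E4 : (snd d - fst d) * A s = 0) by lra.
  assert (E5 : (snd d + fst d) * / A s = 0) by lra.
  apply Rmult_integral in E4; apply Rmult_integral in E5.
  assert (Hi := Rinv_neq_0_compat _ H0).
  destruct E4 as [E4|]; [|easy]; destruct E5 as [E5|]; [|easy].
  destruct d as [d1 d2]; simpl in *; f_equal; lra.
Qed.

End FlowCurve.

(** [X] is only twice differentiable, so its curvature has a derivative only because the expander
    equation expresses it through [X] and [T]. Hence [k] is taken to be [- <X,N>]. *)
Lemma expander_flow a b X : expander_on a b X -> exists A t k, flow a b A t k /\
  forall s, in_intv a b s -> X s = curve A t k s.
Proof.
  intros [_ HX].
  pose (x := fun s => fst (X s)); pose (y := fun s => snd (X s)).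
  pose (p := fun s => fst (dX X s)); pose (q := fun s => snd (dX X s)).
  assert (Hall : forall s, in_intv a b s -> is_derive x s (p s) /\ is_derive y s (q s) /\
    exists k, k = y s * p s - x s * q s /\
      is_derive p s (k * q s) /\ is_derive q s (k * p s) /\ p s ^ 2 - q s ^ 2 = 1).
  { assert (Hu : forall s, in_intv a b s -> p s ^ 2 - q s ^ 2 = 1).
    { intros s Hs; destruct (HX s Hs) as (_ & _ & _ & _ & H & _).
      rewrite <- H; unfold mink, tang, p, q; ring. }
    intros s Hs; destruct (HX s Hs) as (H1 & H2 & H3 & H4 & H5 & H6).
    split; [now apply Derive_correct|]; split; [now apply Derive_correct|].
    exists (y s * p s - x s * q s); split; [reflexivity|].
    assert (Hp : is_derive p s (fst (ddX X s))) by now apply Derive_correct.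
    assert (Hq : is_derive q s (snd (ddX X s))) by now apply Derive_correct.
    assert (Hk : y s * p s - x s * q s = snd (ddX X s) * p s - fst (ddX X s) * q s).
    { unfold curv, norml, tang, mink, hmul in H6; simpl in H6.
      unfold x, y, p, q, dX; simpl; unfold dX in H6; simpl in H6; lra. }
    (* Differentiating [<T,T> = 1] makes [T_s] orthogonal to [T], hence equal to [k N]. *)
    assert (Horth : p s * fst (ddX X s) - q s * snd (ddX X s) = 0).
    { assert (Hd : is_derive (fun s => p s ^ 2 - q s ^ 2) s
        (2 * (p s * fst (ddX X s) - q s * snd (ddX X s)))) by (solve_derive; ring).
      apply is_derive_unique in Hd.
      rewrite (Derive_ext_loc _ (fun _ => 1)), Derive_const in Hd; [lra|].
      apply filter_imp with (2 := intv_open _ _ _ Hs); exact Hu. }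
    specialize (Hu s Hs); rewrite Hk; split; [|split; [|exact Hu]].
    - replace ((snd (ddX X s) * p s - fst (ddX X s) * q s) * q s) with (fst (ddX X s)); trivial.
      transitivity (fst (ddX X s) * (p s ^ 2 - q s ^ 2)
        - p s * (p s * fst (ddX X s) - q s * snd (ddX X s))); [rewrite Hu, Horth; ring|ring].
    - replace ((snd (ddX X s) * p s - fst (ddX X s) * q s) * p s) with (snd (ddX X s)); trivial.
      transitivity (snd (ddX X s) * (p s ^ 2 - q s ^ 2)
        - q s * (p s * fst (ddX X s) - q s * snd (ddX X s))); [rewrite Hu, Horth; ring|ring]. }
  exists (fun s => p s + q s), (fun s => x s * p s - y s * q s), (fun s => y s * p s - x s * q s).
  clearbody p q; split; [split|].
  - intros s Hs; destruct (Hall s Hs) as (Hx & Hy & k & Ek & Hp & Hq & Hu); rewrite <- Ek.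
    clearbody x y; split.
    + replace (1 - k ^ 2) with (p s ^ 2 - q s ^ 2 - k * (y s * p s - x s * q s))
        by (rewrite <- Ek, Hu; ring).
      solve_derive; ring.
    + solve_derive; ring.
  - intros s Hs; destruct (Hall s Hs) as (Hx & Hy & k & Ek & Hp & Hq & Hu); rewrite <- Ek.
    split; [solve_derive; ring|].
    intros H; replace (p s ^ 2 - q s ^ 2) with ((p s + q s) * (p s - q s)) in Hu by ring.
    rewrite H in Hu; lra.
  - intros s Hs; destruct (Hall s Hs) as (_ & _ & k & Ek & _ & _ & Hu).
    assert (H0 : p s + q s <> 0).
    { intros H; replace (p s ^ 2 - q s ^ 2) with ((p s + q s) * (p s - q s)) in Hu by ring.
      rewrite H in Hu; lra. }
    assert (Hi : / (p s + q s) = p s - q s).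
    { apply Rmult_eq_reg_l with (p s + q s); trivial; rewrite Rinv_r by trivial; lra. }
    rewrite (surjective_pairing (X s)); unfold curve, Rdiv; fold (x s) (y s).
    rewrite Hi; f_equal.
    + transitivity (x s * (p s ^ 2 - q s ^ 2)); [rewrite Hu; ring|field].
    + transitivity (y s * (p s ^ 2 - q s ^ 2)); [rewrite Hu; ring|field].
Qed.

(** Once the planar parts agree, [A1] and [A2] solve the same linear equation and their quotient is
    constant. *)
Lemma flow_unique a b A1 t1 k1 A2 t2 k2 s0 s : flow a b A1 t1 k1 -> flow a b A2 t2 k2 ->
  in_intv a b s0 -> A1 s0 = A2 s0 -> t1 s0 = t2 s0 -> k1 s0 = k2 s0 -> in_intv a b s ->
  A1 s = A2 s /\ t1 s = t2 s /\ k1 s = k2 s.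
Proof.
  intros [O1 F1] [O2 F2] Hs0 EA Et Ek Hs.
  assert (Hu : forall u, in_intv a b u -> t1 u = t2 u /\ k1 u = k2 u).
  { intros u Hu; exact (orbit_unique _ _ _ _ _ _ _ _ O1 O2 Hs0 Et Ek Hu). }
  split; [|now apply Hu].
  assert (H : A1 s0 / A2 s0 = A1 s / A2 s).
  { apply (derive_zero_const a b (fun u => A1 u / A2 u)); trivial.
    intros u Hu'; destruct (F1 u Hu') as [H1 H2], (F2 u Hu') as [H3 H4].
    solve_derive; rewrite (proj2 (Hu u Hu')); field; trivial. }
  destruct (F2 s Hs) as [_ H1], (F2 s0 Hs0) as [_ H2].
  rewrite EA in H; unfold Rdiv in H; rewrite Rinv_r in H by trivial.
  apply Rmult_eq_reg_r with (/ A2 s); [|now apply Rinv_neq_0_compat].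
  rewrite <- H, Rinv_r; trivial.
Qed.

Lemma flow_exists a b t k s0 A0 : orbit a b t k -> in_intv a b s0 -> A0 <> 0 ->
  exists A, A s0 = A0 /\ flow a b A t k.
Proof.
  intros Ho Hs0 HA0.
  destruct (antiderivative_exists a b k s0 Hs0) as (K & HK0 & HK).
  { intros s Hs; eapply is_derive_continuity_pt, Ho, Hs. }
  exists (fun s => A0 * exp (K s)); split; [rewrite HK0, exp_0; ring|].
  split; trivial; intros s Hs; specialize (HK s Hs); split.
  - solve_derive; ring.
  - apply Rmult_integral_contrapositive_currified; trivial.
    assert (H := exp_pos (K s)); lra.
Qed.

(** * Maximality, and identification with the explicit solutions *)

Lemma orbit_sub a b a' b' t k : Rbar_le a' a -> Rbar_le b b' ->
  orbit a' b' t k -> orbit a b t k.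
Proof.
  intros Ha Hb H s [H1 H2]; apply H; split.
  - now apply Rbar_le_lt_trans with a.
  - now apply Rbar_lt_le_trans with b.
Qed.

Lemma flow_sub a b a' b' A t k : Rbar_le a' a -> Rbar_le b b' ->
  flow a' b' A t k -> flow a b A t k.
Proof.
  intros Ha Hb [Ho HA]; split; [now apply orbit_sub with a' b'|].
  intros s [H1 H2]; apply HA; split.
  - now apply Rbar_le_lt_trans with a.
  - now apply Rbar_lt_le_trans with b.
Qed.

Lemma intv_inter a b a' b' : exists c d,
  Rbar_le a c /\ Rbar_le a' c /\ Rbar_le d b /\ Rbar_le d b' /\
  forall s, in_intv a b s -> in_intv a' b' s -> in_intv c d s.
Proof.
  assert (Hc : exists c, Rbar_le a c /\ Rbar_le a' c /\ (c = a \/ c = a')).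
  { destruct (Rbar_le_lt_dec a a') as [H|H].
    - exists a'; split; [exact H|]; split; [apply Rbar_le_refl|now right].
    - exists a; split; [apply Rbar_le_refl|]; split; [now apply Rbar_lt_le|now left]. }
  assert (Hd : exists d, Rbar_le d b /\ Rbar_le d b' /\ (d = b \/ d = b')).
  { destruct (Rbar_le_lt_dec b b') as [H|H].
    - exists b; split; [apply Rbar_le_refl|]; split; [exact H|now left].
    - exists b'; split; [now apply Rbar_lt_le|]; split; [apply Rbar_le_refl|now right]. }
  destruct Hc as (c & H1 & H2 & H3), Hd as (d & H4 & H5 & H6).
  exists c, d; do 4 (split; [assumption|]).
  intros s [Ha Hb] [Ha' Hb']; split; [now destruct H3 as [->| ->]|now destruct H6 as [->| ->]].
Qed.

Lemma intv_union a b a' b' s0 : in_intv a b s0 -> in_intv a' b' s0 -> exists c d,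
  Rbar_le c a /\ Rbar_le c a' /\ Rbar_le b d /\ Rbar_le b' d /\
  forall s, in_intv c d s -> in_intv a b s \/ in_intv a' b' s.
Proof.
  intros [Ha0 Hb0] [Ha0' Hb0'].
  assert (Hc : exists c, Rbar_le c a /\ Rbar_le c a' /\ (c = a \/ c = a')).
  { destruct (Rbar_le_lt_dec a a') as [H|H].
    - exists a; split; [apply Rbar_le_refl|]; split; [exact H|now left].
    - exists a'; split; [now apply Rbar_lt_le|]; split; [apply Rbar_le_refl|now right]. }
  assert (Hd : exists d, Rbar_le b d /\ Rbar_le b' d /\ (d = b \/ d = b')).
  { destruct (Rbar_le_lt_dec b b') as [H|H].
    - exists b'; split; [exact H|]; split; [apply Rbar_le_refl|now right].
    - exists b; split; [apply Rbar_le_refl|]; split; [now apply Rbar_lt_le|now left]. }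
  destruct Hc as (c & H1 & H2 & H3), Hd as (d & H4 & H5 & H6).
  exists c, d; do 4 (split; [assumption|]).
  intros s [Hs1 Hs2]; destruct (Rle_lt_dec s s0) as [Hs|Hs].
  - destruct H3 as [->| ->]; [left|right]; split; trivial;
      apply Rbar_le_lt_trans with s0; trivial.
  - destruct H6 as [->| ->]; [left|right]; split; trivial;
      apply Rbar_lt_trans with s0; trivial.
Qed.

(** An infinite end cannot be passed. At a sharp end [k] is unbounded, so no function continuous at
    the endpoint can agree with it nearby. *)
Lemma right_kind_complete e a b b' t k k' s0 : in_intv a b s0 ->
  right_kind e b t k -> Rbar_le b b' ->
  (forall s, in_intv a b s -> k' s = k s) ->
  (forall s, in_intv a b' s -> ex_derive k' s) -> b' = b.
Proof.
  intros Hs0 He Hb Hk Hd.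
  assert (Hcase : b = p_infty \/ exists r, b = Finite r /\ forall M, right_end b (fun s => M < k s)).
  { destruct e; simpl in He.
    - now left.
    - now left.
    - right; destruct He as [[r Hr] He]; exists r; split; trivial.
      intros M; apply filter_imp with (2 := He M); tauto. }
  destruct Hcase as [->|(r & -> & HM)]; [now destruct b'|].
  destruct (Rbar_le_lt_or_eq_dec _ _ Hb) as [Hlt|]; [|easy]; exfalso.
  assert (Hr : in_intv a b' r) by (split; trivial; apply Rbar_lt_trans with s0; apply Hs0).
  assert (Hc : locally r (fun s => k' s < k' r + 1)).
  { assert (Hcont := ex_derive_continuous k' r (Hd r Hr)).
    apply (Hcont (fun y => y < k' r + 1)), (open_lt (k' r + 1) (k' r)); lra. }
  assert (Hc' : right_end r (fun s => k' s < k' r + 1)) by (apply filter_le_within; exact Hc).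
  destruct (right_end_elim a r s0 _ Hs0 (filter_and _ _ Hc' (HM (k' r + 1))))
    as (s1 & _ & Hs1 & H).
  destruct (H s1 (Rle_refl _) Hs1) as [H1 H2]; rewrite Hk in H1 by trivial; lra.
Qed.

Lemma left_kind_complete e a b a' t k k' s0 : in_intv a b s0 ->
  left_kind e a t k -> Rbar_le a' a ->
  (forall s, in_intv a b s -> k' s = k s) ->
  (forall s, in_intv a' b s -> ex_derive k' s) -> a' = a.
Proof.
  intros Hs0 He Ha Hk Hd.
  rewrite <- (Rbar_opp_involutive a'), <- (Rbar_opp_involutive a); f_equal.
  apply (right_kind_complete e (Rbar_opp b) (Rbar_opp a) (Rbar_opp a') (fun s => - t (- s))
    (fun s => k (- s)) (fun s => k' (- s)) (- s0)).
  - now apply intv_opp.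
  - exact He.
  - now apply Rbar_opp_le.
  - intros s Hs; apply Hk; now apply intv_opp_inv.
  - intros s Hs; apply intv_opp_inv, Hd in Hs.
    auto_derive; auto.
Qed.

(** An extension [Y] is again a flow, whose [k'] is its curvature. Curvature is local, so [k' = k]
    on the smaller interval, and completeness of both ends forbids a strict extension. *)
Lemma phase_nonlinear_expander eL eR n a b A t k X : Rbar_lt a b ->
  phase eL eR n a b t k -> flow a b A t k ->
  (forall s, in_intv a b s -> X s = curve A t k s) -> nonlinear_expander a b X.
Proof.
  intros Hab (Ho & Hpos & HL & HR & _) Hf HX.
  destruct (intv_nonempty _ _ Hab) as [s0 Hs0].
  split; [split; [split; [assumption|]|]|].
  - intros s Hs; exact (flow_expander_at a b A t k X Hf HX s Hs).
  - intros a' b' Y HY Ha Hb HYX.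
    destruct (expander_flow _ _ _ HY) as (A' & t' & k' & Hf' & HY').
    assert (Hk : forall s, in_intv a b s -> k' s = k s).
    { intros s Hs.
      assert (Hs' : in_intv a' b' s)
        by (split; [apply Rbar_le_lt_trans with a|apply Rbar_lt_le_trans with b]; trivial; apply Hs).
      rewrite <- (flow_curv a' b' A' t' k' Y), <- (flow_curv a b A t k X) by trivial.
      assert (Hl : locally s (fun u => Y u = X u))
        by (apply filter_imp with (2 := intv_open _ _ _ Hs); exact HYX).
      unfold curv, norml, tang, ddX.
      now rewrite (dX_ext_loc _ _ _ Hl), (dX_ext_loc _ _ _ (dX_ext_loc_loc _ _ _ Hl)). }
    assert (Hd : forall s, in_intv a' b' s -> ex_derive k' s).
    { intros s Hs; eexists; apply (proj1 Hf'), Hs. }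
    split.
    + apply (left_kind_complete eL a b a' t k k' s0); trivial.
      intros s [H1 H2]; apply Hd; split; trivial; now apply Rbar_lt_le_trans with b.
    + apply (right_kind_complete eR a b b' t k k' s0); trivial.
      intros s [H1 H2]; apply Hd; split; trivial; now apply Rbar_le_lt_trans with a.
  - intros Hl; assert (H := flow_straight_line a b A t k X Hf HX s0 Hs0 Hl).
    specialize (Hpos s0 Hs0); lra.
Qed.

(** The explicit solution has the same data as [X] at [s0], so the two curves agree on the overlap.
    Maximality of [X] and completeness of the explicit ends give the two inclusions between the
    intervals. *)
Lemma nonlinear_expander_phase a b X : nonlinear_expander a b X ->
  (forall s, in_intv a b s -> 0 < curv X s) ->
  exists eL eR n A t k, (In (eL, eR, n) phase_types \/ In (eR, eL, n) phase_types) /\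
    phase eL eR n a b t k /\ flow a b A t k /\
    forall s, in_intv a b s -> X s = curve A t k s.
Proof.
  intros [[HX Hmax] _] Hcurv.
  destruct (intv_nonempty a b (proj1 HX)) as [s0 Hs0].
  destruct (expander_flow _ _ _ HX) as (A1 & t1 & k1 & Hf1 & HX1).
  assert (Hk1 : 0 < k1 s0) by (rewrite <- (flow_curv a b A1 t1 k1 X) by trivial; auto).
  destruct (phase_exists s0 (t1 s0) (k1 s0) Hk1) as (eL & eR & n & Htype & Hthrough).
  destruct Hthrough as (a2 & b2 & t & k & Hph & Hs2 & Et & Ek).
  destruct (flow_exists a2 b2 t k s0 (A1 s0) (proj1 Hph) Hs2) as (A & EA & Hf).
  { now apply Hf1. }
  assert (Hagree : forall s, in_intv a b s -> in_intv a2 b2 s -> X s = curve A t k s).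
  { intros s Hs Hs'; destruct (intv_inter a b a2 b2) as (c & d & H1 & H2 & H3 & H4 & H5).
    destruct (flow_unique c d A1 t1 k1 A t k s0 s) as (E1 & E2 & E3); auto.
    - now apply flow_sub with a b.
    - now apply flow_sub with a2 b2.
    - rewrite HX1 by trivial; unfold curve; now rewrite E1, E2, E3. }
  destruct (intv_union a b a2 b2 s0 Hs0 Hs2) as (c & d & H1 & H2 & H3 & H4 & H5).
  (* By agreement on the overlap, [Y] coincides near every point of the union with one of the two
     curves. *)
  pose (Y := fun s => if Rbar_lt_dec a2 s then if Rbar_lt_dec s b2 then curve A t k s else X s
    else X s).
  assert (HYM : forall s, in_intv a2 b2 s -> Y s = curve A t k s).
  { intros s [Hs Hs']; unfold Y; destruct Rbar_lt_dec; [|easy]; now destruct Rbar_lt_dec. }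
  assert (HYX : forall s, in_intv a b s -> Y s = X s).
  { intros s Hs; unfold Y; destruct Rbar_lt_dec as [Ha|]; [|easy].
    destruct Rbar_lt_dec as [Hb|]; [|easy]; symmetry; apply Hagree; trivial; now split. }
  assert (Hcd : Rbar_lt c d).
  { apply Rbar_le_lt_trans with (1 := H1); apply Rbar_lt_le_trans with (2 := H3); apply HX. }
  destruct (Hmax c d Y) as [Hca Hdb]; trivial.
  { split; trivial; intros s Hs; destruct (H5 s Hs) as [Hi|Hi].
    - apply expander_at_ext with X; [|now apply HX].
      apply filter_imp with (2 := intv_open _ _ _ Hi); intros u Hu; symmetry; auto.
    - apply expander_at_ext with (curve A t k).
      + apply filter_imp with (2 := intv_open _ _ _ Hi); intros u Hu; symmetry; auto.
      + apply (flow_expander_at a2 b2 A t k); auto. }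
  rewrite Hca in H2; rewrite Hdb in H4; clear c d Hca Hdb H1 H3 H5 Hcd.
  assert (Hk : forall s, in_intv a2 b2 s -> k1 s = k s).
  { intros s Hs.
    assert (Hs' : in_intv a b s)
      by (split; [apply Rbar_le_lt_trans with a2|apply Rbar_lt_le_trans with b2]; trivial; apply Hs).
    destruct (flow_unique a2 b2 A1 t1 k1 A t k s0 s) as (_ & _ & E); trivial; auto.
    now apply flow_sub with a b. }
  assert (Hd : forall s, in_intv a b s -> ex_derive k1 s).
  { intros s Hs; eexists; apply (proj1 Hf1), Hs. }
  assert (Ea : a = a2).
  { apply (left_kind_complete eL a2 b2 a t k k1 s0); trivial; [apply Hph|].
    intros s [Hs1 Hs3]; apply Hd; split; trivial; now apply Rbar_lt_le_trans with b2. }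
  assert (Eb : b = b2).
  { apply (right_kind_complete eR a2 b2 b t k k1 s0); trivial; [apply Hph|].
    intros s [Hs1 Hs3]; apply Hd; split; trivial; now apply Rbar_le_lt_trans with a2. }
  subst a2 b2; exists eL, eR, n, A, t, k; auto.
Qed.

(** * Reflection in the x-axis, which changes the sign of the curvature *)

Definition pconj (p : pt) : pt := (fst p, - snd p).

Lemma pconj_involutive p : pconj (pconj p) = p.
Proof. destruct p; unfold pconj; simpl; now rewrite Ropp_involutive. Qed.

Lemma dX_conj X s : dX (fun u => pconj (X u)) s = pconj (dX X s).
Proof. unfold dX, pconj; simpl; f_equal; apply Derive_opp. Qed.

Lemma ddX_conj X s : ddX (fun u => pconj (X u)) s = pconj (ddX X s).
Proof.
  unfold ddX; rewrite <- (dX_conj (dX X)).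
  apply dX_ext_loc, filter_forall; intros u; apply dX_conj.
Qed.

Lemma curv_conj X s : curv (fun u => pconj (X u)) s = - curv X s.
Proof.
  unfold curv, norml, tang; rewrite ddX_conj, dX_conj.
  unfold mink, hmul, pconj; simpl; ring.
Qed.

Lemma mink_conj p : mink (pconj p) (pconj p) = mink p p.
Proof. unfold mink, pconj; simpl; ring. Qed.

Lemma expander_on_conj a b X : expander_on a b X -> expander_on a b (fun u => pconj (X u)).
Proof.
  intros [Hab HX]; split; trivial; intros s Hs.
  destruct (HX s Hs) as (H1 & H2 & H3 & H4 & H5 & H6).
  split; [exact H1|]; split; [exact (ex_derive_opp _ _ H2)|]; split; [|split; [|split]].
  - apply ex_derive_ext with (2 := H3); intros u; now rewrite dX_conj.
  - apply ex_derive_ext with (2 := ex_derive_opp _ _ H4); intros u; now rewrite dX_conj.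
  - unfold tang; rewrite dX_conj, mink_conj; exact H5.
  - rewrite curv_conj, <- H6; unfold norml, tang; rewrite dX_conj.
    unfold mink, hmul, pconj; simpl; ring.
Qed.

Lemma nonlinear_expander_conj a b X :
  nonlinear_expander a b X -> nonlinear_expander a b (fun u => pconj (X u)).
Proof.
  intros [[HX Hmax] Hl]; split; [split|].
  - now apply expander_on_conj.
  - intros a' b' Y HY Ha Hb HYX.
    apply (Hmax a' b' (fun u => pconj (Y u))); trivial.
    + now apply expander_on_conj.
    + intros s Hs; rewrite HYX by trivial; apply pconj_involutive.
  - intros (P & d & Hd & H); apply Hl; exists (pconj P), (pconj d); split.
    + intros E; apply Hd; rewrite <- (pconj_involutive d), E; unfold pconj; simpl; now rewrite Ropp_0.
    + intros s Hs; destruct (H s Hs) as [c Hc]; exists c.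
      rewrite <- (pconj_involutive (X s)), Hc; unfold pconj, padd, pscal; simpl; f_equal; ring.
Qed.

(** * The first integral and convexity *)

Lemma expander_first_integral a b X s1 s2 : expander_on a b X ->
  in_intv a b s1 -> in_intv a b s2 ->
  curv X s1 ^ 2 * exp (mink (X s1) (X s1)) = curv X s2 ^ 2 * exp (mink (X s2) (X s2)).
Proof.
  intros HX Hs1 Hs2; destruct (expander_flow _ _ _ HX) as (A & t & k & Hf & HX').
  rewrite !(flow_curv a b A t k X), !(flow_mink a b A t k X) by trivial.
  apply (orbit_first_integral a b); trivial; apply Hf.
Qed.

Lemma derive_const_affine a b (f : R -> R) l x y :
  (forall z, in_intv a b z -> is_derive f z l) ->
  in_intv a b x -> in_intv a b y -> f y = f x + (y - x) * l.
Proof.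
  intros H Hx Hy; cut (f y - y * l = f x - x * l); [lra|].
  apply (derive_zero_const a b (fun z => f z - z * l)); trivial.
  intros z Hz; specialize (H z Hz); solve_derive; ring.
Qed.

(** If [k] vanishes once, the first integral is 0 and [k] vanishes identically; then [A] is constant
    and the curve is a line. Otherwise [k] is continuous without zeros and keeps its sign. *)
Lemma nonlinear_expander_convex a b X : nonlinear_expander a b X -> convex_curve a b X.
Proof.
  intros [[HX _] Hl].
  destruct (intv_nonempty a b (proj1 HX)) as [s0 Hs0].
  assert (Hfi := fun s1 s2 => expander_first_integral a b X s1 s2 HX).
  destruct (expander_flow _ _ _ HX) as (A & t & k & [Ho HA] & HX').
  assert (Hf : flow a b A t k) by now split.
  assert (Hck : forall s, in_intv a b s -> curv X s = k s)
    by (intros s Hs; apply (flow_curv a b A t k); trivial).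
  assert (Hk : forall s, in_intv a b s -> k s <> 0).
  { intros s Hs Hks; apply Hl.
    assert (H0 : forall u, in_intv a b u -> k u = 0).
    { intros u Hu; specialize (Hfi u s Hu Hs); rewrite !Hck, Hks in Hfi by trivial.
      assert (He := exp_pos (mink (X u) (X u))).
      apply Rsqr_0_uniq; unfold Rsqr; nra. }
    (* This base point is chosen so that arc length itself is the parameter along the line. *)
    exists (psub (X s0) (pscal s0 (dX X s0))), (dX X s0); split.
    - intros E; destruct HX as [_ HX]; destruct (HX s0 Hs0) as (_ & _ & _ & _ & H & _).
      unfold tang in H; rewrite E in H; unfold mink in H; simpl in H; lra.
    - intros u Hu; exists u.
      assert (HAc : forall u, in_intv a b u -> A u = A s0).
      { intros v Hv; apply (derive_zero_const a b); trivial.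
        intros z Hz; destruct (HA z Hz) as [Hd _]; now rewrite H0, Rmult_0_l in Hd. }
      assert (Hx := derive_const_affine a b (fun v => fst (X v)) ((A s0 + / A s0) / 2) s0 u).
      assert (Hy := derive_const_affine a b (fun v => snd (X v)) ((A s0 - / A s0) / 2) s0 u).
      cbv beta in Hx, Hy.
      rewrite (surjective_pairing (X u)), Hx, Hy; trivial.
      + rewrite (flow_dX a b A t k X) by trivial; unfold padd, psub, pscal; simpl; f_equal; ring.
      + intros z Hz; rewrite <- (HAc z Hz); now apply (flow_derive a b A t k X Hf HX').
      + intros z Hz; rewrite <- (HAc z Hz); now apply (flow_derive a b A t k X Hf HX'). }
  assert (Hsign : forall s1 s2, in_intv a b s1 -> in_intv a b s2 -> 0 < k s1 -> 0 < k s2).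
  { intros s1 s2 Hs1 Hs2 H1; destruct (Rlt_le_dec 0 (k s2)) as [|H2]; trivial; exfalso.
    assert (H2' : k s2 < 0) by (specialize (Hk s2 Hs2); lra).
    assert (Hcont : forall z, in_intv a b z -> continuity_pt k z).
    { intros z Hz; eapply is_derive_continuity_pt, Ho, Hz. }
    destruct (Rtotal_order s1 s2) as [H|[->|H]]; [|lra|].
    - destruct (ivt_interval (fun z => - k z) s1 s2 0) as (z & Hz & Hz'); [trivial| |lra|].
      + intros z Hz; apply (continuity_pt_opp k), Hcont; now apply intv_between with s1 s2.
      + apply (Hk z); [now apply intv_between with s1 s2|lra].
    - destruct (ivt_interval k s2 s1 0) as (z & Hz & Hz'); [trivial| |lra|].
      + intros z Hz; apply Hcont; now apply intv_between with s2 s1.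
      + apply (Hk z); [now apply intv_between with s2 s1|lra]. }
  destruct (Rlt_le_dec 0 (k s0)) as [H|H].
  - left; intros s Hs; rewrite Hck by trivial; now apply Hsign with s0.
  - right; intros s Hs; rewrite Hck by trivial.
    destruct (Rlt_le_dec 0 (k s)) as [H'|H']; [|specialize (Hk s Hs); lra].
    apply (Hsign s s0) in H'; trivial; lra.
Qed.

(** * Asymptotes *)

Lemma enorm_triangle p q : enorm (padd p q) <= enorm p + enorm q.
Proof. exact (Cmod_triangle p q). Qed.

Lemma enorm_pos p : 0 <= enorm p.
Proof. apply sqrt_pos. Qed.

Lemma enorm_pscal c p : enorm (pscal c p) = Rabs c * enorm p.
Proof.
  unfold enorm, pscal; simpl fst; simpl snd.
  replace ((c * fst p) ^ 2 + (c * snd p) ^ 2) with (Rsqr c * (fst p ^ 2 + snd p ^ 2))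
    by (unfold Rsqr; ring).
  rewrite sqrt_mult_alt, sqrt_Rsqr_abs; trivial; apply Rle_0_sqr.
Qed.

Lemma enorm_psub_sym p q : enorm (psub p q) = enorm (psub q p).
Proof. unfold enorm, psub; simpl; f_equal; ring. Qed.

Lemma enorm_psub_triangle p q r : enorm (psub p r) <= enorm (psub p q) + enorm (psub q r).
Proof.
  replace (psub p r) with (padd (psub p q) (psub q r))
    by (unfold psub, padd; simpl; f_equal; ring).
  apply enorm_triangle.
Qed.

Lemma enorm_psub_0 p : enorm (psub p (0, 0)) = enorm p.
Proof. unfold enorm, psub; simpl; f_equal; ring. Qed.

Lemma enorm_le_psub p q : enorm p <= enorm (psub p q) + enorm q.
Proof.
  rewrite <- (enorm_psub_0 p), <- (enorm_psub_0 q); apply enorm_psub_triangle.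
Qed.

Lemma enorm_gt_0 p : p <> (0, 0) -> 0 < enorm p.
Proof.
  intros Hp; apply sqrt_lt_R0.
  destruct (Req_dec (fst p) 0) as [H1|H1].
  - destruct (Req_dec (snd p) 0) as [H2|H2].
    + exfalso; apply Hp; destruct p; simpl in *; now f_equal.
    + rewrite H1; assert (H := pow2_gt_0 _ H2); lra.
  - assert (H := pow2_gt_0 _ H1); assert (H' := pow2_ge_0 (snd p)); lra.
Qed.

(** The Euclidean norm is controlled by the null components, which are the quantities estimated at
    the ends. *)
Lemma enorm_le_null p : enorm p <= Rabs (fst p + snd p) + Rabs (fst p - snd p).
Proof.
  assert (H1 := Rabs_pos (fst p + snd p)); assert (H2 := Rabs_pos (fst p - snd p)).
  apply Rsqr_incr_0; [|apply enorm_pos|lra].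
  unfold enorm; rewrite Rsqr_sqrt; unfold Rsqr.
  - assert (E1 := pow2_abs (fst p + snd p)); assert (E2 := pow2_abs (fst p - snd p)); nra.
  - assert (H3 := pow2_ge_0 (fst p)); assert (H4 := pow2_ge_0 (snd p)); lra.
Qed.

(** Here the oriented line matters, not the origin of the ray: as [rho] tends to infinity, [Q] may
    be slid along the line. This lets both asymptotes later start at a common vertex. *)
Definition asymptote (F : (R -> Prop) -> Prop) (X : R -> pt) (Q d : pt) : Prop :=
  enorm d = 1 /\ exists rho : R -> R,
    (forall M, F (fun s => M < rho s)) /\
    (forall eps, 0 < eps ->
       F (fun s => enorm (psub (X s) (padd Q (pscal (rho s) d))) < eps)).

Lemma asymptote_ray F {FF : Filter F} X Q d c : asymptote F X Q d ->
  asymptotic_to_ray F X (padd Q (pscal c d)) d.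
Proof.
  intros (Hd & rho & Hr & He); split.
  - intros M; apply filter_imp with (2 := filter_and _ _ (Hr (M + 1 + enorm Q)) (He 1 Rlt_0_1)).
    intros s [H1 H2].
    assert (H3 : enorm (pscal (rho s) d) <= enorm (psub (pscal (rho s) d) (psub (X s) Q))
      + enorm (psub (X s) Q)) by apply enorm_le_psub.
    replace (psub (pscal (rho s) d) (psub (X s) Q))
      with (psub (padd Q (pscal (rho s) d)) (X s)) in H3
      by (unfold psub, padd; simpl; f_equal; ring).
    rewrite enorm_psub_sym, enorm_pscal, Hd in H3.
    assert (H4 := enorm_psub_triangle (X s) (0, 0) Q).
    rewrite enorm_psub_0, (enorm_psub_sym (0, 0) Q), enorm_psub_0 in H4.
    assert (H5 := Rle_abs (rho s)); lra.
  - intros eps Heps; apply filter_imp with (2 := filter_and _ _ (Hr c) (He eps Heps)).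
    intros s [H1 H2]; exists (rho s - c); split; [lra|].
    replace (padd (padd Q (pscal c d)) (pscal (rho s - c) d)) with (padd Q (pscal (rho s) d));
      trivial.
    unfold padd, pscal; simpl; f_equal; ring.
Qed.

Lemma asymptote_intro F {FF : Filter F} X Q D rho : D <> (0, 0) ->
  (forall M, F (fun s => M < rho s)) ->
  (forall eps, 0 < eps -> F (fun s => enorm (psub (X s) (padd Q (pscal (rho s) D))) < eps)) ->
  asymptote F X Q (pscal (/ enorm D) D).
Proof.
  intros HD Hr He; assert (Hn := enorm_gt_0 D HD); split.
  - rewrite enorm_pscal, Rabs_pos_eq; [field; lra|now apply Rlt_le, Rinv_0_lt_compat].
  - exists (fun s => rho s * enorm D); split.
    + intros M; apply filter_imp with (2 := Hr (M / enorm D)).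
      intros s H; apply Rmult_lt_compat_r with (r := enorm D) in H; trivial.
      unfold Rdiv in H; rewrite Rmult_assoc, Rinv_l, Rmult_1_r in H; lra.
    + intros eps Heps; apply filter_imp with (2 := He eps Heps); intros s.
      replace (pscal (rho s * enorm D) (pscal (/ enorm D) D)) with (pscal (rho s) D); trivial.
      unfold pscal; simpl; f_equal; field; lra.
Qed.

(** With signs [e1], [e2] this serves three reductions: negative curvature [(1, -1)], negative [A]
    [(-1, -1)] and reversal of arc length [(-1, 1)]. *)
Definition reflect (e1 e2 : R) (p : pt) : pt := (e1 * fst p, e2 * snd p).

Lemma enorm_reflect e1 e2 p : e1 * e1 = 1 -> e2 * e2 = 1 -> enorm (reflect e1 e2 p) = enorm p.
Proof.
  intros H1 H2; unfold enorm, reflect; simpl; f_equal.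
  transitivity (e1 * e1 * (fst p * (fst p * 1)) + e2 * e2 * (snd p * (snd p * 1))); [ring|].
  rewrite H1, H2; ring.
Qed.

Lemma reflect_involutive e1 e2 p : e1 * e1 = 1 -> e2 * e2 = 1 ->
  reflect e1 e2 (reflect e1 e2 p) = p.
Proof.
  intros H1 H2; unfold reflect; destruct p as [x y]; simpl.
  now rewrite <- !Rmult_assoc, H1, H2, !Rmult_1_l.
Qed.

Lemma enorm_psub_reflect e1 e2 p Q r d : e1 * e1 = 1 -> e2 * e2 = 1 ->
  enorm (psub (reflect e1 e2 p) (padd (reflect e1 e2 Q) (pscal r (reflect e1 e2 d)))) =
  enorm (psub p (padd Q (pscal r d))).
Proof.
  intros H1 H2; rewrite <- (enorm_reflect e1 e2 (psub p _)); trivial; f_equal.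
  unfold reflect, psub, padd, pscal; simpl; f_equal; ring.
Qed.

Lemma asymptote_reflect e1 e2 F {FF : Filter F} X Q d : e1 * e1 = 1 -> e2 * e2 = 1 ->
  asymptote F X Q d ->
  asymptote F (fun s => reflect e1 e2 (X s)) (reflect e1 e2 Q) (reflect e1 e2 d).
Proof.
  intros H1 H2 (Hd & rho & Hr & He); split; [now rewrite enorm_reflect|].
  exists rho; split; trivial; intros eps Heps.
  apply filter_imp with (2 := He eps Heps); intros s; now rewrite enorm_psub_reflect.
Qed.

Lemma asymptotic_to_ray_reflect e1 e2 F {FF : Filter F} X P d : e1 * e1 = 1 -> e2 * e2 = 1 ->
  asymptotic_to_ray F X P d ->
  asymptotic_to_ray F (fun s => reflect e1 e2 (X s)) (reflect e1 e2 P) (reflect e1 e2 d).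
Proof.
  intros H1 H2 [HM He]; split.
  - intros M; apply filter_imp with (2 := HM M); intros s; now rewrite enorm_reflect.
  - intros eps Heps; apply filter_imp with (2 := He eps Heps).
    intros s (r & Hr & H); exists r; split; trivial; now rewrite enorm_psub_reflect.
Qed.

Lemma asymptotic_to_cone_reflect e1 e2 a b X P d1 d2 : e1 * e1 = 1 -> e2 * e2 = 1 ->
  asymptotic_to_cone a b X P d1 d2 ->
  asymptotic_to_cone a b (fun s => reflect e1 e2 (X s))
    (reflect e1 e2 P) (reflect e1 e2 d1) (reflect e1 e2 d2).
Proof.
  intros H1 H2 (Hd1 & Hd2 & Hne & HL & HR).
  split; [now rewrite enorm_reflect|]; split; [now rewrite enorm_reflect|].
  split; [|split; apply asymptotic_to_ray_reflect; trivial; apply _].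
  intros E; apply Hne.
  rewrite <- (reflect_involutive e1 e2 d1), E by trivial; now apply reflect_involutive.
Qed.

Lemma asymptotic_to_ray_ext F {FF : Filter F} X Y P d : F (fun s => X s = Y s) ->
  asymptotic_to_ray F X P d -> asymptotic_to_ray F Y P d.
Proof.
  intros HXY [HM He]; split.
  - intros M; apply filter_imp with (2 := filter_and _ _ HXY (HM M)); now intros s [-> H].
  - intros eps Heps; apply filter_imp with (2 := filter_and _ _ HXY (He eps Heps)).
    now intros s [-> H].
Qed.

Lemma asymptotic_to_cone_ext a b X Y P d1 d2 : Rbar_lt a b ->
  (forall s, in_intv a b s -> X s = Y s) ->
  asymptotic_to_cone a b X P d1 d2 -> asymptotic_to_cone a b Y P d1 d2.
Proof.
  intros Hab HXY (Hd1 & Hd2 & Hne & HL & HR).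
  split; trivial; split; trivial; split; trivial; split.
  - apply asymptotic_to_ray_ext with X; trivial; [apply _|].
    now apply filter_imp with (2 := left_end_intv a b Hab).
  - apply asymptotic_to_ray_ext with X; trivial; [apply _|].
    now apply filter_imp with (2 := right_end_intv a b Hab).
Qed.

Lemma asymptote_opp a X Q d :
  asymptote (right_end (Rbar_opp a)) (fun s => X (- s)) Q d -> asymptote (left_end a) X Q d.
Proof.
  intros (Hd & rho & Hr & He); split; trivial; exists (fun s => rho (- s)); split.
  - intros M; apply left_end_opp; apply filter_imp with (2 := Hr M).
    intros s; now rewrite Ropp_involutive.
  - intros eps Heps; apply left_end_opp; apply filter_imp with (2 := He eps Heps).
    intros s; now rewrite Ropp_involutive.
Qed.

(** Both the supremum property and the limit are exported: the flat end uses the former, the sharp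
    end the latter. *)
Lemma monotone_right_limit a b (f : R -> R) s1 B : in_intv a b s1 ->
  (forall x y, s1 <= x -> x <= y -> in_intv a b x -> in_intv a b y -> f x <= f y) ->
  (forall x, s1 <= x -> in_intv a b x -> f x <= B) ->
  exists l, (forall x, s1 <= x -> in_intv a b x -> f x <= l) /\
    (forall M, (forall x, s1 <= x -> in_intv a b x -> f x <= M) -> l <= M) /\
    (forall eps, 0 < eps -> right_end b (fun s => Rabs (f s - l) < eps)).
Proof.
  intros Hs1 Hmono HB.
  destruct (completeness (fun y => exists x, s1 <= x /\ in_intv a b x /\ y = f x)) as [l [Hl1 Hl2]].
  - exists B; intros y (x & H1 & H2 & ->); auto.
  - exists (f s1), s1; split; [lra|now split].
  - assert (Hle : forall x, s1 <= x -> in_intv a b x -> f x <= l)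
      by (intros x H1 H2; apply Hl1; now exists x).
    exists l; split; trivial; split.
    + intros M HM; apply Hl2; intros y (x & H1 & H2 & ->); auto.
    + intros eps He.
      assert (Hx : exists x, s1 <= x /\ in_intv a b x /\ l - eps < f x).
      { apply Classical_Prop.NNPP; intros H; apply (Rlt_not_le l (l - eps)); [lra|].
        apply Hl2; intros y (x & H1 & H2 & ->); apply Rnot_lt_le; intros H3.
        apply H; now exists x. }
      destruct Hx as (x & H1 & H2 & H3).
      apply (right_end_intro a b x _ H2); intros s Hs Hi.
      assert (H4 := Hmono x s H1 (Rlt_le _ _ Hs) H2 Hi).
      assert (H5 := Hle s ltac:(lra) Hi); apply Rabs_def1; lra.
Qed.

Section RightAsymptote.

Variables (a b : Rbar) (A t k : R -> R) (s0 c : R).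
Hypothesis Hs0 : in_intv a b s0.
Hypothesis Hflow : flow a b A t k.
Hypothesis HA : forall s, in_intv a b s -> 0 < A s.
Hypothesis Hpos : forall s, in_intv a b s -> 0 < k s.

Lemma flow_increasing x y : in_intv a b x -> in_intv a b y -> x <= y -> A x <= A y.
Proof.
  intros Hx Hy Hxy; apply (derive_nonneg_le A (fun s => k s * A s) x y Hxy).
  intros z Hz; assert (Hzi : in_intv a b z) by now apply intv_between with x y.
  split; [now apply Hflow|].
  apply Rmult_le_pos; apply Rlt_le; auto.
Qed.

(** If [x + y] tends to infinity and [x - y] to [v0], the asymptote is the light-like line
    [x - y = v0]. With [rho = x + y] the error has only the component [x - y - v0]. *)
Lemma right_asymptote_null v0 :
  (forall M, right_end b (fun s => M < (t s + k s) * A s)) ->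
  (forall eps, 0 < eps -> right_end b (fun s => Rabs ((t s - k s) / A s - v0) < eps)) ->
  exists Q d, asymptote (right_end b) (curve A t k) Q d /\
    0 < fst d + snd d /\ fst d - snd d = 0 /\ (v0 = 0 -> Q = (0, 0)).
Proof.
  intros Hu Hv; exists (v0 / 2, - (v0 / 2)), (pscal (/ enorm (1 / 2, 1 / 2)) (1 / 2, 1 / 2)).
  assert (HD : (1 / 2, 1 / 2) <> (0, 0)) by (intros E; injection E; lra).
  assert (Hn := Rinv_0_lt_compat _ (enorm_gt_0 _ HD)).
  split; [|split; [|split]].
  - apply asymptote_intro with (fun s => (t s + k s) * A s); trivial; [apply _|].
    assert (Hab : Rbar_lt a b) by (apply Rbar_lt_trans with s0; apply Hs0).
    intros eps He.
    apply filter_imp with (2 := filter_and _ _ (Hv eps He) (right_end_intv a b Hab)).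
    intros s [H Hi]; assert (HAs := HA s Hi); eapply Rle_lt_trans; [apply enorm_le_null|].
    unfold psub, padd, pscal, curve; simpl.
    match goal with |- Rabs ?x + Rabs ?y < _ =>
      replace x with 0 by (field; lra); replace y with ((t s - k s) / A s - v0) by (field; lra) end.
    rewrite Rabs_R0; lra.
  - unfold pscal; simpl; lra.
  - unfold pscal; simpl; ring.
  - intros ->; f_equal; lra.
Qed.

(** Once [t > 1], [ln A] increases while [ln A + k] decreases, so [ln A] is within [k] of its limit
    and [B - A = O(k)]. The first integral makes [k t] tend to 0, so [X] approaches the multiple by
    [t] of the limiting tangent. *)
Lemma right_asymptote_flat : right_kind Flat b t k ->
  exists d, asymptote (right_end b) (curve A t k) (0, 0) d /\
    0 < fst d + snd d /\ 0 < fst d - snd d.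
Proof.
  intros (Hb & Hk & Ht).
  destruct (right_end_elim a b s0 _ Hs0 (filter_and _ _ (Ht 1) (Hk (1 / 2) ltac:(lra))))
    as (s1 & _ & Hs1 & H1).
  assert (Hk1 : forall s, s1 <= s -> in_intv a b s -> 1 < t s /\ k s < 1 / 2).
  { intros s Hs Hi; destruct (H1 s Hs Hi) as [H2 H3]; split; trivial.
    rewrite Rabs_pos_eq in H3; trivial; apply Rlt_le; auto. }
  assert (HL : forall x y, in_intv a b x -> in_intv a b y -> x <= y -> ln (A x) <= ln (A y)).
  { intros x y Hx Hy Hxy; apply ln_le; auto; now apply flow_increasing. }
  assert (HW : forall x y, s1 <= x -> in_intv a b x -> in_intv a b y -> x <= y ->
    ln (A y) + k y <= ln (A x) + k x).
  { intros x y Hsx Hx Hy Hxy; cut (- (ln (A x) + k x) <= - (ln (A y) + k y)); [lra|].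
    apply (derive_nonneg_le (fun s => - (ln (A s) + k s)) (fun s => k s * (t s - 1)) x y Hxy).
    intros z Hz; assert (Hzi : in_intv a b z) by now apply intv_between with x y.
    destruct (proj1 Hflow z Hzi) as [_ Hdk], (proj2 Hflow z Hzi) as [HdA HA0].
    assert (HAz := HA z Hzi); assert (Hkz := Hpos z Hzi).
    destruct (Hk1 z) as [Htz _]; trivial; [lra|].
    split; [solve_derive; field; lra|nra]. }
  destruct (monotone_right_limit a b (fun s => ln (A s)) s1 (ln (A s1) + k s1) Hs1)
    as (l & Hl1 & Hl2 & _).
  { intros x y Hx Hxy Hxi Hyi; now apply HL. }
  { intros x Hx Hxi; assert (H := HW s1 x (Rle_refl _) Hs1 Hxi Hx).
    specialize (Hpos x Hxi); lra. }
  assert (Hl3 : forall s, s1 <= s -> in_intv a b s -> l <= ln (A s) + k s).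
  { intros s Hs Hi; apply Hl2; intros x Hx Hxi; destruct (Rle_dec s x) as [H|H].
    - assert (H' := HW s x Hs Hi Hxi H); specialize (Hpos x Hxi); lra.
    - assert (H' := HL x s Hxi Hi ltac:(lra)); specialize (Hpos s Hi); lra. }
  pose (B := exp l); assert (HB : 0 < B) by apply exp_pos.
  assert (HBi := Rinv_0_lt_compat _ HB).
  assert (HA1 := HA s1 Hs1).
  assert (Hgap : forall s, s1 <= s -> in_intv a b s ->
    A s1 <= A s <= B /\ B - A s <= 2 * k s * A s).
  { intros s Hs Hi; specialize (Hl1 s Hs Hi); specialize (Hl3 s Hs Hi).
    assert (HAs := HA s Hi); assert (Hks := Hpos s Hi); destruct (Hk1 s Hs Hi) as [_ Hk2].
    assert (Hlo : A s <= B).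
    { rewrite <- (exp_ln (A s)) by trivial; unfold B.
      destruct Hl1 as [Hl1| ->]; [apply Rlt_le, exp_increasing; exact Hl1|lra]. }
    split; [split; trivial; now apply flow_increasing|].
    assert (Hhi : B <= A s * exp (k s)).
    { rewrite <- (exp_ln (A s)) at 1 by trivial; rewrite <- exp_plus; unfold B.
      destruct Hl3 as [Hl3| ->]; [apply Rlt_le, exp_increasing; exact Hl3|lra]. }
    assert (He : exp (k s) <= 1 + 2 * k s).
    { assert (H := exp_ineq1_le (- k s)); rewrite exp_Ropp in H.
      assert (Hp := exp_pos (k s)).
      apply Rmult_le_compat_r with (r := exp (k s)) in H; [|lra].
      rewrite Rinv_l in H by lra; nra. }
    nra. }
  pose (C := k s0 ^ 2 * exp (t s0 ^ 2 - k s0 ^ 2)).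
  assert (HC : 0 < C).
  { apply Rmult_lt_0_compat; [apply pow_lt; auto|apply exp_pos]. }
  (* From [k^2 exp (t^2) = C exp (k^2) <= 3 C] and [exp (t^2) >= t^4 / 4]; hence [k t] is of order
     at most [/ t]. *)
  assert (Hkt2 : forall s, s1 <= s -> in_intv a b s -> (k s * t s) ^ 2 * t s ^ 2 <= 12 * C).
  { intros s Hs Hi; destruct (Hk1 s Hs Hi) as [Hts Hks]; assert (Hks0 := Hpos s Hi).
    assert (HCs : C = k s ^ 2 * exp (t s ^ 2 - k s ^ 2))
      by (apply (orbit_first_integral a b); trivial; apply Hflow).
    assert (E1 : exp (t s ^ 2) = exp (t s ^ 2 - k s ^ 2) * exp (k s ^ 2))
      by (rewrite <- exp_plus; f_equal; ring).
    assert (E2 : exp (k s ^ 2) <= 3).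
    { apply Rle_trans with (exp 1); [apply Rlt_le, exp_increasing; nra|apply exp_le_3]. }
    assert (E3 : t s ^ 2 / 2 * (t s ^ 2 / 2) <= exp (t s ^ 2)).
    { replace (exp (t s ^ 2)) with (exp (t s ^ 2 / 2) * exp (t s ^ 2 / 2))
        by (rewrite <- exp_plus; f_equal; field).
      assert (H := exp_ineq1_le (t s ^ 2 / 2)); assert (H' := pow2_ge_0 (t s)).
      apply Rmult_le_compat; lra. }
    assert (E4 : k s ^ 2 * exp (t s ^ 2) <= 3 * C).
    { rewrite E1, <- Rmult_assoc, <- HCs; nra. }
    assert (E5 : k s ^ 2 * (t s ^ 2 / 2 * (t s ^ 2 / 2)) <= k s ^ 2 * exp (t s ^ 2))
      by (apply Rmult_le_compat_l; [apply pow2_ge_0|exact E3]).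
    replace ((k s * t s) ^ 2 * t s ^ 2)
      with (4 * (k s ^ 2 * (t s ^ 2 / 2 * (t s ^ 2 / 2)))) by field; lra. }
  assert (Hkt : forall eps, 0 < eps -> right_end b (fun s => k s * t s < eps)).
  { intros eps He.
    destruct (right_end_elim a b s1 _ Hs1 (Ht ((12 * C + 1) / eps))) as (s2 & H2 & Hs2 & H3).
    apply (right_end_intro a b s2 _ Hs2); intros s Hs Hi.
    specialize (H3 s (Rlt_le _ _ Hs) Hi).
    assert (H4 := Hkt2 s ltac:(lra) Hi); destruct (Hk1 s ltac:(lra) Hi) as [H5 _].
    apply Rnot_le_lt; intros H6; specialize (Hpos s Hi).
    assert (H7 : 12 * C + 1 < t s * eps).
    { apply Rmult_lt_compat_r with (r := eps) in H3; trivial.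
      unfold Rdiv in H3; rewrite Rmult_assoc, Rinv_l in H3; lra. }
    assert (H8 : t s * eps <= t s * (k s * t s)) by (apply Rmult_le_compat_l; lra).
    assert (H9 : (k s * t s) ^ 2 * t s ^ 2 = (t s * (k s * t s)) ^ 2) by ring.
    rewrite H9 in H4; nra. }
  pose (D := ((B + / B) / 2, (B - / B) / 2)).
  assert (HD : D <> (0, 0)) by (intros E; injection E; lra).
  exists (pscal (/ enorm D) D).
  assert (Hn := Rinv_0_lt_compat _ (enorm_gt_0 _ HD)).
  split; [|split].
  - apply asymptote_intro with t; trivial; [apply _|].
    intros eps He.
    (* The two null components of the error are at most [3 k t B] and [3 k t / A s1]. *)
    pose (m := 3 * (B + / A s1)).
    assert (HA1i := Rinv_0_lt_compat _ HA1).
    assert (Hm : 0 < m) by (unfold m; lra).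
    destruct (right_end_elim a b s1 _ Hs1 (Hkt (eps / m) ltac:(now apply Rdiv_lt_0_compat)))
      as (s2 & H2 & Hs2 & H3).
    apply (right_end_intro a b s2 _ Hs2); intros s Hs Hi.
    specialize (H3 s (Rlt_le _ _ Hs) Hi).
    destruct (Hk1 s ltac:(lra) Hi) as [Hts Hks].
    destruct (Hgap s ltac:(lra) Hi) as [[Hg1 Hg2] Hg3].
    assert (HAs := HA s Hi); assert (Hks0 := Hpos s Hi).
    assert (HAsi := Rinv_0_lt_compat _ HAs).
    assert (Hki : k s <= k s * t s) by nra.
    eapply Rle_lt_trans; [apply enorm_le_null|].
    unfold psub, padd, pscal, curve, D; simpl.
    match goal with |- Rabs ?x + Rabs ?y < _ =>
      replace x with (k s * A s - t s * (B - A s)) by (field; lra);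
      replace y with ((t s * (B - A s) / B - k s) * / A s) by (field; lra) end.
    assert (Hx : Rabs (k s * A s - t s * (B - A s)) <= 3 * (k s * t s) * B).
    { assert (0 <= t s * (B - A s)) by (apply Rmult_le_pos; lra).
      assert (t s * (B - A s) <= t s * (2 * k s * A s)) by (apply Rmult_le_compat_l; lra).
      assert (k s * A s <= k s * t s * B) by (apply Rmult_le_compat; lra).
      assert (k s * t s * A s <= k s * t s * B) by (apply Rmult_le_compat_l; lra).
      apply Rabs_le; split; nra. }
    assert (Hy : Rabs ((t s * (B - A s) / B - k s) * / A s) <= 3 * (k s * t s) * / A s1).
    { rewrite Rabs_mult, (Rabs_pos_eq (/ A s)) by lra.
      assert (/ A s <= / A s1) by (apply Rinv_le_contravar; lra).
      assert (0 <= t s * (B - A s) / B <= 2 * (k s * t s)).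
      { assert (0 <= t s * (B - A s)) by (apply Rmult_le_pos; lra).
        assert (t s * (B - A s) <= t s * (2 * k s * B)).
        { apply Rmult_le_compat_l; [lra|]; nra. }
        split; [apply Rmult_le_pos; lra|].
        apply Rmult_le_reg_r with B; trivial; unfold Rdiv.
        rewrite Rmult_assoc, Rinv_l by lra; lra. }
      apply Rmult_le_compat; try lra; [apply Rabs_pos|].
      apply Rabs_le; split; lra. }
    apply Rle_lt_trans with (k s * t s * m); [unfold m; lra|].
    apply Rmult_lt_compat_r with (r := m) in H3; trivial.
    replace (eps / m * m) with eps in H3 by (field; lra); exact H3.
  - assert (H := Rmult_lt_0_compat _ _ Hn HB); unfold pscal; cbn [fst snd].
    change (fst D) with ((B + / B) / 2); change (snd D) with ((B - / B) / 2); lra.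
  - assert (H := Rmult_lt_0_compat _ _ Hn HBi); unfold pscal; cbn [fst snd].
    change (fst D) with ((B + / B) / 2); change (snd D) with ((B - / B) / 2); lra.
Qed.

(** With [k] near 1, [A' = k A] makes [A] grow at least linearly on an infinite end. Since [t + k]
    and [t - k] stay near 1 and -1, [x + y] tends to infinity and [x - y] to 0. *)
Lemma right_asymptote_unit : right_kind Unit b t k ->
  exists d, asymptote (right_end b) (curve A t k) (0, 0) d /\
    0 < fst d + snd d /\ fst d - snd d = 0.
Proof.
  intros [Hb Hk].
  destruct (right_end_elim a b s0 _ Hs0 (Hk (1 / 4) ltac:(lra))) as (s1 & _ & Hs1 & H1).
  assert (H2 : forall s, s1 <= s -> in_intv a b s -> 3 / 4 < k s < 5 / 4 /\ - 1 / 4 < t s < 1 / 4).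
  { intros s Hs Hi; destruct (H1 s Hs Hi) as [H2 H3]; apply Rabs_def2 in H2, H3; lra. }
  assert (HA1 := HA s1 Hs1).
  assert (Hgrow : forall s, s1 <= s -> in_intv a b s -> A s1 * (1 + (s - s1) / 2) <= A s).
  { intros s Hs Hi; cut (A s1 - A s1 * s1 / 2 <= A s - A s1 * s / 2); [lra|].
    apply (derive_nonneg_le (fun u => A u - A s1 * u / 2) (fun u => k u * A u - A s1 / 2) s1 s Hs).
    intros z Hz; assert (Hzi : in_intv a b z) by now apply intv_between with s1 s.
    destruct (proj2 Hflow z Hzi) as [HdA _]; destruct (H2 z (proj1 Hz) Hzi) as [Hkz _].
    assert (HAz := flow_increasing s1 z Hs1 Hzi (proj1 Hz)).
    split; [solve_derive; field|nra]. }
  assert (Hlim : forall M, right_end b (fun s => M < A s)).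
  { intros M; pose (s2 := s1 + 2 * (Rabs M / A s1)).
    assert (HM : 0 <= Rabs M / A s1)
      by (apply Rmult_le_pos; [apply Rabs_pos|now apply Rlt_le, Rinv_0_lt_compat]).
    assert (Hs2 : in_intv a b s2).
    { split; [apply Rbar_lt_le_trans with s1; [apply Hs1|unfold s2; simpl; lra]|now rewrite Hb]. }
    apply (right_end_intro a b s2 _ Hs2); intros s Hs Hi; unfold s2 in Hs.
    assert (H3 := Hgrow s ltac:(lra) Hi).
    assert (H4 : A s1 * (Rabs M / A s1) = Rabs M) by (field; lra).
    assert (H5 : A s1 * (1 + (s - s1) / 2) > A s1 * (Rabs M / A s1))
      by (apply Rmult_lt_compat_l; lra).
    assert (H6 := Rle_abs M); lra. }
  destruct (right_asymptote_null 0) as (Q & d & Hd1 & Hd2 & Hd3 & HQ).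
  - intros M.
    destruct (right_end_elim a b s1 _ Hs1 (Hlim (2 * Rabs M))) as (s2 & H3 & Hs2 & H4).
    apply (right_end_intro a b s2 _ Hs2); intros s Hs Hi.
    specialize (H4 s (Rlt_le _ _ Hs) Hi); destruct (H2 s ltac:(lra) Hi) as [H5 H6].
    assert (H7 := Rle_abs M); assert (H8 := Rabs_pos M); nra.
  - intros eps He.
    destruct (right_end_elim a b s1 _ Hs1 (Hlim (2 / eps))) as (s2 & H3 & Hs2 & H4).
    apply (right_end_intro a b s2 _ Hs2); intros s Hs Hi.
    specialize (H4 s (Rlt_le _ _ Hs) Hi); destruct (H2 s ltac:(lra) Hi) as [H5 H6].
    assert (HAs := HA s Hi); assert (HAsi := Rinv_0_lt_compat _ HAs).
    rewrite Rminus_0_r; unfold Rdiv; rewrite Rabs_mult, (Rabs_pos_eq (/ A s)) by lra.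
    apply Rmult_lt_reg_r with (A s); trivial; rewrite Rmult_assoc, Rinv_l, Rmult_1_r by lra.
    apply Rmult_lt_compat_r with (r := eps) in H4; trivial.
    unfold Rdiv in H4; rewrite Rmult_assoc, Rinv_l in H4 by lra.
    apply Rle_lt_trans with 2; [apply Rabs_le; lra|lra].
  - exists d; rewrite HQ in Hd1; auto.
Qed.

Hypothesis Hc : forall s, in_intv a b s -> 2 * ln (k s) + t s ^ 2 - k s ^ 2 = c.

(** The component [v = x - y] has derivative [/ A > 0] and is negative near the end, so it
    converges. The product of [x + y] with [v] is [c - 2 ln k], tending to minus infinity, and [v]
    is bounded, so [x + y] tends to infinity. *)
Lemma right_asymptote_sharp : right_kind Sharp b t k ->
  exists Q d, asymptote (right_end b) (curve A t k) Q d /\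
    0 < fst d + snd d /\ fst d - snd d = 0.
Proof.
  intros [[r Hr] Hk].
  destruct (right_end_elim a b s0 _ Hs0 (Hk 0)) as (s1 & _ & Hs1 & H1).
  assert (HA1 := HA s1 Hs1); assert (HA1i := Rinv_0_lt_compat _ HA1).
  pose (v := fun s => (t s - k s) / A s).
  assert (Hdv : forall s, in_intv a b s -> is_derive v s (/ A s)).
  { intros s Hs; destruct (proj1 Hflow s Hs) as [Hdt Hdk], (proj2 Hflow s Hs) as [HdA HA0].
    unfold v; solve_derive; field; trivial. }
  assert (Hvneg : forall s, s1 <= s -> in_intv a b s -> v s < 0).
  { intros s Hs Hi; destruct (H1 s Hs Hi) as [H2 H3].
    assert (HAs := Rinv_0_lt_compat _ (HA s Hi)); unfold v, Rdiv; nra. }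
  assert (Hmono : forall x y, in_intv a b x -> in_intv a b y -> x <= y -> v x <= v y).
  { intros x y Hx Hy Hxy; apply (derive_nonneg_le v (fun s => / A s) x y Hxy).
    intros z Hz; assert (Hzi : in_intv a b z) by now apply intv_between with x y.
    split; [auto|now apply Rlt_le, Rinv_0_lt_compat, HA]. }
  destruct (monotone_right_limit a b v s1 0 Hs1) as (v0 & _ & _ & Hv0).
  { intros x y Hx Hxy Hxi Hyi; now apply Hmono. }
  { intros x Hx Hxi; now apply Rlt_le, Hvneg. }
  destruct (right_asymptote_null v0) as (Q & d & Hd1 & Hd2 & Hd3 & _).
  - intros M; pose (V := - v s1).
    assert (HV : 0 < V) by (assert (H := Hvneg s1 (Rle_refl _) Hs1); unfold V; lra).
    (* Beyond this curvature [2 ln k - c > V |M|]; dividing by [- v], which lies between 0 and [V],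
       gives [x + y > |M|]. *)
    destruct (right_end_elim a b s1 _ Hs1 (Hk (exp ((c + V * Rabs M) / 2)))) as (s2 & H3 & Hs2 & H4).
    apply (right_end_intro a b s2 _ Hs2); intros s Hs Hi.
    destruct (H4 s (Rlt_le _ _ Hs) Hi) as [H5 _].
    apply ln_increasing in H5; [|apply exp_pos]; rewrite ln_exp in H5.
    specialize (Hc s Hi).
    assert (Hvs := Hvneg s ltac:(lra) Hi); assert (Hvs' := Hmono s1 s Hs1 Hi ltac:(lra)).
    assert (HAs := HA s Hi).
    assert (Huv : (t s + k s) * A s * v s = t s ^ 2 - k s ^ 2) by (unfold v; field; lra).
    assert (HM := Rabs_pos M); assert (HM' := Rle_abs M).
    set (u := (t s + k s) * A s) in *.
    assert (Hu : V * Rabs M < u * - v s) by lra.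
    assert (Hv : - v s <= V) by (unfold V; lra).
    assert (Hu0 : 0 < u).
    { apply Rmult_lt_reg_r with (- v s); [lra|]; rewrite Rmult_0_l.
      apply Rle_lt_trans with (2 := Hu); apply Rmult_le_pos; lra. }
    apply Rle_lt_trans with (1 := HM'); apply Rmult_lt_reg_l with V; trivial.
    apply Rlt_le_trans with (1 := Hu); rewrite Rmult_comm; apply Rmult_le_compat_r; lra.
  - exact Hv0.
  - now exists Q, d.
Qed.

Lemma right_asymptote e : right_kind e b t k ->
  exists Q d, asymptote (right_end b) (curve A t k) Q d /\
    0 < fst d + snd d /\ 0 <= fst d - snd d /\ (fst d - snd d = 0 \/ Q = (0, 0)).
Proof.
  destruct e; intros H.
  - destruct (right_asymptote_flat H) as (d & H1 & H2 & H3).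
    exists (0, 0), d; split; [trivial|split; [trivial|split; [lra|now right]]].
  - destruct (right_asymptote_unit H) as (d & H1 & H2 & H3).
    exists (0, 0), d; split; [trivial|split; [trivial|split; [lra|now right]]].
  - destruct (right_asymptote_sharp H) as (Q & d & H1 & H2 & H3).
    exists Q, d; split; [trivial|split; [trivial|split; [lra|now left]]].
Qed.

End RightAsymptote.

Lemma asymptote_ext F {FF : Filter F} X Y Q d : F (fun s => X s = Y s) ->
  asymptote F X Q d -> asymptote F Y Q d.
Proof.
  intros HXY (Hd & rho & Hr & He); split; trivial; exists rho; split; trivial.
  intros eps Heps; apply filter_imp with (2 := filter_and _ _ HXY (He eps Heps)).
  now intros s [-> H].
Qed.

(** Inverting [A] combines the reversal with the reflection of the plane that changes the sign of x;
    this keeps [k], and the sign of [A]. *)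
Lemma flow_reverse a b A t k : flow a b A t k ->
  flow (Rbar_opp b) (Rbar_opp a) (fun s => / A (- s)) (fun s => - t (- s)) (fun s => k (- s)).
Proof.
  intros [Ho HA]; split; [now apply orbit_reverse|].
  intros s Hs; destruct (HA (- s)) as [Hd H0]; [now apply intv_opp_inv|].
  split; [solve_derive; field; trivial|now apply Rinv_neq_0_compat].
Qed.

Lemma left_asymptote e a b A t k s0 c : in_intv a b s0 -> flow a b A t k ->
  (forall s, in_intv a b s -> 0 < A s) -> (forall s, in_intv a b s -> 0 < k s) ->
  (forall s, in_intv a b s -> 2 * ln (k s) + t s ^ 2 - k s ^ 2 = c) ->
  left_kind e a t k ->
  exists Q d, asymptote (left_end a) (curve A t k) Q d /\
    fst d + snd d <= 0 /\ fst d - snd d < 0 /\ (fst d + snd d = 0 \/ Q = (0, 0)).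
Proof.
  intros Hs0 Hf HA Hk Hc He.
  destruct (right_asymptote (Rbar_opp b) (Rbar_opp a) _ _ _ (- s0) c
    (intv_opp _ _ _ Hs0) (flow_reverse _ _ _ _ _ Hf)) with (e := e)
    as (Q & d & H1 & H2 & H3 & H4); trivial.
  - intros s Hs; apply Rinv_0_lt_compat, HA; now apply intv_opp_inv.
  - intros s Hs; apply Hk; now apply intv_opp_inv.
  - intros s Hs; rewrite <- (Hc (- s)); [ring|now apply intv_opp_inv].
  - exists (reflect (-1) 1 Q), (reflect (-1) 1 d); split; [|split; [|split]].
    + apply asymptote_opp.
      apply asymptote_ext with (fun s => reflect (-1) 1
        (curve (fun s => / A (- s)) (fun s => - t (- s)) (fun s => k (- s)) s)); [apply _| |].
      * assert (Hab : Rbar_lt (Rbar_opp b) (Rbar_opp a))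
          by (destruct (intv_opp _ _ _ Hs0); now apply Rbar_lt_trans with (- s0)).
        apply filter_imp with (2 := right_end_intv _ _ Hab); intros s Hs.
        assert (H0 := HA (- s) (intv_opp_inv _ _ _ Hs)).
        unfold reflect, curve; simpl; f_equal; field; lra.
      * apply asymptote_reflect; trivial; [apply _|lra|lra].
    + unfold reflect; simpl; lra.
    + unfold reflect; simpl; lra.
    + destruct H4 as [H4| ->]; [left; unfold reflect; simpl; lra|right].
      unfold reflect; simpl; f_equal; ring.
Qed.

Lemma flow_positive a b A t k s0 s : flow a b A t k -> in_intv a b s0 -> 0 < A s0 ->
  in_intv a b s -> 0 < A s.
Proof.
  intros [Ho HA] Hs0 H0 Hs.
  destruct (antiderivative_exists a b k s0 Hs0) as (K & HK0 & HK).
  { intros u Hu; eapply is_derive_continuity_pt, Ho, Hu. }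
  assert (E : A s * exp (- K s) = A s0 * exp (- K s0)).
  { apply (derive_zero_const a b (fun u => A u * exp (- K u))); trivial.
    intros u Hu; destruct (HA u Hu) as [Hd _]; specialize (HK u Hu); solve_derive; ring. }
  assert (He := exp_pos (- K s)); assert (He0 := exp_pos (- K s0)).
  apply Rmult_lt_reg_r with (exp (- K s)); trivial; rewrite Rmult_0_l, E.
  now apply Rmult_lt_0_compat.
Qed.

(** Two asymptotes through the origin meet there. If one of them is light-like, the equations for
    [c1] and [c2] in null coordinates are triangular, and the strict signs make them solvable. *)
Lemma lines_meet Q1 d1 Q2 d2 :
  fst d1 - snd d1 < 0 -> 0 < fst d2 + snd d2 ->
  (fst d1 + snd d1 = 0 \/ Q1 = (0, 0)) -> (fst d2 - snd d2 = 0 \/ Q2 = (0, 0)) ->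
  exists c1 c2, padd Q1 (pscal c1 d1) = padd Q2 (pscal c2 d2).
Proof.
  destruct Q1 as [x1 y1], Q2 as [x2 y2], d1 as [p1 q1], d2 as [p2 q2]; cbn [fst snd].
  intros Hv Hu H1 H2.
  assert (Hsolve : forall c1 c2,
    x1 + y1 + c1 * (p1 + q1) = x2 + y2 + c2 * (p2 + q2) ->
    x1 - y1 + c1 * (p1 - q1) = x2 - y2 + c2 * (p2 - q2) ->
    padd (x1, y1) (pscal c1 (p1, q1)) = padd (x2, y2) (pscal c2 (p2, q2))).
  { intros c1 c2 E1 E2; unfold padd, pscal; simpl; f_equal; lra. }
  destruct H1 as [H1|H1].
  - pose (c2 := (x1 + y1 - (x2 + y2)) / (p2 + q2)).
    exists ((x2 - y2 + c2 * (p2 - q2) - (x1 - y1)) / (p1 - q1)), c2; apply Hsolve.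
    + rewrite H1; unfold c2; field; lra.
    + field; lra.
  - destruct H2 as [H2|H2].
    + pose (c1 := (x2 - y2 - (x1 - y1)) / (p1 - q1)).
      exists c1, ((x1 + y1 + c1 * (p1 + q1) - (x2 + y2)) / (p2 + q2)); apply Hsolve.
      * field; lra.
      * rewrite H2; unfold c1; field; lra.
    + injection H1 as -> ->; injection H2 as -> ->; exists 0, 0; apply Hsolve; ring.
Qed.

(** The vertex is the intersection of the two asymptotes. The directions differ because [x + y] is
    at most 0 on the left one and positive on the right one. *)
Lemma phase_cone_positive eL eR n a b A t k : Rbar_lt a b ->
  phase eL eR n a b t k -> flow a b A t k -> (forall s, in_intv a b s -> 0 < A s) ->
  exists P d1 d2, asymptotic_to_cone a b (curve A t k) P d1 d2.
Proof.
  intros Hab (Ho & Hk & HL & HR & _) Hf HA.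
  destruct (intv_nonempty _ _ Hab) as [s0 Hs0].
  assert (Hc : forall s, in_intv a b s -> 2 * ln (k s) + t s ^ 2 - k s ^ 2
    = 2 * ln (k s0) + t s0 ^ 2 - k s0 ^ 2).
  { intros s Hs; now apply (orbit_energy a b). }
  destruct (left_asymptote eL a b A t k s0 _ Hs0 Hf HA Hk Hc HL)
    as (Q1 & d1 & H1 & H2 & H3 & H4).
  destruct (right_asymptote a b A t k s0 _ Hs0 Hf HA Hk Hc eR HR)
    as (Q2 & d2 & H5 & H6 & H7 & H8).
  destruct (lines_meet Q1 d1 Q2 d2 H3 H6 H4 H8) as (c1 & c2 & E).
  exists (padd Q1 (pscal c1 d1)), d1, d2.
  split; [apply H1|]; split; [apply H5|]; split; [intros Ed; rewrite Ed in H2; lra|].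
  split; [exact (asymptote_ray _ _ _ _ c1 H1)|rewrite E; exact (asymptote_ray _ _ _ _ c2 H5)].
Qed.

Lemma phase_cone eL eR n a b A t k : Rbar_lt a b ->
  phase eL eR n a b t k -> flow a b A t k ->
  exists P d1 d2, asymptotic_to_cone a b (curve A t k) P d1 d2.
Proof.
  intros Hab Hph Hf.
  destruct (intv_nonempty _ _ Hab) as [s0 Hs0].
  assert (H0 : A s0 <> 0) by now apply Hf.
  destruct (Rdichotomy _ _ H0) as [Hneg|Hpos].
  - assert (Hf' : flow a b (fun s => - A s) t k).
    { split; [apply Hf|]; intros s Hs; destruct (proj2 Hf s Hs) as [Hd Hn].
      split; [solve_derive; ring|lra]. }
    destruct (phase_cone_positive eL eR n a b (fun s => - A s) t k) as (P & d1 & d2 & H); trivial.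
    { intros s Hs; apply (flow_positive a b (fun s => - A s) t k s0 s); trivial; lra. }
    exists (reflect (-1) (-1) P), (reflect (-1) (-1) d1), (reflect (-1) (-1) d2).
    apply asymptotic_to_cone_ext with
      (fun s => reflect (-1) (-1) (curve (fun s => - A s) t k s)); trivial.
    + intros s Hs; assert (Hn : A s <> 0) by now apply Hf.
      unfold reflect, curve; simpl; f_equal; field; trivial.
    + apply asymptotic_to_cone_reflect; trivial; lra.
  - apply (phase_cone_positive eL eR n); trivial.
    intros s Hs; now apply (flow_positive a b A t k s0 s).
Qed.

(** * Emergence from the cone and expansion to infinity *)

Lemma expander_enorm_continuous a b X s : expander_on a b X -> in_intv a b s ->
  continuity_pt (fun u => enorm (X u)) s.
Proof.
  intros [_ H] Hs; destruct (H s Hs) as ([l1 H1] & [l2 H2] & _).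
  apply (continuity_pt_comp (fun u => fst (X u) ^ 2 + snd (X u) ^ 2) sqrt).
  - apply is_derive_continuity_pt with (2 * fst (X s) * l1 + 2 * snd (X s) * l2).
    set (f := fun u => fst (X u)) in *; set (g := fun u => snd (X u)) in *.
    change (is_derive (fun u => f u ^ 2 + g u ^ 2) s (2 * f s * l1 + 2 * g s * l2)).
    solve_derive; ring.
  - apply continuity_pt_sqrt; assert (H3 := pow2_ge_0 (fst (X s)));
      assert (H4 := pow2_ge_0 (snd (X s))); lra.
Qed.

Lemma expander_opp_continuous a b X s : expander_on a b X ->
  in_intv (Rbar_opp b) (Rbar_opp a) s -> continuity_pt (fun u => enorm (X (- u))) s.
Proof.
  intros HX Hs; apply (continuity_pt_comp Ropp (fun u => enorm (X u))).
  - apply continuity_pt_opp, derivable_continuous_pt, derivable_pt_id.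
  - apply expander_enorm_continuous with a b; trivial; now apply intv_opp_inv.
Qed.

(** For [r > 0] the intermediate value theorem yields a point of the tail with norm [r / l]. Being
    near the ray, it is [(r / l) d] up to a bounded error, and scaling by [l] makes that error
    small, including the offset [P]. *)
Lemma ray_reached a b X P d r eps : Rbar_lt a b ->
  (forall s, in_intv a b s -> continuity_pt (fun u => enorm (X u)) s) ->
  enorm d = 1 -> asymptotic_to_ray (right_end b) X P d -> 0 <= r -> 0 < eps ->
  exists eta, 0 < eta /\ forall l, 0 < l < eta ->
    exists s, in_intv a b s /\ enorm (psub (pscal l (X s)) (pscal r d)) < eps.
Proof.
  intros Hab Hcont Hd [HM He] Hr Heps.
  destruct (intv_nonempty _ _ Hab) as [s0 Hs0].
  destruct (right_end_elim a b s0 _ Hs0 (He 1 Rlt_0_1)) as (s1 & _ & Hs1 & H1).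
  assert (HX1 := enorm_pos (X s1)); assert (HP := enorm_pos P).
  destruct Hr as [Hr|Hr].
  (* [e1] pushes [r / l] above the norm at [s1], as the intermediate value theorem requires; [e2]
     makes the scaled error [2 l (|P| + 1)] less than [eps]. *)
  - pose (e1 := r / (enorm (X s1) + 1)); pose (e2 := eps / (2 * (enorm P + 1))).
    assert (He1 : 0 < e1) by (apply Rdiv_lt_0_compat; lra).
    assert (He2 : 0 < e2) by (apply Rdiv_lt_0_compat; lra).
    exists (Rmin e1 e2); split; [now apply Rmin_pos|].
    intros l [Hl Hl'].
    assert (Hl1 : l < e1) by (apply Rlt_le_trans with (1 := Hl'), Rmin_l).
    assert (Hl2 : l < e2) by (apply Rlt_le_trans with (1 := Hl'), Rmin_r).
    assert (Hlow : enorm (X s1) < r / l).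
    { apply Rmult_lt_reg_r with l; trivial.
      replace (r / l * l) with r by (field; lra).
      apply Rmult_lt_compat_r with (r := enorm (X s1) + 1) in Hl1; [|lra].
      unfold e1 in Hl1; replace (r / (enorm (X s1) + 1) * (enorm (X s1) + 1)) with r in Hl1
        by (field; lra); lra. }
    destruct (right_end_elim a b s1 _ Hs1 (HM (r / l))) as (s2 & Hs12 & Hs2 & H2).
    specialize (H2 s2 (Rle_refl _) Hs2).
    destruct (ivt_interval (fun u => enorm (X u)) s1 s2 (r / l) Hs12) as (s & Hs & Hsn).
    { intros z Hz; apply Hcont; now apply intv_between with s1 s2. }
    { now split. }
    assert (Hi : in_intv a b s) by now apply intv_between with s1 s2.
    exists s; split; trivial.
    destruct (H1 s (proj1 Hs) Hi) as (rho & Hrho & Hdist).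
    (* |X s| = r / l, so the ray parameter [rho] of the nearby point is within |P| + 1 of r / l. *)
    assert (Hgap : Rabs (rho - r / l) <= enorm P + 1).
    { assert (E1 := enorm_le_psub (X s) (padd P (pscal rho d))).
      assert (E2 := enorm_triangle P (pscal rho d)).
      assert (E3 := enorm_le_psub (pscal rho d) (psub (X s) P)).
      replace (psub (pscal rho d) (psub (X s) P)) with (psub (padd P (pscal rho d)) (X s)) in E3
        by (unfold psub, padd; simpl; f_equal; ring).
      rewrite (enorm_psub_sym (padd P (pscal rho d))) in E3.
      assert (E4 := enorm_psub_triangle (X s) (0, 0) P).
      rewrite enorm_psub_0, (enorm_psub_sym (0, 0)), enorm_psub_0 in E4.
      rewrite enorm_pscal, Hd, Rabs_pos_eq in E2, E3 by trivial.
      rewrite <- Hsn; apply Rabs_le; split; lra. }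
    assert (E : psub (pscal l (X s)) (pscal r d) =
      pscal l (padd (psub (X s) (padd P (pscal rho d))) (padd P (pscal (rho - r / l) d)))).
    { unfold psub, pscal, padd; simpl; f_equal; field; lra. }
    rewrite E, enorm_pscal, Rabs_pos_eq by lra.
    assert (E1 := enorm_triangle (psub (X s) (padd P (pscal rho d))) (padd P (pscal (rho - r / l) d))).
    assert (E2 := enorm_triangle P (pscal (rho - r / l) d)).
    rewrite (enorm_pscal (rho - r / l)), Hd in E2.
    apply Rle_lt_trans with (l * (2 * (enorm P + 1))); [apply Rmult_le_compat_l; lra|].
    apply Rmult_lt_compat_r with (r := 2 * (enorm P + 1)) in Hl2; [|lra].
    unfold e2 in Hl2; replace (eps / (2 * (enorm P + 1)) * (2 * (enorm P + 1))) with eps in Hl2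
      by (field; lra); exact Hl2.
  - exists (eps / (enorm (X s1) + 1)); split; [apply Rdiv_lt_0_compat; lra|].
    intros l [Hl Hl']; exists s1; split; trivial.
    rewrite <- Hr; replace (pscal 0 d) with (0, 0) by (unfold pscal; f_equal; ring).
    rewrite enorm_psub_0, enorm_pscal, Rabs_pos_eq by lra.
    apply Rmult_lt_compat_r with (r := enorm (X s1) + 1) in Hl'; [|lra].
    replace (eps / (enorm (X s1) + 1) * (enorm (X s1) + 1)) with eps in Hl' by (field; lra); lra.
Qed.

Lemma asymptotic_to_ray_opp a X P d : asymptotic_to_ray (left_end a) X P d ->
  asymptotic_to_ray (right_end (Rbar_opp a)) (fun s => X (- s)) P d.
Proof.
  intros [HM He]; split.
  - intros M; apply (left_end_opp a (fun s => M < enorm (X s))); auto.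
  - intros eps Heps; specialize (He eps Heps); now apply left_end_opp in He.
Qed.

Lemma scaling_small eta : 0 < eta -> exists delta, 0 < delta /\
  forall t, -1 / 2 < t < -1 / 2 + delta -> 0 < sqrt (2 * t + 1) < eta.
Proof.
  intros He; exists (eta ^ 2 / 2).
  assert (H := pow_lt eta 2 He); split; [lra|]; intros t Ht; split.
  - apply sqrt_lt_R0; lra.
  - rewrite <- (sqrt_pow2 eta) by lra; apply sqrt_lt_1_alt; lra.
Qed.

Lemma expander_emerges a b X P d1 d2 : expander_on a b X ->
  asymptotic_to_cone a b X P d1 d2 -> emerges_from_cone a b X d1 d2.
Proof.
  intros HX (Hd1 & Hd2 & _ & HL & HR); assert (Hab := proj1 HX).
  destruct (intv_nonempty _ _ Hab) as [s0 Hs0].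
  assert (HLo := asymptotic_to_ray_opp _ _ _ _ HL); split.
  - intros c (r & Hr & Hc) eps Heps.
    assert (Hscale : exists eta, 0 < eta /\ forall l, 0 < l < eta ->
      exists s, in_intv a b s /\ enorm (psub (pscal l (X s)) c) < eps).
    { destruct Hc as [->| ->].
      - destruct (ray_reached (Rbar_opp b) (Rbar_opp a) (fun s => X (- s)) P d1 r eps)
          as (eta & Heta & H); trivial.
        + destruct (intv_opp _ _ _ Hs0); now apply Rbar_lt_trans with (- s0).
        + intros s; now apply expander_opp_continuous.
        + exists eta; split; trivial; intros l Hl; destruct (H l Hl) as (s & Hs & Hn).
          exists (- s); split; trivial; now apply intv_opp_inv.
      - apply ray_reached with P; trivial.
        intros s; now apply expander_enorm_continuous. }
    destruct Hscale as (eta & Heta & H), (scaling_small eta Heta) as (delta & Hdelta & Ht).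
    exists delta; split; auto.
  - intros Rad eps Heps.
    destruct (left_end_elim a b s0 _ Hs0 (proj2 HL 1 Rlt_0_1)) as (s1 & Hs10 & Hs1 & H1).
    destruct (right_end_elim a b s0 _ Hs0 (proj2 HR 1 Rlt_0_1)) as (s2 & Hs20 & Hs2 & H2).
    destruct (continuity_bounded (fun u => enorm (X u)) s1 s2) as [B HB]; [lra| |].
    { intros z Hz; apply expander_enorm_continuous with a b; trivial.
      now apply intv_between with s1 s2. }
    assert (HB0 : 0 <= B).
    { apply Rle_trans with (2 := HB s0 ltac:(lra)); apply Rabs_pos. }
    assert (HP := enorm_pos P).
    (* On the tails the distance to a ray from the origin is at most [|P| + 1], and on the compact
       middle the norm is at most [B]; [K] dominates both before scaling. *)
    pose (K := enorm P + B + 1); assert (HK : 0 < K) by (unfold K; lra).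
    destruct (scaling_small (eps / K)) as (delta & Hdelta & Ht); [now apply Rdiv_lt_0_compat|].
    exists delta; split; trivial; intros t Htd s Hs _.
    destruct (Ht t Htd) as [Hl Hl']; set (l := sqrt (2 * t + 1)) in *.
    assert (HlK : l * K < eps).
    { apply Rmult_lt_compat_r with (r := K) in Hl'; trivial.
      replace (eps / K * K) with eps in Hl' by (field; lra); exact Hl'. }
    assert (Hnear : forall d r, 0 <= r -> enorm (psub (X s) (padd P (pscal r d))) < 1 ->
      enorm (psub (pscal l (X s)) (pscal (l * r) d)) < eps).
    { intros d r Hr Hn.
      replace (psub (pscal l (X s)) (pscal (l * r) d)) with
        (pscal l (padd (psub (X s) (padd P (pscal r d))) P))
        by (unfold psub, pscal, padd; simpl; f_equal; ring).
      rewrite enorm_pscal, Rabs_pos_eq by lra.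
      assert (E := enorm_triangle (psub (X s) (padd P (pscal r d))) P).
      apply Rle_lt_trans with (2 := HlK), Rmult_le_compat_l; unfold K; lra. }
    destruct (Rle_dec s s1) as [Hss1|Hss1]; [|destruct (Rle_dec s2 s) as [Hss2|Hss2]].
    + destruct (H1 s Hss1 Hs) as (r & Hr & Hn).
      exists (pscal (l * r) d1); split; [|now apply Hnear].
      exists (l * r); split; [apply Rmult_le_pos; lra|now left].
    + destruct (H2 s Hss2 Hs) as (r & Hr & Hn).
      exists (pscal (l * r) d2); split; [|now apply Hnear].
      exists (l * r); split; [apply Rmult_le_pos; lra|now right].
    + exists (pscal 0 d1); split; [exists 0; split; [lra|now left]|].
      replace (pscal 0 d1) with (0, 0) by (unfold pscal; f_equal; ring).
      rewrite enorm_psub_0, enorm_pscal, Rabs_pos_eq by lra.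
      assert (Hb := HB s ltac:(lra)); rewrite Rabs_pos_eq in Hb by apply enorm_pos.
      apply Rle_lt_trans with (2 := HlK), Rmult_le_compat_l; unfold K; lra.
Qed.

(** The distance to the origin has a positive lower bound: it exceeds 1 on both tails and attains a
    nonzero minimum on the compact middle. Scaling then does the rest. *)
Lemma expander_expands a b X P d1 d2 : expander_on a b X ->
  (forall s, in_intv a b s -> X s <> (0, 0)) ->
  asymptotic_to_cone a b X P d1 d2 -> expands_to_infinity a b X.
Proof.
  intros HX Hne (_ & _ & _ & HL & HR); assert (Hab := proj1 HX).
  destruct (intv_nonempty _ _ Hab) as [s0 Hs0].
  destruct (left_end_elim a b s0 _ Hs0 (proj1 HL 1)) as (s1 & Hs10 & Hs1 & H1).
  destruct (right_end_elim a b s0 _ Hs0 (proj1 HR 1)) as (s2 & Hs20 & Hs2 & H2).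
  destruct (continuity_ab_min (fun u => enorm (X u)) s1 s2) as (sm & Hm & Hsm); [lra| |].
  { intros z Hz; apply expander_enorm_continuous with a b; trivial.
    now apply intv_between with s1 s2. }
  pose (m := Rmin 1 (enorm (X sm))).
  assert (Hm0 : 0 < m).
  { apply Rmin_pos; [lra|]; apply enorm_gt_0, Hne; now apply intv_between with s1 s2. }
  assert (Hmin : forall s, in_intv a b s -> m <= enorm (X s)).
  { intros s Hs; destruct (Rle_dec s s1) as [Hss1|Hss1]; [|destruct (Rle_dec s2 s) as [Hss2|Hss2]].
    - assert (H := H1 s Hss1 Hs); assert (H' := Rmin_l 1 (enorm (X sm))); unfold m; lra.
    - assert (H := H2 s Hss2 Hs); assert (H' := Rmin_l 1 (enorm (X sm))); unfold m; lra.
    - apply Rle_trans with (1 := Rmin_r _ _), Hm; lra. }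
  intros Rad; pose (L := (Rabs Rad + 1) / m).
  assert (HR0 := Rabs_pos Rad); assert (HR1 := Rle_abs Rad).
  assert (HL0 : 0 < L) by (apply Rdiv_lt_0_compat; lra).
  exists (L ^ 2); intros t Ht s Hs.
  assert (Hl : L < sqrt (2 * t + 1)).
  { rewrite <- (sqrt_pow2 L) at 1 by lra; apply sqrt_lt_1_alt.
    assert (H := pow2_ge_0 L); lra. }
  rewrite enorm_pscal, Rabs_pos_eq by apply sqrt_pos.
  apply Rlt_le_trans with (L * m).
  - unfold L; replace ((Rabs Rad + 1) / m * m) with (Rabs Rad + 1) by (field; lra); lra.
  - apply Rmult_le_compat; try lra; auto.
Qed.

(** * Classification *)

Definition kind_data (e : end_kind) : end_data :=
  match e with
  | Flat => (false, Finite 0)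
  | Unit => (false, Finite 1)
  | Sharp => (true, p_infty)
  end.

Definition phase_profile (x : end_kind * end_kind * nat) : profile :=
  match x with (eL, eR, n) => (kind_data eL, kind_data eR, n) end.

Lemma kind_data_inj e1 e2 : kind_data e1 = kind_data e2 -> e1 = e2.
Proof.
  destruct e1, e2; simpl; intros H; try reflexivity; try discriminate;
    injection H; lra.
Qed.

Lemma phase_profile_inj x y : phase_profile x = phase_profile y -> x = y.
Proof.
  destruct x as [[x1 x2] n], y as [[y1 y2] m]; simpl; intros H; injection H as H1 H2 H3.
  apply kind_data_inj in H1; apply kind_data_inj in H2; now subst.
Qed.

(** The list never contains a non-symmetric type together with its reversal, so no type is counted
    twice up to reflection. *)
Lemma phase_types_swap eL eR n :
  In (eL, eR, n) phase_types -> In (eR, eL, n) phase_types -> eL = eR.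
Proof.
  destruct eL, eR; trivial; simpl; intros H1 H2; exfalso;
    decompose [or] H1; decompose [or] H2; congruence.
Qed.

Lemma right_kind_limit e b t k f : right_kind e b t k ->
  right_end b (fun s => f s = k s) ->
  fst (kind_data e) = finite_end b /\
  filterlim f (right_end b) (Rbar_locally (snd (kind_data e))).
Proof.
  intros He Hf; destruct e; simpl in *.
  - destruct He as (Hb & Hk & _); split; [now rewrite Hb|].
    intros P [eps HP].
    apply filter_imp with (2 := filter_and _ _ Hf (Hk eps (cond_pos eps))).
    intros s [E H]; rewrite E; apply HP.
    unfold ball; simpl; unfold AbsRing_ball, abs, minus, plus, opp; simpl.
    now rewrite Ropp_0, Rplus_0_r.
  - destruct He as (Hb & Hk); split; [now rewrite Hb|].
    intros P [eps HP].
    apply filter_imp with (2 := filter_and _ _ Hf (Hk eps (cond_pos eps))).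
    intros s [E [H _]]; rewrite E; apply HP, H.
  - destruct He as ([r Hb] & Hk); split; [now rewrite Hb|].
    intros P [M HP].
    apply filter_imp with (2 := filter_and _ _ Hf (Hk M)).
    intros s [E [H _]]; rewrite E; now apply HP.
Qed.

Lemma left_kind_limit e a t k f : left_kind e a t k ->
  left_end a (fun s => f s = k s) ->
  fst (kind_data e) = finite_end a /\
  filterlim f (left_end a) (Rbar_locally (snd (kind_data e))).
Proof.
  intros He Hf; apply left_end_opp in Hf.
  destruct (right_kind_limit _ _ _ _ (fun s => f (- s)) He Hf) as [H1 H2]; split.
  - rewrite H1; now destruct a.
  - intros P HP; apply (left_end_opp a (fun s => P (f s))); exact (H2 P HP).
Qed.

Lemma phase_has_profile eL eR n a b t k X : Rbar_lt a b -> phase eL eR n a b t k ->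
  (forall s, in_intv a b s -> Rabs (curv X s) = k s /\ mink (X s) (X s) = t s ^ 2 - k s ^ 2) ->
  has_profile a b X (phase_profile (eL, eR, n)).
Proof.
  intros Hab (_ & _ & HL & HR & l & Hl1 & Hl2 & Hl3) HX.
  destruct (left_kind_limit _ _ _ _ (fun s => Rabs (curv X s)) HL) as [H1 H2].
  { apply filter_imp with (2 := left_end_intv a b Hab); intros s Hs; now apply HX. }
  destruct (right_kind_limit _ _ _ _ (fun s => Rabs (curv X s)) HR) as [H3 H4].
  { apply filter_imp with (2 := right_end_intv a b Hab); intros s Hs; now apply HX. }
  unfold phase_profile.
  rewrite (surjective_pairing (kind_data eL)), (surjective_pairing (kind_data eR)).
  do 4 (split; [assumption|]).
  exists l; do 2 (split; [assumption|]); intros s; rewrite Hl3; split; intros [Hs E];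
    (split; [assumption|]); destruct (HX s Hs) as [_ Hm]; lra.
Qed.

Lemma positive_expander_classified a b X : nonlinear_expander a b X ->
  (forall s, in_intv a b s -> 0 < curv X s) ->
  exists eL eR n t k, (In (eL, eR, n) phase_types \/ In (eR, eL, n) phase_types) /\
    phase eL eR n a b t k /\
    (forall s, in_intv a b s -> Rabs (curv X s) = k s /\ mink (X s) (X s) = t s ^ 2 - k s ^ 2) /\
    exists P d1 d2, asymptotic_to_cone a b X P d1 d2.
Proof.
  intros HX Hpos.
  destruct (nonlinear_expander_phase a b X HX Hpos)
    as (eL & eR & n & A & t & k & Htype & Hph & Hf & HXc).
  assert (Hab : Rbar_lt a b) by apply HX.
  exists eL, eR, n, t, k; split; trivial; split; trivial; split.
  - intros s Hs; split; [|now apply (flow_mink a b A t k)].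
    rewrite Rabs_pos_eq by (apply Rlt_le; auto); now apply (flow_curv a b A t k).
  - destruct (phase_cone eL eR n a b A t k Hab Hph Hf) as (P & d1 & d2 & H).
    exists P, d1, d2; apply asymptotic_to_cone_ext with (curve A t k); trivial.
    intros s Hs; symmetry; auto.
Qed.

Lemma nonlinear_expander_classified a b X : nonlinear_expander a b X ->
  exists eL eR n t k, (In (eL, eR, n) phase_types \/ In (eR, eL, n) phase_types) /\
    phase eL eR n a b t k /\
    (forall s, in_intv a b s -> Rabs (curv X s) = k s /\ mink (X s) (X s) = t s ^ 2 - k s ^ 2) /\
    exists P d1 d2, asymptotic_to_cone a b X P d1 d2.
Proof.
  intros HX; destruct (nonlinear_expander_convex a b X HX) as [Hpos|Hneg].
  - now apply positive_expander_classified.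
  - destruct (positive_expander_classified a b (fun s => pconj (X s)))
      as (eL & eR & n & t & k & Htype & Hph & Hs & P & d1 & d2 & Hcone).
    + now apply nonlinear_expander_conj.
    + intros s Hs; rewrite curv_conj; specialize (Hneg s Hs); lra.
    + exists eL, eR, n, t, k; split; trivial; split; trivial; split.
      * intros s Hi; rewrite <- Rabs_Ropp, <- curv_conj, <- mink_conj; auto.
      * exists (reflect 1 (-1) P), (reflect 1 (-1) d1), (reflect 1 (-1) d2).
        apply asymptotic_to_cone_ext with (fun s => reflect 1 (-1) (pconj (X s))).
        -- apply HX.
        -- intros s _; unfold reflect, pconj; destruct (X s); simpl; f_equal; ring.
        -- apply asymptotic_to_cone_reflect; trivial; lra.
Qed.

(** At the saddle [A' = A]; the solution [A = exp] gives [x + y = exp s] and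
    [x - y = - exp (- s)]. *)
Lemma hyperbola_expander : nonlinear_expander m_infty p_infty (fun s => (sinh s, cosh s)).
Proof.
  apply (phase_nonlinear_expander Unit Unit 0 m_infty p_infty exp (fun _ => 0) (fun _ => 1)).
  - exact I.
  - exact phase_fixed_point.
  - split; [apply phase_fixed_point|]; intros s _; split.
    + rewrite Rmult_1_l; apply is_derive_exp.
    + assert (H := exp_pos s); lra.
  - intros s _; assert (H := exp_pos s); unfold curve, sinh, cosh.
    rewrite exp_Ropp; f_equal; field; lra.
Qed.

Theorem theorem6p1 :
  (* the expanding hyperbola y^2 - x^2 = 2t+1 (at t = 0) is one of them *)
  nonlinear_expander m_infty p_infty (fun s => (sinh s, cosh s)) /\
  (* there are exactly six types *)
  (exists ps : list profile,
     length ps = 6%nat /\ NoDup ps /\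
     (forall p q, In p ps -> In q ps -> same_type p q -> p = q) /\
     (forall p, In p ps -> exists a b X, nonlinear_expander a b X /\ has_profile a b X p) /\
     (forall a b X, nonlinear_expander a b X ->
        exists p q, In p ps /\ same_type p q /\ has_profile a b X q)) /\
  (* each one is convex, k^2 e^<X,X> is constant, it is asymptotic to a cone,
     and under the flow it comes out of the cone and expands to infinity *)
  (forall a b X, nonlinear_expander a b X ->
     convex_curve a b X /\
     (exists C, forall s, in_intv a b s ->
        (curv X s) ^ 2 * exp (mink (X s) (X s)) = C) /\
     (exists P d1 d2, asymptotic_to_cone a b X P d1 d2 /\
        emerges_from_cone a b X d1 d2 /\ expands_to_infinity a b X)).
Proof.
  split; [exact hyperbola_expander|]; split.
  - exists (map phase_profile phase_types); split; [reflexivity|]; split; [|split; [|split]].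
    + apply FinFun.Injective_map_NoDup; [exact phase_profile_inj|].
      repeat constructor; simpl; intuition discriminate.
    + intros p q Hp Hq Hpq; apply in_map_iff in Hp, Hq.
      destruct Hp as ([[eL eR] n] & <- & Hp), Hq as (y & <- & Hq).
      destruct Hpq as [Hpq|Hpq]; trivial.
      change (phase_profile (eR, eL, n) = phase_profile y) in Hpq.
      apply phase_profile_inj in Hpq; subst y.
      now rewrite (phase_types_swap _ _ _ Hp Hq).
    + intros p Hp; apply in_map_iff in Hp; destruct Hp as ([[eL eR] n] & <- & Hp).
      destruct (phase_realized _ _ _ Hp)
        as (t0 & k0 & Hk0 & a & b & t & k & Hph & Hs0 & _ & _).
      assert (Hab : Rbar_lt a b) by (destruct Hs0; now apply Rbar_lt_trans with 0).
      (* The value [A = 1] at 0 fixes the hyperbolic rotation, under which the profile is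
         invariant. *)
      destruct (flow_exists a b t k 0 1 (proj1 Hph) Hs0 R1_neq_R0) as (A & _ & Hf).
      exists a, b, (curve A t k); split.
      * now apply (phase_nonlinear_expander eL eR n a b A t k).
      * apply (phase_has_profile eL eR n a b t k); trivial; intros s Hs.
        rewrite (flow_curv a b A t k), (flow_mink a b A t k) by trivial; split; trivial.
        apply Rabs_pos_eq, Rlt_le; now apply Hph.
    + intros a b X HX.
      destruct (nonlinear_expander_classified a b X HX)
        as (eL & eR & n & t & k & Htype & Hph & Hs & _).
      assert (Hab : Rbar_lt a b) by apply HX.
      assert (Hprof := phase_has_profile eL eR n a b t k X Hab Hph Hs).
      destruct Htype as [H|H].
      * exists (phase_profile (eL, eR, n)), (phase_profile (eL, eR, n)).
        split; [now apply in_map|]; split; [now left|trivial].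
      * exists (phase_profile (eR, eL, n)), (phase_profile (eL, eR, n)).
        split; [now apply in_map|]; split; [now right|trivial].
  - intros a b X HX; assert (Hon : expander_on a b X) by apply HX.
    assert (Hconv := nonlinear_expander_convex a b X HX).
    split; trivial; split.
    + destruct (intv_nonempty a b (proj1 Hon)) as [s0 Hs0].
      exists (curv X s0 ^ 2 * exp (mink (X s0) (X s0))).
      intros s Hs; now apply (expander_first_integral a b).
    + destruct (nonlinear_expander_classified a b X HX)
        as (eL & eR & n & t & k & _ & _ & _ & P & d1 & d2 & Hcone).
      exists P, d1, d2; split; trivial; split; [now apply expander_emerges with P|].
      apply expander_expands with P d1 d2; trivial.
      (* At the origin the expander equation would give zero curvature, contrary to convexity. *)
      intros s Hs E; destruct (proj2 Hon s Hs) as (_ & _ & _ & _ & _ & Hk).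
      rewrite E in Hk; unfold mink in Hk; simpl in Hk.
      destruct Hconv as [H|H]; specialize (H s Hs); lra.
Qed.
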